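(* For any real number $d\in[1,2]$ there exists a sequence $\mathcal{A}=\{a_i\}_{i=1}^\infty$ of real numbers $a_i>2$ such that $$\dim_{\sf box}(W_{\mathcal{A}})=d.$$
   Context: **Minkowski dimension.** For a bounded set $S\subset\mathbb{R}^n$ and $\epsilon>0$ let $N(\epsilon)$ be the (minimal) number of boxes (cubes; squares if $n=2$) of side length $\epsilon$ required to cover $S$. The upper and lower Minkowski dimensions of $S$ are the $\limsup$ and $\liminf$ of $\ln(N(\epsilon))/\ln(1/\epsilon)$ as $\epsilon\to0^+$; when they agree, the common value is the Minkowski dimension $\dim_{\sf box}(S)$. **Lakes of Wada in the modified Cantor way.** Let $\mathcal{A}=\{a_i\}_{i\ge1}$ be a sequence of real numbers $a_i>2$. Put $t_0=1$, $t_n=\prod_{i=1}^na_i^{-1}$ and $w_n=t_{n-1}(1-\frac2{a_n})$ for $n\ge1$. One constructs closed canals $C_1,C_2,\dots\subset[0,1]^2$ (with $C_n$ dug on Day $n$); the island after Day $n$ is $I_n:=\overline{[0,1]^2\setminus(C_1\cup\dots\cup C_n)}$, with $I_0=[0,1]^2$. For every $n\ge1$, $I_n$ is a rectilinear strip of constant width $t_n$: a finite chain of axis-parallel straight pieces of width $t_n$ joined at right angles by $t_n\times t_n$ corner squares, having two end edges of length $t_n$ and two long sides. The canals have width $w_n$ and are as follows. - Day 1: $C_1=[0,1-\frac1{a_1}]\times[\frac1{a_1},1-\frac1{a_1}]$. The two end edges of $I_1$ lie on the left side $\{x=0\}$ of the square. - Days $n=2,3$: $C_n$ enters $I_{n-1}$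 from the left side $\{x=0\}$ through one of the two end edges of $I_{n-1}$ (the lower one if $n=2$; either one if $n=3$), runs along the middle of the whole strip, leaving land of width $t_n$ on both sides, and stops at distance $t_n$ from the other end edge. - Days $n\ge4$: a peak point of a canal is the midpoint of an edge (of length equal to the width of the canal) in which the canal terminates; $C_1,C_2,C_3$ have one peak point each, and each $C_n$ with $n\ge4$ has two. Choose one peak point $p$ of $C_{n-3}$; it lies on a long side of the strip $I_{n-1}$. The canal $C_n$ starts at $p$, crosses the wall of the strip perpendicularly (by a connecting piece of width $w_n$ with axis through $p$) to the middle of the strip, separates there into two opposite directions, and runs in both directions along the middle of the strip, leaving land of width $t_n$ on both sides, until it stops at distance $t_n$ from each of the two end edges of $I_{n-1}$. (After Day $n$ every point of the island is at distance at most $\sqrt2\,t_n$ from the lake extended on Day $n$.) The lakes $B_{3k+1}$, $R_{3k+2}$, $G_{3k+3}$ ($k\ge0$) are the interiors of $\bigcup_{j=0}^kC_{3j+1}$, $\bigcup_{j=0}^kC_{3j+2}$, $\bigcup_{j=0}^kC_{3j+3}$ respectively. Let $U_B=\bigcup_kB_{3k+1}$, $U_R=\bigcup_kR_{3k+2}$, $U_G=\bigcup_kG_{3k+3}$. These have the same boundary in $(0,1)^2$, and $$W_{\mathcal{A}}:=(0,1)^2\cap\partial U_B=(0,1)^2\cap\partial U_R=(0,1)^2\cap\partial U_G.$$ *)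

(* Defs.v *)
From HB Require Import structures.
From mathcomp Require Import all_boot all_order all_algebra.
From mathcomp Require Import all_classical all_reals all_analysis.

Set Implicit Arguments.
Unset Strict Implicit.
Unset Printing Implicit Defensive.

Import Order.TTheory GRing.Theory Num.Theory.
Import numFieldNormedType.Exports.

Local Open Scope classical_set_scope.
Local Open Scope ring_scope.

Definition frontier {T : topologicalType} (S : set T) : set T :=
  closure S `\` interior S.

Section MinkowskiDimension.
Variable R : realType.
Implicit Types (S : set (R * R)) (e : R) (k : nat).

Definition square (c : R * R) e : set (R * R) :=
  [set z | c.1 <= z.1 <= c.1 + e /\ c.2 <= z.2 <= c.2 + e].

Definition covered_by_squares S e k : Prop :=
  exists c : 'I_k -> R * R, S `<=` \bigcup_(i in [set: 'I_k]) square (c i) e.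

(* Equal to 0 when no finite cover exists; a bounded set always has one. *)
Definition covering_number S e : nat :=
  xget 0%N [set k | covered_by_squares S e k /\
    forall j, covered_by_squares S e j -> (k <= j)%N].

Definition box_ratio S e : \bar R :=
  (ln (covering_number S e)%:R / ln (1 / e))%:E.

Definition upper_box_dim S : \bar R := limf_esup (box_ratio S) 0^'+.
Definition lower_box_dim S : \bar R := limf_einf (box_ratio S) 0^'+.

Definition has_box_dim S (d : R) : Prop :=
  upper_box_dim S = d%:E /\ lower_box_dim S = d%:E.

End MinkowskiDimension.

(* A polyline with m segments is given by its vertices v 0, ..., v m;         *)
(* the values of v beyond m are irrelevant.                                   *)
Section Strips.
Variable R : realType.
Implicit Types (p q : R * R) (v : nat -> R * R) (m i : nat) (r s u w : R).

(* A unit vector, for p <> q on a common axis-parallel line. *)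
Definition dir p q : R * R := (Num.sg (q.1 - p.1), Num.sg (q.2 - p.2)).

(* dir p q turned counterclockwise by a right angle. *)
Definition normal p q : R * R := (- (dir p q).2, (dir p q).1).

Definition move p r (n : R * R) : R * R := (p.1 + r * n.1, p.2 + r * n.2).

(* The vertices of the polyline parallel to v at signed distance u (to the    *)
(* left for u > 0): at an inner vertex both adjacent segments are shifted.    *)
Definition parallel m v u i : R * R :=
  let q := if (i == 0)%N then v i else move (v i) u (normal (v i.-1) (v i)) in
  if (i == m)%N then q else move q u (normal (v i) (v i.+1)).

Definition parallel_pt m v i s u : R * R :=
  let p := parallel m v u i in
  let q := parallel m v u i.+1 in
  ((1 - s) * p.1 + s * q.1, (1 - s) * p.2 + s * q.2).

(* The strip of width w with middle line v, swept out by the parallel lines   *)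
(* at distance at most w / 2. Around an inner vertex, where v turns by a      *)
(* right angle, they sweep out the w x w corner square; the two long sides    *)
(* are the parallel lines at distance w / 2, and the two end edges are the    *)
(* perpendicular segments of length w centred at v 0 and v m.                 *)
Definition strip m v w : set (R * R) :=
  [set z | exists i s u,
    [/\ (i < m)%N, 0 <= s <= 1, `|u| <= w / 2 & z = parallel_pt m v i s u]].

Definition rectilinear m v : Prop :=
  (forall i, (i < m)%N ->
     ((v i).1 == (v i.+1).1) != ((v i).2 == (v i.+1).2)) /\
  (forall i, (i.+1 < m)%N ->
     ((v i).1 == (v i.+1).1) != ((v i.+1).1 == (v i.+2).1)).

(* The parallel lines sweeping out the strip are simple and pairwise          *)
(* disjoint, i.e. the strip does not overlap itself. Turning left and then    *)
(* right is possible after an arbitrarily short straight way, in which case   *)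
(* the two corner squares of the strip overlap. This cannot be excluded:      *)
(* such jogs do appear in the islands below when the a_n are close to 2.      *)
Definition non_overlapping m v w : Prop :=
  forall i j s s' u u', (i < m)%N -> (j < m)%N ->
    0 <= s <= 1 -> 0 <= s' <= 1 -> `|u| <= w / 2 -> `|u'| <= w / 2 ->
    parallel_pt m v i s u = parallel_pt m v j s' u' ->
    i%:R + s = j%:R + s' /\ u = u'.

Definition is_strip m v w (S : set (R * R)) : Prop :=
  [/\ (0 < m)%N, rectilinear m v, non_overlapping m v w & S = strip m v w].

Definition cut_start v r : nat -> R * R :=
  fun i => if (i == 0)%N then move (v 0%N) r (dir (v 0%N) (v 1%N)) else v i.

Definition cut_end m v r : nat -> R * R :=
  fun i => if (i == m)%N then move (v m) r (dir (v m) (v m.-1)) else v i.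

(* The rectangle of width w whose axis is the segment from p to q. *)
Definition bar p q w : set (R * R) :=
  strip 1%N (fun i => if (i == 0)%N then p else q) w.

End Strips.

Section LakesOfWada.
Variable R : realType.
(* Days are counted from 1: the terms with index 0 of a, C and P below are    *)
(* not used.                                                                  *)
Implicit Types (a : nat -> R) (C P : nat -> set (R * R)) (n k c : nat).

Definition unit_square : set (R * R) :=
  [set z | 0 <= z.1 <= 1 /\ 0 <= z.2 <= 1].

Definition open_unit_square : set (R * R) :=
  [set z | 0 < z.1 < 1 /\ 0 < z.2 < 1].

Definition land_width a n : R := \prod_(1 <= i < n.+1) (a i)^-1.

Definition canal_width a n : R := land_width a n.-1 * (1 - 2 / a n).

Definition island C n : set (R * R) :=
  closure (unit_square `\` \bigcup_(i in [set i | (1 <= i <= n)%N]) C i).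

(* C n is the canal dug on Day n and P n is the set of its peak points. *)

Definition first_canal a C P : Prop :=
  C 1%N = [set z | 0 <= z.1 <= 1 - (a 1%N)^-1 /\
                   (a 1%N)^-1 <= z.2 <= 1 - (a 1%N)^-1] /\
  P 1%N = [set (1 - (a 1%N)^-1, 1 / 2)].

(* Days 2 and 3: the canal enters through the end edge at v 0. *)
Definition side_canal a C P n : Prop :=
  exists m v,
    let mid := cut_end m v (land_width a n) in
    [/\ is_strip m v (land_width a n.-1) (island C n.-1),
        (v 0%N).1 = 0,
        n = 2%N -> (v 0%N).2 < (v m).2,
        C n = strip m mid (canal_width a n) &
        P n = [set mid m]].

(* Days n >= 4: p = parallel_pt m v i s u lies on a long side of the strip,   *)
(* at a place where this side is parallel to the segment from v i to          *)
(* v i.+1, and q is the foot of the perpendicular to this segment.            *)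
Definition peak_canal a C P n : Prop :=
  exists m v i s u,
    let mid := cut_start (cut_end m v (land_width a n)) (land_width a n) in
    let p := parallel_pt m v i s u in
    let q := move p (- u) (normal (v i) (v i.+1)) in
    [/\ is_strip m v (land_width a n.-1) (island C n.-1),
        [/\ (i < m)%N, 0 <= s <= 1 & `|u| = land_width a n.-1 / 2],
        P (n - 3)%N p,
        C n = bar p q (canal_width a n) `|` strip m mid (canal_width a n) &
        P n = [set mid 0%N; mid m]].

Definition wada_canals a C P : Prop :=
  [/\ first_canal a C P,
      forall n, (2 <= n <= 3)%N -> side_canal a C P n &
      forall n, (4 <= n)%N -> peak_canal a C P n].

(* The lakes B_{3k+1}, R_{3k+2}, G_{3k+3} are lake C c k for c = 1, 2, 3. *)
Definition lake C c k : set (R * R) :=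
  interior (\bigcup_(j in [set j | (j <= k)%N]) C (3 * j + c)%N).

Definition final_lake C c : set (R * R) :=
  \bigcup_(k in [set: nat]) lake C c k.

Definition wada_set C : set (R * R) :=
  open_unit_square `&` frontier (final_lake C 1%N).

End LakesOfWada.

(* Main.v *)
(* Put delta = d - 1 and choose the a_n so that the land widths are           *)
(* t_n = 2^(- S_n), where S_n = n (n + 2) / (n delta + 1). Then               *)
(* n / S_n -> delta and S_(n+1) / S_n -> 1.                                   *)
(* The canals exist since the shore of a canal dug in a strip can be followed *)
(* explicitly, so that the new island is again a strip; a peak point becomes  *)
(* the midpoint of an edge at which the strip makes a U-turn, and this edge   *)
(* is wide enough for the bar starting there since w_n < w_(n-3).             *)
(* For every choice of the canals, comparing areas shows that the length of   *)
(* the island I_n lies between 2^n / 2 and 3 * 2^n. A point of W is near I_n  *)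
(* or on a shore of one of the first n canals, which have a total length of   *)
(* order 2^n; hence about 2^n / t_n squares of side 8 t_n cover W.            *)
(* Conversely each point of I_n is within 4 t_n of the intersection of all    *)
(* islands, which lies in W inside the open square; since I_n has area at     *)
(* least 2^n t_n / 2, this many squares of side t_n are needed, up to a       *)
(* constant. The dimension is therefore lim (n + S_n) / S_n = 1 + delta.      *)
Require Import Defs.
From HB Require Import structures.
From mathcomp Require Import all_boot all_order all_algebra.
From mathcomp Require Import ring lra zify.
From mathcomp Require Import all_classical all_reals all_analysis.
From mathcomp Require Import measurable_realfun.
Set Implicit Arguments.
Unset Strict Implicit.
Unset Printing Implicit Defensive.
Import Order.TTheory GRing.Theory Num.Theory.
Import numFieldNormedType.Exports.
Local Open Scope classical_set_scope.
Local Open Scope ring_scope.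

(** * Rectilinear strips in coordinates along their middle line *)

(** Write t_n = 2^(- S_n) for the land widths, I_n for the islands and W for the common boundary.
    Each canal runs along the middle of a strip and leaves two strips of about the same length, so
    I_n is a strip of width t_n whose length is of order 2^n. Comparing areas proves this for every
    admissible choice of end edges and peak points ([tlen_bounds]). At scale t_n the set W looks
    like I_n, so its covering number there is of order 2^n / t_n, and the dimension is 1 + lim n /
    S_n, provided that S_(n+1) / S_n -> 1, so that the scales t_n control all the others. The
    constraint a_n > 2 says that S_n grows by more than 1 each day; under it n / S_n can tend to any
    delta in [0, 1].

    The upper count is [covers_wada]. Points of W near I_n are covered along the middle line of I_n.
    A point of W farther away is surrounded by the first n canals only and is a boundary point of
    one of them; [canal_frontier] then puts it on a shore, possibly of an earlier canal, and the
    shores involved have total length of order 2^n.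

    The lower count is [wada_covers_ge]. By [next_island] and compactness each point of I_n has a
    point common to all islands within 4 t_n ([near_kernel]), and inside the open square such common
    points belong to W ([kernel_wada]). Hence enlarged squares of a cover of W, together with a thin
    border of the unit square, cover I_n, whose area is known.

    Existence of the canals is a separate matter. [next_chain] follows the land left by a canal as a
    new polyline; [good_next] shows that its strip does not overlap itself and [closure_dug] that it
    is the new island. The new polyline keeps the new canal on its left and all older shores on its
    right. A peak point stays the midpoint of an edge between two equal turns ([peak_new],
    [peak_left], [peak_right]), so three days later a bar can start there, being narrower than this
    edge ([canal_widths_decrease]).

    All strips are treated in coordinates: the abscissa x along a segment and the signed offset u
    from it. [is_strip_good] and [good_is_strip] translate between these and [is_strip]. *)

Section Paths.
Variable R : realType.
Implicit Types (p d : R * R) (x u w : R) (k m : nat).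

Definition axis d : Prop :=
  [\/ d = (1, 0), d = (-1, 0), d = (0, 1) | d = (0, -1)].

Definition perp d : R * R := (- d.2, d.1).

Definition pt p d x u : R * R :=
  (p.1 + x * d.1 - u * d.2, p.2 + x * d.2 + u * d.1).

Definition cross d d' : R := d.1 * d'.2 - d.2 * d'.1.

(** Directions and lengths are stored beside the vertices, so that coordinate computations are
    linear and free of signs and absolute values; [polyline] expresses their consistency. *)
Record chain := Chain {
  psize : nat;
  vert : nat -> R * R;
  pdir : nat -> R * R;
  plen : nat -> R }.

Implicit Types c : chain.

(* Left turns count 1, right turns -1, and the two ends 0. *)
Definition turn c k : R :=
  if (0 < k < psize c)%N then cross (pdir c k.-1) (pdir c k) else 0.

(* The quadrilateral swept out by segment k is lo c k u <= x <= hi c k u in   *)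
(* the frame at vert c k whose x-axis is pdir c k.                            *)
Definition lo c k u : R := turn c k * u.
Definition hi c k u : R := plen c k - turn c k.+1 * u.

Definition cpt c k x u : R * R := pt (vert c k) (pdir c k) x u.

Definition polyline c : Prop :=
  [/\ (0 < psize c)%N,
      forall k, (k < psize c)%N -> axis (pdir c k),
      forall k, (k < psize c)%N -> 0 < plen c k,
      forall k, (k < psize c)%N -> vert c k.+1 = cpt c k (plen c k) 0 &
      forall k, (k.+1 < psize c)%N -> turn c k.+1 = 1 \/ turn c k.+1 = -1].

Definition dom c w k x u : Prop :=
  [/\ (k < psize c)%N, - (w / 2) <= u <= w / 2 & lo c k u <= x <= hi c k u].

Definition ribbon c w : set (R * R) :=
  [set z | exists k x u, dom c w k x u /\ z = cpt c k x u].

Definition thick c w : Prop := forall k u, (k < psize c)%N ->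
  - (w / 2) <= u <= w / 2 -> lo c k u < hi c k u.

(** The last two alternatives are the mitre between consecutive segments, whose points have
    coordinates in both. *)
Definition embedded c w : Prop := forall k x u l y u',
  dom c w k x u -> dom c w l y u' -> cpt c k x u = cpt c l y u' ->
  u = u' /\ [\/ k = l /\ x = y,
               [/\ l = k.+1, x = hi c k u & y = lo c l u] |
               [/\ k = l.+1, y = hi c l u & x = lo c k u]].

Definition good c w : Prop := [/\ polyline c, thick c w & embedded c w].

Lemma axis_perp d : axis d -> axis (perp d).
Proof.
by case=> ->; rewrite /axis /perp /= ?oppr0 ?opprK;
  [constructor 3|constructor 4|constructor 2|constructor 1].
Qed.

Lemma axisN d : axis d -> axis (- d.1, - d.2).
Proof.
by case=> ->; rewrite /axis /= ?oppr0 ?opprK;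
  [constructor 2|constructor 1|constructor 4|constructor 3].
Qed.

Lemma pt_inj p d x u x' u' : axis d -> pt p d x u = pt p d x' u' ->
  x = x' /\ u = u'.
Proof. by case=> -> [] /= *; split; lra. Qed.

Lemma dir_pt p d x : axis d -> 0 < x -> dir p (pt p d x 0) = d.
Proof.
move=> ax x0; rewrite /dir /pt /=.
have -> : p.1 + x * d.1 - 0 * d.2 - p.1 = x * d.1 by ring.
have -> : p.2 + x * d.2 + 0 * d.1 - p.2 = x * d.2 by ring.
rewrite !sgrM gtr0_sg// !mul1r.
by case: ax => -> /=; rewrite ?sgrN ?sgr1 ?sgr0.
Qed.

Lemma cross_turn c k : polyline c -> (k.+1 < psize c)%N ->
  turn c k.+1 = cross (pdir c k) (pdir c k.+1).
Proof. by move=> _ km; rewrite /turn /= km. Qed.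

Lemma turn0 c : turn c 0 = 0. Proof. by []. Qed.

Lemma turnm c : turn c (psize c) = 0.
Proof. by rewrite /turn ltnn andbF. Qed.

Lemma dir_vert c k : polyline c -> (k < psize c)%N ->
  dir (vert c k) (vert c k.+1) = pdir c k.
Proof.
by case=> _ ax L0 nx _ km; rewrite nx// dir_pt//; [exact: ax|exact: L0].
Qed.

Lemma cpt_joint c k u : polyline c -> (k.+1 < psize c)%N ->
  cpt c k (hi c k u) u = cpt c k.+1 (lo c k.+1 u) u.
Proof.
move=> pc km; have := cross_turn pc km.
case: pc => _ ax _ nx tn; have := tn _ km.
rewrite /cpt /hi /lo nx; last exact: ltnW.
move: (turn c k.+1) => t; rewrite /cpt /pt /cross.
case: (ax _ (ltnW km)) => ->; case: (ax _ km) => -> /=; case=> -> E;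
  try (exfalso; lra); congr pair; ring.
Qed.

Lemma normal_vert c k : polyline c -> (k < psize c)%N ->
  normal (vert c k) (vert c k.+1) = perp (pdir c k).
Proof. by move=> pc km; rewrite /normal dir_vert. Qed.

Lemma parallel_lo c k u : polyline c -> (k < psize c)%N ->
  parallel (psize c) (vert c) u k = cpt c k (lo c k u) u.
Proof.
move=> pc km; rewrite /parallel (ltn_eqF km) normal_vert//.
case: k km => [|k] km.
  by rewrite /lo turn0 mul0r /cpt /pt /move /=; congr pair; ring.
have := cross_turn pc km; rewrite [k.+1.-1]/= normal_vert ?(ltnW km)//.
case: pc => _ ax _ nx tn; have := tn _ km; rewrite /cpt /lo.
move: (turn c k.+1) => t; rewrite /pt /move /cross /perp /=.
case: (ax _ (ltnW km)) => ->; case: (ax _ km) => -> /=; case=> -> E;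
  try (exfalso; lra); congr pair; ring.
Qed.

Lemma parallel_hi c k u : polyline c -> (k < psize c)%N ->
  parallel (psize c) (vert c) u k.+1 = cpt c k (hi c k u) u.
Proof.
move=> pc km; have [km1|] := ltnP k.+1 (psize c).
  by rewrite parallel_lo// cpt_joint.
move=> mk; have E : k.+1 = psize c by apply/eqP; rewrite eqn_leq km mk.
rewrite /parallel E eqxx -E [k.+1.-1]/= [(k.+1 == 0)%N]/= normal_vert//.
have -> : hi c k u = plen c k by rewrite /hi E turnm mul0r subr0.
case: pc => _ _ _ nx _; rewrite nx// /cpt /pt /move /=.
by congr pair; ring.
Qed.

Lemma parallel_ptE c k s u : polyline c -> (k < psize c)%N ->
  parallel_pt (psize c) (vert c) k s u =
  cpt c k ((1 - s) * lo c k u + s * hi c k u) u.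
Proof.
move=> pc km; rewrite /parallel_pt parallel_lo// parallel_hi//.
by rewrite /cpt /pt /=; congr pair; ring.
Qed.

Lemma strip_ribbon c w : polyline c -> thick c w ->
  strip (psize c) (vert c) w = ribbon c w.
Proof.
move=> pc th; rewrite eqEsubset; split=> z.
  move=> [k [s [u [km /andP[s0 s1] uw ->]]]].
  rewrite parallel_ptE//; exists k, ((1 - s) * lo c k u + s * hi c k u), u.
  have uw' : - (w / 2) <= u <= w / 2 by rewrite -ler_norml.
  split=> //; split=> //; have := th k u km uw'; move: (lo _ _ _) (hi _ _ _).
  by move=> l h lh; apply/andP; split; nra.
move=> [k [x [u [[km uw /andP[lx xh]] ->]]]].
have lh := th k u km uw.
exists k, ((x - lo c k u) / (hi c k u - lo c k u)), u.
have hl : 0 < hi c k u - lo c k u by lra.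
split=> //; first by rewrite divr_ge0 ?ler_pdivrMr; lra.
  by rewrite ler_norml.
by rewrite parallel_ptE//; congr cpt; field; lra.
Qed.

(** If the parallel line at offset u were reduced to a point or reversed on segment k, then by
    linearity some offset u' between 0 and u would shrink the segment to a point, and there s = 0
    and s = 1 give the same point. *)
Lemma non_overlapping_thick c w : polyline c ->
  non_overlapping (psize c) (vert c) w -> thick c w.
Proof.
move=> pc no k u km uw; rewrite ltNge; apply/negP => hl.
have L0 : 0 < plen c k by case: pc => _ _ + _ _; apply.
pose e := turn c k.+1 * u + turn c k * u.
have eL : plen c k <= e by move: hl; rewrite /hi /lo /e; lra.
pose u' := u * (plen c k / e).
have lam : 0 <= plen c k / e <= 1.
  by rewrite divr_ge0 ?ler_pdivrMr/=; lra.
have hl' : hi c k u' = lo c k u'.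
  have e0 : e != 0 by rewrite gt_eqF//; lra.
  apply/eqP; rewrite -subr_eq0; apply/eqP.
  transitivity (plen c k * (1 - e / e)); last by rewrite divff// subrr mulr0.
  by rewrite /hi /lo /u' {3}/e; ring.
have uw' : `|u'| <= w / 2.
  rewrite /u' normrM (ger0_norm (andP lam).1) -ler_norml in uw *.
  by apply: le_trans uw; rewrite ler_piMr//; case/andP: lam.
have := @no k k 0 1 u' u' km km; rewrite !lexx !ler01 /= => /(_ isT isT uw' uw').
rewrite !parallel_ptE// hl' => /(_ _)[|]; first by congr cpt; ring.
lra.
Qed.

(** For k < l the equality k + s = l + s' with s, s' in [0, 1] leaves only s = 1, s' = 0 and l = k +
    1, which is the joint. *)
Lemma non_overlapping_embedded c w : polyline c ->
  non_overlapping (psize c) (vert c) w -> embedded c w.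
Proof.
move=> pc no k x u l y u' [km uw /andP[lx xh]] [lm uw' /andP[ly yh]] E.
have th := non_overlapping_thick pc no.
have h1 := th _ _ km uw; have h2 := th _ _ lm uw'.
pose s := (x - lo c k u) / (hi c k u - lo c k u).
pose s' := (y - lo c l u') / (hi c l u' - lo c l u').
have hl : 0 < hi c k u - lo c k u by lra.
have hl' : 0 < hi c l u' - lo c l u' by lra.
have s01 : 0 <= s <= 1 by rewrite divr_ge0 ?ler_pdivrMr/=; lra.
have s01' : 0 <= s' <= 1 by rewrite divr_ge0 ?ler_pdivrMr/=; lra.
have xE : x = (1 - s) * lo c k u + s * hi c k u by rewrite /s; field; lra.
have yE : y = (1 - s') * lo c l u' + s' * hi c l u' by rewrite /s'; field; lra.
have /= := @no k l s s' u u' km lm s01 s01'.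
rewrite !ler_norml !parallel_ptE// -xE -yE => /(_ uw uw' E)[S U].
split=> //; rewrite -U in yE.
have [kl|lk|kl] := ltngtP k l.
- have : (k%:R + 1 <= l%:R :> R) by rewrite natr1 ler_nat.
  move=> kl'; have s1 : s = 1 by lra.
  have s0 : s' = 0 by lra.
  constructor 2; split; last 2 first.
  + by rewrite xE s1; ring.
  + by rewrite yE s0; ring.
  by apply/eqP; rewrite -(eqr_nat R); apply/eqP; rewrite -natr1; lra.
- have : (l%:R + 1 <= k%:R :> R) by rewrite natr1 ler_nat.
  move=> kl'; have s1 : s' = 1 by lra.
  have s0 : s = 0 by lra.
  constructor 3; split; last 2 first.
  + by rewrite yE s1; ring.
  + by rewrite xE s0; ring.
  by apply/eqP; rewrite -(eqr_nat R); apply/eqP; rewrite -natr1; lra.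
- constructor 1; split=> //; rewrite xE yE -kl.
  by have -> : s = s' by rewrite kl in S; lra.
Qed.

Lemma good_non_overlapping c w : good c w ->
  non_overlapping (psize c) (vert c) w.
Proof.
move=> [pc th em] i j s s' u u' im jm s01 s01'; rewrite !ler_norml => uw uw'.
rewrite !parallel_ptE// => E.
have h1 := th _ _ im uw; have h2 := th _ _ jm uw'.
have [] := @em _ _ _ _ _ _ _ _ E.
- split=> //; move: h1; move: (lo _ _ _) (hi _ _ _) => l h lh.
  by apply/andP; split; nra.
- split=> //; move: h2; move: (lo _ _ _) (hi _ _ _) => l h lh.
  by apply/andP; split; nra.
move=> uu D; split=> //; move: h1 h2; rewrite -uu.
move=> h1 h2; rewrite -uu in D; case: D => [[ij]|[ij H1 H2]|[ij H1 H2]].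
- subst j => H; congr (_ + _).
  have /eqP : (s - s') * (hi c i u - lo c i u) = 0 by lra.
  by rewrite mulf_eq0 => /orP[] /eqP; lra.
- subst j; have /eqP : (1 - s) * (hi c i u - lo c i u) = 0 by lra.
  have /eqP : s' * (hi c i.+1 u - lo c i.+1 u) = 0 by lra.
  rewrite !mulf_eq0 [_.+1%:R]mulrSr => /orP[] /eqP; last by move=> ? _; lra.
  by move=> ? /orP[] /eqP; lra.
- subst i; have /eqP : (1 - s') * (hi c j u - lo c j u) = 0 by lra.
  have /eqP : s * (hi c j.+1 u - lo c j.+1 u) = 0 by lra.
  rewrite !mulf_eq0 [_.+1%:R]mulrSr => /orP[] /eqP; last by move=> ? _; lra.
  by move=> ? /orP[] /eqP; lra.
Qed.

Definition path_of m (v : nat -> R * R) : chain :=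
  Chain m v (fun k => dir (v k) (v k.+1))
    (fun k => `|(v k.+1).1 - (v k).1| + `|(v k.+1).2 - (v k).2|).

Lemma rectilinear_polyline m v : (0 < m)%N -> rectilinear m v ->
  polyline (path_of m v).
Proof.
move=> m0 [r1 r2].
have D k : (k < m)%N -> [/\ axis (pdir (path_of m v) k),
   0 < plen (path_of m v) k,
   v k.+1 = cpt (path_of m v) k (plen (path_of m v) k) 0 &
   ((v k).1 == (v k.+1).1) = ((pdir (path_of m v) k).1 == 0)].
  move=> /r1; rewrite /cpt /pt /= /dir; move: (v k) (v k.+1) => [a b] [a' b'] /=.
  rewrite sgr_eq0 subr_eq0 [a' == a]eq_sym.
  have [<-|ab] := eqVneq a a'; have [<-|bb] := eqVneq b b' => // _.
    rewrite !subrr sgr0 normr0 add0r normr_gt0 subr_eq0 eq_sym bb.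
    have [lt|gt|/eqP] := ltrgtP b b'; last by rewrite (negPf bb).
      rewrite gtr0_sg ?gtr0_norm ?subr_gt0//; split=> //; first by constructor 3.
      by congr pair; ring.
    rewrite ltr0_sg ?ltr0_norm ?subr_lt0//; split=> //; first by constructor 4.
    by congr pair; ring.
  rewrite !subrr sgr0 normr0 addr0 normr_gt0 subr_eq0 eq_sym ab.
  have [lt|gt|/eqP] := ltrgtP a a'; last by rewrite (negPf ab).
    rewrite gtr0_sg ?gtr0_norm ?subr_gt0//; split=> //; first by constructor 1.
    by congr pair; ring.
  rewrite ltr0_sg ?ltr0_norm ?subr_lt0//; split=> //; first by constructor 2.
  by congr pair; ring.
split=> // k; do ?[by case/D].
move=> km.
have -> : turn (path_of m v) k.+1 =
    cross (pdir (path_of m v) k) (pdir (path_of m v) k.+1).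
  by rewrite /turn /= km.
have /D[ax1 _ _ e1] := ltnW km; have /D[ax2 _ _ e2] := km.
have := r2 _ km; rewrite e1 e2 => {e1 e2}; move: ax1 ax2.
by case=> ->; case=> ->; rewrite /cross /= ?oppr_eq0 ?oner_eq0 ?eqxx//= => _;
  first [left; ring | right; ring].
Qed.

Lemma polyline_rectilinear c : polyline c -> rectilinear (psize c) (vert c).
Proof.
move=> pc; have [_ ax L0 nx tn] := pc.
have H j : (j < psize c)%N ->
    (((vert c j).1 == (vert c j.+1).1) = ((pdir c j).1 == 0)) /\
    (((vert c j).2 == (vert c j.+1).2) = ((pdir c j).2 == 0)).
  move=> jm; rewrite nx// /cpt /pt /= !mul0r subr0 addr0.
  by split; rewrite eq_sym -subr_eq0 addrAC subrr add0r mulf_eq0 gt_eqF//;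
    exact: L0.
split=> k km.
  have [-> ->] := H _ km.
  by case: (ax _ km) => -> /=; rewrite ?oppr_eq0 ?oner_eq0 ?eqxx.
have [-> _] := H _ km; have [-> _] := H _ (ltnW km).
have := tn _ km; rewrite cross_turn// /cross.
case: (ax _ (ltnW km)) => ->; case: (ax _ km) => -> /=;
  rewrite ?oppr_eq0 ?oner_eq0 ?eqxx//;
 by move=> H1; exfalso; case: H1; lra.
Qed.

Lemma is_strip_good m v w S : is_strip m v w S ->
  good (path_of m v) w /\ S = ribbon (path_of m v) w.
Proof.
move=> [m0 rl no SE]; have pc := rectilinear_polyline m0 rl.
have th := @non_overlapping_thick (path_of m v) w pc no.
split; last by rewrite SE -strip_ribbon.
by split=> //; exact: (@non_overlapping_embedded (path_of m v)).
Qed.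

Lemma good_is_strip c w : good c w ->
  is_strip (psize c) (vert c) w (ribbon c w).
Proof.
move=> gc; have [pc th em] := gc; split.
- by case: pc.
- exact: polyline_rectilinear.
- exact: good_non_overlapping.
- by rewrite strip_ribbon.
Qed.

End Paths.

(** * Trapezoids, and the canal along the middle of a strip *)

Section Trapezoids.
Variable R : realType.
Implicit Types (p d : R * R) (x u w t : R) (k m : nat) (c : chain R).

Definition trap p d (a b l0 l1 h0 h1 : R) : set (R * R) :=
  [set z | exists x u, [/\ a <= u <= b, l0 + l1 * u <= x <= h0 + h1 * u &
                           z = pt p d x u]].

Definition coordx p d (z : R * R) : R :=
  (z.1 - p.1) * d.1 + (z.2 - p.2) * d.2.

Definition coordu p d (z : R * R) : R :=
  (z.2 - p.2) * d.1 - (z.1 - p.1) * d.2.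

Lemma pt_coord p d z : axis d -> pt p d (coordx p d z) (coordu p d z) = z.
Proof.
by rewrite /pt /coordx /coordu; case: z => z1 z2; case=> -> /=; congr pair; ring.
Qed.

Lemma coordx_pt p d x u : axis d -> coordx p d (pt p d x u) = x.
Proof. by rewrite /pt /coordx; case=> -> /=; ring. Qed.

Lemma coordu_pt p d x u : axis d -> coordu p d (pt p d x u) = u.
Proof. by rewrite /pt /coordu; case=> -> /=; ring. Qed.

Lemma trapE p d a b l0 l1 h0 h1 : axis d -> trap p d a b l0 l1 h0 h1 =
  [set z | a <= coordu p d z <= b /\
           l0 + l1 * coordu p d z <= coordx p d z <= h0 + h1 * coordu p d z].
Proof.
move=> ax; rewrite eqEsubset; split=> z /=.
  by move=> [x [u [? ? ->]]]; rewrite coordx_pt// coordu_pt.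
by move=> [? ?]; exists (coordx p d z), (coordu p d z); rewrite pt_coord.
Qed.

Lemma continuous_coord (a b e : R) :
  continuous (fun z : R * R => a * z.1 + b * z.2 + e).
Proof.
move=> z; apply: cvgD; last exact: cvg_cst.
by apply: cvgD; apply: cvgM; (try exact: cvg_cst); [exact: cvg_fst|exact: cvg_snd].
Qed.

Lemma closed_halfplane (a b e : R) :
  closed [set z : R * R | 0 <= a * z.1 + b * z.2 + e].
Proof.
rewrite (_ : mkset _ = (fun z : R * R => a * z.1 + b * z.2 + e) @^-1`
  [set x | 0 <= x])//.
by apply: closed_comp; [move=> z _; exact: continuous_coord|exact: closed_ge].
Qed.

Lemma closed_trap p d a b l0 l1 h0 h1 : axis d ->
  closed (trap p d a b l0 l1 h0 h1).
Proof.
move=> ax; rewrite trapE//.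
have -> : [set z | a <= coordu p d z <= b /\
           l0 + l1 * coordu p d z <= coordx p d z <= h0 + h1 * coordu p d z]
  = [set z | 0 <= (- d.2) * z.1 + d.1 * z.2 + (p.1 * d.2 - p.2 * d.1 - a)] `&`
    [set z | 0 <= d.2 * z.1 + (- d.1) * z.2 + (b - (p.1 * d.2 - p.2 * d.1))] `&`
    [set z | 0 <= (d.1 + l1 * d.2) * z.1 + (d.2 - l1 * d.1) * z.2 +
      (- (p.1 * d.1 + p.2 * d.2) - l0 - l1 * (p.1 * d.2 - p.2 * d.1))] `&`
    [set z | 0 <= (- d.1 - h1 * d.2) * z.1 + (- d.2 + h1 * d.1) * z.2 +
      (p.1 * d.1 + p.2 * d.2 + h0 + h1 * (p.1 * d.2 - p.2 * d.1))].
  rewrite eqEsubset /coordx /coordu; split=> z /=.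
    by move=> [/andP[? ?] /andP[? ?]]; repeat split; lra.
  by move=> [[[? ?] ?] ?]; split; lra.
by repeat apply: closedI; exact: closed_halfplane.
Qed.

Definition rect c k (a b l h : R) : set (R * R) :=
  trap (vert c k) (pdir c k) a b l 0 h 0.

Definition quad c k (a b : R) : set (R * R) :=
  trap (vert c k) (pdir c k) a b 0 (turn c k) (plen c k) (- turn c k.+1).

Lemma quadP c k a b z : quad c k a b z <->
  exists x u, [/\ a <= u <= b, lo c k u <= x <= hi c k u & z = cpt c k x u].
Proof.
split=> -[x [u [H1 H2 H3]]]; exists x, u; split=> //;
  by move: H2; rewrite /lo /hi ?add0r ?mulNr.
Qed.

Lemma ribbonE c w :
  ribbon c w = \bigcup_(k in `I_(psize c)) quad c k (- (w / 2)) (w / 2).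
Proof.
rewrite eqEsubset; split=> z.
  by move=> [k [x [u [[km uw lh] E]]]]; exists k => //; apply/quadP; exists x, u.
by move=> [k /= km /quadP[x [u [? ? ?]]]]; exists k, x, u.
Qed.

Lemma closed_ribbon c w : polyline c -> closed (ribbon c w).
Proof.
move=> [_ ax _ _ _]; rewrite ribbonE; apply: closed_bigcup => // k km.
by apply: closed_trap; exact: ax.
Qed.

(* The middle of a strip of width w + 2 t, at distance t from the sides, from *)
(* the far end, and from the near end if b holds.                             *)
Definition clo c (b : bool) t k u : R :=
  if b && (k == 0)%N then t else lo c k u.
Definition chi c t k u : R :=
  if (k.+1 == psize c)%N then plen c k - t else hi c k u.

Definition middle c b w t : set (R * R) :=
  [set z | exists k x u, [/\ (k < psize c)%N, - (w / 2) <= u <= w / 2,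
     clo c b t k u <= x <= chi c t k u & z = cpt c k x u]].

Lemma middleE c b w t : middle c b w t = \bigcup_(k in `I_(psize c))
  trap (vert c k) (pdir c k) (- (w / 2)) (w / 2)
   (if b && (k == 0)%N then t else 0) (if b && (k == 0)%N then 0 else turn c k)
   (if (k.+1 == psize c)%N then plen c k - t else plen c k)
   (if (k.+1 == psize c)%N then 0 else - turn c k.+1).
Proof.
rewrite eqEsubset; split=> z.
  move=> [k [x [u [km uw]]]]; rewrite /clo /chi /lo /hi => lh E.
  exists k => //; exists x, u; split=> //; move: lh.
  by case: ifP => _; case: ifP => _; rewrite ?mul0r ?addr0 ?add0r ?mulNr.
move=> [k km [x [u [uw lh E]]]]; exists k, x, u; split=> //; move: lh.
rewrite /clo /chi /lo /hi.
by case: ifP => _; case: ifP => _; rewrite ?mul0r ?addr0 ?add0r ?mulNr.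
Qed.

Lemma closed_middle c b w t : polyline c -> closed (middle c b w t).
Proof.
move=> [_ ax _ _ _]; rewrite middleE; apply: closed_bigcup => // k km.
by apply: closed_trap; exact: ax.
Qed.

Definition midline c (b : bool) t : nat -> R * R :=
  if b then cut_start (cut_end (psize c) (vert c) t) t
  else cut_end (psize c) (vert c) t.

Definition midpath c b t : chain R := Chain (psize c) (midline c b t) (pdir c)
  (fun k => plen c k - (if (k.+1 == psize c)%N then t else 0)
            - (if b && (k == 0)%N then t else 0)).

(** Only a strip with a single segment could be too short to be cut at both ends: otherwise the end
    segments are long enough by [plen_first] and [plen_last]. *)
Definition roomy c t : Prop := psize c = 1%N -> 2 * t < plen c 0.

Lemma dir_pt_rev p d x : axis d -> 0 < x -> dir (pt p d x 0) p = (- d.1, - d.2).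
Proof.
move=> ax x0; rewrite /dir /pt /=.
have -> : p.1 - (p.1 + x * d.1 - 0 * d.2) = - (x * d.1) by ring.
have -> : p.2 - (p.2 + x * d.2 + 0 * d.1) = - (x * d.2) by ring.
rewrite !sgrN !sgrM gtr0_sg// !mul1r.
by case: ax => -> /=; rewrite ?sgrN ?sgr1 ?sgr0.
Qed.

(** The first segment turns at one end only, so one of its two sides has length [plen c 0 - w / 2],
    which is positive by thickness. *)
Lemma plen_first c w : good c w -> 0 < w -> (1 < psize c)%N ->
  w / 2 < plen c 0.
Proof.
move=> [pc th _] w0 m1; have m0 := ltnW m1.
have hw : - (w / 2) <= w / 2 <= w / 2 by lra.
have hw' : - (w / 2) <= - (w / 2) <= w / 2 by lra.
have := th _ _ m0 hw; have := th _ _ m0 hw'; rewrite /lo /hi turn0.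
by case: pc => _ _ _ _ /(_ _ m1)[]->; lra.
Qed.

Lemma plen_last c w k : good c w -> 0 < w -> psize c = k.+2 ->
  w / 2 < plen c k.+1.
Proof.
move=> [pc th _] w0 mk; have km : (k.+1 < psize c)%N by rewrite mk.
have hw : - (w / 2) <= w / 2 <= w / 2 by lra.
have hw' : - (w / 2) <= - (w / 2) <= w / 2 by lra.
have := th _ _ km hw; have := th _ _ km hw'; rewrite /lo /hi -mk turnm.
by case: pc => _ _ _ _ /(_ _ km)[]->; lra.
Qed.

Lemma mid_vert c b t k : polyline c -> 0 < t -> roomy c t ->
  ((1 < psize c)%N -> t < plen c 0) ->
  (k < psize c)%N ->
  midline c b t k = cpt c k (if b && (k == 0)%N then t else 0) 0.
Proof.
move=> pc t0 ro L1 km; have [m0 ax L0 nx tn] := pc.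
rewrite /midline; case: b => /=; last first.
  by rewrite /cut_end ltn_eqF// /cpt /pt; case: (vert c k) => a b /=;
    congr pair; ring.
rewrite /cut_start; case: eqP => [->|_]; last first.
  by rewrite /cut_end ltn_eqF// /cpt /pt; case: (vert c k) => a b /=;
    congr pair; ring.
have -> : cut_end (psize c) (vert c) t 0 = vert c 0.
  by rewrite /cut_end ltn_eqF.
have -> : dir (vert c 0) (cut_end (psize c) (vert c) t 1) = pdir c 0.
  rewrite /cut_end; case: eqP => [m1|_]; last exact: dir_vert.
  rewrite -m1 nx// dir_pt_rev; [|exact: ax|exact: L0].
  rewrite /move /cpt /pt /=.
  rewrite -[RHS](@dir_pt _ (vert c 0) _ (plen c 0 - t)); last 2 first.
  - exact: ax.
  - by have := ro (esym m1); lra.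
  by congr dir; rewrite /pt; congr pair; ring.
by rewrite /move /cpt /pt; congr pair; ring.
Qed.

Lemma mid_last c b t : polyline c -> 0 < t ->
  midline c b t (psize c) = cpt c (psize c).-1 (plen c (psize c).-1 - t) 0.
Proof.
move=> pc t0; have [m0 ax L0 nx tn] := pc.
have E : midline c b t (psize c) = cut_end (psize c) (vert c) t (psize c).
  by rewrite /midline /cut_start; case: b => //=; rewrite gtn_eqF.
rewrite E /cut_end eqxx; have [k mk] : exists k, psize c = k.+1.
  by exists (psize c).-1; rewrite prednK.
rewrite mk /= nx ?mk// dir_pt_rev; [|by apply: ax; rewrite mk|by apply: L0; rewrite mk].
by rewrite /move /cpt /pt /=; congr pair; ring.
Qed.

Lemma mid_cpt c b t k x u : polyline c -> 0 < t -> roomy c t ->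
  ((1 < psize c)%N -> t < plen c 0) -> (k < psize c)%N ->
  cpt (midpath c b t) k x u = cpt c k (x + if b && (k == 0)%N then t else 0) u.
Proof.
move=> *; rewrite /cpt /= mid_vert// /cpt /pt /=.
by congr pair; ring.
Qed.

Lemma mid_turn c b t k : turn (midpath c b t) k = turn c k.
Proof. by []. Qed.

Lemma mid_plen_gt0 c b t k : polyline c -> 0 < t -> roomy c t ->
  ((1 < psize c)%N -> t < plen c 0 /\ t < plen c (psize c).-1) ->
  (k < psize c)%N -> 0 < plen (midpath c b t) k.
Proof.
move=> pc t0 ro L1 km /=; have [m0 ax L0 nx tn] := pc; have L0k := L0 _ km.
have := L1; have := ro; rewrite /roomy.
case: eqP => [<-|nE] /=; case: eqP => [k0|nk]; rewrite ?andbT ?andbF ?subr0.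
- by rewrite k0; move=> /(_ erefl) H _; case: b; lra.
- by case: k nk {km L0k} => // k _ _ /(_ isT)[] /=; lra.
- rewrite k0 => _ H; have L00 := L0 _ m0; case: b; last by lra.
  have [|] := H _; last by lra.
  by subst k; rewrite ltn_neqAle m0 andbT; apply/eqP.
by rewrite ?subr0.
Qed.

Lemma mid_short c w t : good c (w + 2 * t) -> 0 < w -> 0 < t ->
  (1 < psize c)%N -> w / 2 + t < plen c 0 /\ w / 2 + t < plen c (psize c).-1.
Proof.
move=> gc w0 t0 m1; have wt : 0 < w + 2 * t by lra.
split; first by have := plen_first gc wt m1; lra.
case E : (psize c) m1 => [|[|k]]// _ /=.
by have := plen_last gc wt E; lra.
Qed.

Lemma mid_polyline c b w t : good c (w + 2 * t) -> 0 < w -> 0 < t ->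
  roomy c t -> polyline (midpath c b t).
Proof.
move=> gc w0 t0 ro; have [pc _ _] := gc; have [m0 ax L0 nx tn] := pc.
have S := mid_short gc w0 t0.
have S1 : (1 < psize c)%N -> t < plen c 0 by move=> /S[]; lra.
split=> //.
  by move=> k km; apply: mid_plen_gt0 => // /S[]; split; lra.
move=> k km; rewrite mid_cpt//=.
have [km1|] := ltnP k.+1 (psize c).
  rewrite mid_vert//= andbF (ltn_eqF km1) subr0 subrK.
  rewrite {1}/cpt (nx _ km) /cpt /pt /=; congr pair; ring.
move=> mk; have E : psize c = k.+1 by apply/eqP; rewrite eqn_leq km mk.
by rewrite -E mid_last// E eqxx /= subrK.
Qed.

Lemma mid_thick c b w t : good c (w + 2 * t) -> 0 < w -> 0 < t ->
  roomy c t -> thick (midpath c b t) w.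
Proof.
move=> gc w0 t0 ro k u km0 uw; have km : (k < psize c)%N := km0.
clear km0; have [pc th _] := gc; have [m0 ax L0 nx tn] := pc.
have S := mid_short gc w0 t0.
have uw' : - ((w + 2 * t) / 2) <= u <= (w + 2 * t) / 2.
  by case/andP: uw => *; lra.
have := th _ _ km uw'; rewrite /lo /hi mid_turn /= !mid_turn.
case: eqP => [E|nE].
  rewrite E turnm mul0r subr0; case: eqP => [k0|/eqP k0].
    subst k; rewrite turn0 mul0r andbT; have := ro (esym E); case: b; lra.
  rewrite andbF subr0 => _; have m1 : (1 < psize c)%N by rewrite -E ltnS lt0n.
  have [_] := S m1; rewrite -E /=; case: k {km E} k0 (km : (k < psize c)%N) => // k _ km.
  by have [->|->] := tn _ km; lra.
rewrite subr0; case: eqP => [k0|k0]; last by rewrite andbF subr0.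
subst k; rewrite turn0 mul0r andbT => _.
have m1 : (1 < psize c)%N by rewrite ltn_neqAle m0 andbT; apply/eqP.
have [+ _] := S m1; have [->|->] := tn _ m1; case: b; lra.
Qed.

Lemma strip_mid c b w t : good c (w + 2 * t) -> 0 < w -> 0 < t ->
  roomy c t -> strip (psize c) (midline c b t) w = middle c b w t.
Proof.
move=> gc w0 t0 ro; have [pc th _] := gc; have [m0 ax L0 nx tn] := pc.
have S := mid_short gc w0 t0.
have S1 : (1 < psize c)%N -> t < plen c 0 by move=> /S[]; lra.
rewrite -[LHS]/(strip (psize (midpath c b t)) (vert (midpath c b t)) w).
rewrite strip_ribbon; [|exact: mid_polyline gc w0 t0 ro|exact: mid_thick gc w0 t0 ro].
have loE k u : lo (midpath c b t) k u + (if b && (k == 0)%N then t else 0) =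
    clo c b t k u.
  rewrite /lo /clo mid_turn; case: ifP => [/andP[_ /eqP ->]|_]; last by rewrite addr0.
  by rewrite turn0 mul0r add0r.
have hiE k u : (k < psize c)%N ->
    hi (midpath c b t) k u + (if b && (k == 0)%N then t else 0) = chi c t k u.
  rewrite /hi /chi mid_turn /=; move: (if b && _ then t else 0) => e.
  by case: eqP => [->|_] _; rewrite ?turnm /hi; ring.
rewrite eqEsubset; split=> z.
  move=> [k [x [u [[km uw /andP[h1 h2]] ->]]]].
  exists k, (x + if b && (k == 0)%N then t else 0), u.
  by rewrite -loE -hiE// mid_cpt//; split=> //; lra.
move=> [k [x [u [km uw + ->]]]]; rewrite -loE -hiE// => /andP[h1 h2].
exists k, (x - if b && (k == 0)%N then t else 0), u.
rewrite mid_cpt// subrK; split=> //; split=> //.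
by lra.
Qed.

(** A bar is a strip with an axis of its own, perpendicular to segment k; this puts it into the
    coordinates of that segment, for a wall on either side. *)
Lemma bar_rect c k x u w : polyline c -> (k < psize c)%N -> u != 0 -> 0 < w ->
  bar (cpt c k x u) (cpt c k x 0) w =
  [set z | exists y l, [/\ x - w / 2 <= y <= x + w / 2, 0 <= l <= 1 &
                           z = cpt c k y (l * u)]].
Proof.
move=> [_ /(_ k) ax _ _ _] /ax {}ax u0 w0; rewrite /bar.
have [s [n [sE nu0 us]]] : exists s n : R, [/\ s = 1 \/ s = -1, 0 < n & u = s * n].
  exists (Num.sg u), `|u|; rewrite normr_gt0 -numEsg; split=> //.
  by move: u0; case: sgrP => //; auto.
subst u; clear u0.
(* The direction from the wall at offset u to the middle line. *)
pose d := (s * (pdir c k).2, - s * (pdir c k).1).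
pose b := Chain 1 (fun i => if (i == 0)%N then cpt c k x (s * n) else cpt c k x 0)
  (fun=> d) (fun=> n).
have axd : axis d.
  rewrite /d; case: sE => ->; case: ax => -> /=;
    rewrite ?(mulr0, mulr1, mul1r, mulN1r, oppr0, opprK);
    by [constructor 1|constructor 2|constructor 3|constructor 4].
have pb : polyline b.
  split=> //.
  case=> // _; rewrite /b /cpt /pt /=.
  by congr pair; ring.
have th : thick b w.
  by case=> // v _ _; rewrite /lo /hi /turn /= !mul0r subr0.
rewrite -[LHS]/(strip (psize b) (vert b) w) strip_ribbon// eqEsubset; split=> z.
  move=> [[|i] [y [v [[//= _ /andP[v1 v2]]]]]].
  rewrite /lo /hi /turn /= !mul0r subr0 => /andP[y0 yu] ->.
  exists (x + s * v), (1 - y / n); split.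
  - by case: sE => ->; lra.
  - apply/andP; split; last first.
      by rewrite lerBlDr lerDl divr_ge0// ltW.
    by rewrite subr_ge0 ler_pdivrMr ?mul1r.
  have -> : (1 - y / n) * (s * n) = s * n - y * s.
    by field; rewrite gt_eqF.
  by rewrite /cpt /pt /=; congr pair; ring.
move=> [y [l [/andP[y1 y2] /andP[l0 l1] ->]]].
exists 0, ((1 - l) * n), (s * (y - x)); split.
  split=> //; first by case: sE => ->; lra.
  by rewrite /lo /hi /turn /= !mul0r subr0; apply/andP; split; nra.
have ss : s * s = 1 by case: sE => ->; ring.
rewrite /cpt /pt /=; congr pair.
  transitivity ((vert c k).1 + x * (pdir c k).1 - s * n * (pdir c k).2 +
    (1 - l) * n * (s * (pdir c k).2) + (s * s) * (y - x) * (pdir c k).1).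
    by rewrite ss; ring.
  by ring.
transitivity ((vert c k).2 + x * (pdir c k).2 + s * n * (pdir c k).1 +
    (1 - l) * n * (- s * (pdir c k).1) + (s * s) * (y - x) * (pdir c k).2).
  by rewrite ss; ring.
by ring.
Qed.

End Trapezoids.

(** * The strip left after digging a canal *)

Ltac nlia :=
  repeat match goal with
  | H : is_true (@Order.le _ _ _ _) |- _ => clear H
  | H : is_true (@Order.lt _ _ _ _) |- _ => clear H
  | H : is_true (andb (@Order.le _ _ _ _) _) |- _ => clear H
  | H : is_true (andb (@Order.lt _ _ _ _) _) |- _ => clear H
  | H : _ -> _ |- _ => clear H
  | H : good _ _ |- _ => clear H
  | H : roomy _ _ |- _ => clear H
  end; lia.

Section Step.
Variable R : realType.
Variables (c : chain R) (b : bool) (i : nat) (xl xr w t : R).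
Implicit Types (x y u r : R) (j k : nat).

Local Notation m := (psize c).
Local Notation n1 := (psize c - i)%N.
Local Notation h := ((w + t) / 2).

(** The blocks of indices are: segments i, ..., m - 1 forward; the far end; segments m - 1, ..., 0
    backward; the near end; segments 0, ..., i forward. *)
Definition by_kind T k (f1 : nat -> T) (e : T) (fb : nat -> T) (s : T)
    (f3 : nat -> T) : T :=
  if (k < n1)%N then f1 (i + k)%N else
  if (k == n1)%N then e else
  if (k <= n1 + m)%N then fb (n1 + m - k)%N else
  if (k == (n1 + m).+1)%N then s else f3 (k - (n1 + m).+2)%N.

Definition startF j : R := if (j == i)%N then xr else lo c j (- h).
Definition stopF j : R :=
  if (j.+1 == m)%N then plen c j - t / 2 else hi c j (- h).
Definition startB j : R :=
  if (j == 0)%N then (if b then t / 2 else 0) else lo c j h.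
Definition stopB j : R :=
  if (j.+1 == m)%N then plen c j - t / 2 else hi c j h.
Definition startG j : R := if (j == 0)%N then t / 2 else lo c j (- h).
Definition stopG j : R := if (j == i)%N then xl else hi c j (- h).

(* The island left after digging the middle of the strip c (and, if b holds,  *)
(* the bar crossing the right wall of segment i between the abscissas xl and  *)
(* xr) is traversed as follows: along the right wall forward, from the bar or *)
(* from the start (kind F), around the end (kind E), back along the left wall *)
(* (kind B), and, if b holds, around the start (kind S) and along the right   *)
(* wall up to the bar (kind G).                                               *)
Definition next_chain : chain R := Chain
  (if b then (n1 + m).+2 + i.+1 else (n1 + m).+1)%N
  (fun k => by_kind k
    (fun j => cpt c j (startF j) (- h))
    (cpt c m.-1 (plen c m.-1 - t / 2) (- h))
    (fun j => cpt c j (stopB j) h)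
    (cpt c 0 (if b then t / 2 else 0) h)
    (fun j => if (j == i.+1)%N then cpt c i xl (- h) else
              cpt c j (startG j) (- h)))
  (fun k => by_kind k (pdir c) (perp (pdir c m.-1))
    (fun j => (- (pdir c j).1, - (pdir c j).2))
    (- (perp (pdir c 0)).1, - (perp (pdir c 0)).2) (pdir c))
  (fun k => by_kind k (fun j => stopF j - startF j) (w + t)
    (fun j => stopB j - startB j) (w + t) (fun j => stopG j - startG j)).

Local Notation new := next_chain.

Hypotheses (gc : good c (w + 2 * t)) (w0 : 0 < w) (t0 : 0 < t).
Hypothesis room : roomy c t.
Hypothesis im : (i < m)%N.

(** A bar is only dug through the right wall between two right turns, since there the older peak
    points are found. The inequalities keep it clear of the mitres at both ends of segment i. *)
Definition cut_fits : Prop := if b then [/\ (0 < i)%N, (i.+1 < m)%N,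
  turn c i = -1 /\ turn c i.+1 = -1 &
  [/\ (w + 2 * t) / 2 < xl, xl < xr & xr < plen c i - (w + 2 * t) / 2]]
  else i = 0%N /\ xr = 0.
Hypothesis Hcut : cut_fits.

Lemma side_fits : (b -> False) -> i = 0%N /\ xr = 0.
Proof. by move: Hcut; rewrite /cut_fits; case: b => // _ /(_ isT). Qed.

Lemma bar_fits : b -> [/\ (0 < i)%N, (i.+1 < m)%N,
  turn c i = -1 /\ turn c i.+1 = -1 &
  [/\ (w + 2 * t) / 2 < xl, xl < xr & xr < plen c i - (w + 2 * t) / 2]].
Proof. by move: Hcut; rewrite /cut_fits; case: b. Qed.

Lemma chain_polyline : polyline c. Proof. by case: gc. Qed.
Lemma chain_axis k : (k < m)%N -> axis (pdir c k). Proof. by case: chain_polyline => _ /(_ k). Qed.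
Lemma psize_gt0 : (0 < m)%N. Proof. by case: chain_polyline. Qed.

Lemma by_kindF T k f1 (e : T) fb s f3 : (k < n1)%N ->
  by_kind k f1 e fb s f3 = f1 (i + k)%N.
Proof. by move=> kn; rewrite /by_kind kn. Qed.

Lemma by_kindE T f1 (e : T) fb s f3 : by_kind n1 f1 e fb s f3 = e.
Proof. by rewrite /by_kind ltnn eqxx. Qed.

Lemma by_kindB T j f1 (e : T) fb s f3 : (j < m)%N ->
  by_kind (n1 + m - j)%N f1 e fb s f3 = fb j.
Proof.
move=> jm; rewrite /by_kind ifF; last lia.
rewrite ifF; last lia.
by rewrite ifT; [congr fb; lia|lia].
Qed.

Lemma by_kindS T f1 (e : T) fb s f3 : by_kind (n1 + m).+1 f1 e fb s f3 = s.
Proof.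
rewrite /by_kind ifF; last lia.
rewrite ifF; last lia.
by rewrite ifF ?eqxx//; lia.
Qed.

Lemma by_kindG T j f1 (e : T) fb s f3 :
  by_kind ((n1 + m).+2 + j)%N f1 e fb s f3 = f3 j.
Proof.
rewrite /by_kind ifF; last lia.
rewrite ifF; last lia.
rewrite ifF; last lia.
by rewrite ifF; [congr f3; lia|lia].
Qed.

Lemma psize_next : (n1 + m < psize new)%N.
Proof. by rewrite /=; case: b; lia. Qed.

Lemma segmentG j : b -> (j <= i)%N -> ((n1 + m).+2 + j < psize new)%N.
Proof. by move=> bT ji; rewrite /= bT; lia. Qed.

Variant kind : nat -> Prop :=
| KF k : (k < n1)%N -> kind k
| KE : kind n1
| KB j : (j < m)%N -> kind (n1 + m - j)%N
| KS : b -> kind (n1 + m).+1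
| KG j : b -> (j <= i)%N -> kind ((n1 + m).+2 + j)%N.

Lemma kindP k : (k < psize new)%N -> kind k.
Proof.
rewrite /= => km.
have [k1|k1] := ltnP k n1; first exact: KF.
have [->|k2] := eqVneq k n1; first exact: KE.
have [k3|k3] := leqP k (n1 + m)%N.
  have -> : k = (n1 + m - (n1 + m - k))%N by lia.
  by apply: KB; lia.
have bT : b by move: km; case: b => //; lia.
have [->|k4] := eqVneq k (n1 + m).+1; first exact: KS.
have -> : k = ((n1 + m).+2 + (k - (n1 + m).+2))%N by lia.
by apply: KG => //; move: km; rewrite bT; lia.
Qed.

Lemma cross_self (d : R * R) : axis d -> cross d (perp d) = 1.
Proof. by rewrite /cross /perp; case=> -> /=; ring. Qed.

Lemma turnF k : (0 < k < n1)%N -> turn new k = turn c (i + k).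
Proof.
move=> /andP[k0 kn]; rewrite /turn !ifT; [|lia|by have := psize_next; lia].
rewrite /= !by_kindF; [|lia|lia].
by congr (cross (pdir c _) _); lia.
Qed.

Lemma turnE : turn new n1 = 1.
Proof.
rewrite /turn ifT; last by have := psize_next; lia.
rewrite /= by_kindE by_kindF; last lia.
have -> : (i + n1.-1 = m.-1)%N by lia.
by apply: cross_self; apply: chain_axis; lia.
Qed.

Lemma turnB1 : turn new n1.+1 = 1.
Proof.
rewrite /turn ifT; last by have := psize_next; lia.
have -> : n1.+1 = (n1 + m - m.-1)%N by lia.
have -> : (n1 + m - m.-1).-1 = n1 by lia.
rewrite /= by_kindE by_kindB; last lia.
have := @chain_axis m.-1; rewrite prednK ?psize_gt0// leqnn => /(_ isT).
by rewrite /cross /perp; case=> -> /=; ring.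
Qed.

Lemma turnB j : (j.+1 < m)%N -> turn new (n1 + m - j) = - turn c j.+1.
Proof.
move=> jm; rewrite /turn ifT; last by have := psize_next; lia.
have -> : (n1 + m - j).-1 = (n1 + m - j.+1)%N by lia.
rewrite /= !by_kindB; [|lia|lia].
by rewrite ifT// /cross /=; ring.
Qed.

Lemma turnS : turn new (n1 + m).+1 = if b then 1 else 0.
Proof.
rewrite /turn /=; case: ifP; last by case: b => //; lia.
move=> lt; have -> : b by move: lt; case: b => //; lia.
have -> : (n1 + m = n1 + m - 0)%N by lia.
rewrite by_kindB ?psize_gt0//.
have -> : (n1 + m - 0).+1 = (n1 + m).+1 by lia.
rewrite by_kindS.
by have := chain_axis psize_gt0; rewrite /cross /perp; case=> -> /=; ring.
Qed.

Lemma turnG0 : b -> turn new (n1 + m).+2 = 1.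
Proof.
move=> bT; rewrite /turn ifT; last by rewrite /= bT; lia.
have -> : (n1 + m).+2 = ((n1 + m).+2 + 0)%N by lia.
have -> : ((n1 + m).+2 + 0).-1 = (n1 + m).+1 by lia.
rewrite /= by_kindS by_kindG.
by have := chain_axis psize_gt0; rewrite /cross /perp; case=> -> /=; ring.
Qed.

Lemma turnG j : b -> (0 < j <= i)%N -> turn new ((n1 + m).+2 + j) = turn c j.
Proof.
move=> bT /andP[j0 ji]; rewrite /turn !ifT; [|lia|by rewrite /= bT; lia].
have -> : ((n1 + m).+2 + j).-1 = ((n1 + m).+2 + j.-1)%N by lia.
by rewrite /= !by_kindG.
Qed.

Lemma turnGend : b -> turn new ((n1 + m).+2 + i.+1) = 0.
Proof. by move=> bT; rewrite /turn ifF// /= bT ltnn. Qed.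

Lemma loF k r : (k < n1)%N -> startF (i + k) + lo new k r =
  if (k == 0)%N then xr else lo c (i + k) (r - h).
Proof.
move=> kn; rewrite /startF /lo; have [->|k0] := eqVneq k 0%N.
  by rewrite addn0 eqxx turn0; ring.
rewrite ifF; last lia.
by rewrite turnF; [ring|lia].
Qed.

Lemma hiF k r : (k < n1)%N -> startF (i + k) + hi new k r =
  if ((i + k).+1 == m)%N then plen c (i + k) - t / 2 - r
  else hi c (i + k) (r - h).
Proof.
move=> kn; rewrite /hi [plen new _]/= by_kindF// /stopF; case: eqP => [E|E].
  have -> : k.+1 = n1 by lia.
  by rewrite turnE; ring.
by rewrite turnF; [rewrite addnS /hi; ring|lia].
Qed.

Lemma loE r : lo new n1 r = r. Proof. by rewrite /lo turnE mul1r. Qed.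

Lemma hiE r : hi new n1 r = w + t - r.
Proof. by rewrite /hi turnB1 [plen new _]/= by_kindE mul1r. Qed.

Lemma loB j r : (j < m)%N -> stopB j - lo new (n1 + m - j) r =
  if (j.+1 == m)%N then plen c j - t / 2 - r else hi c j (h - r).
Proof.
move=> jm; rewrite /stopB /lo; case: eqP => [E|E].
  have -> : (n1 + m - j = n1.+1)%N by lia.
  by rewrite turnB1; ring.
by rewrite turnB; [rewrite /hi; ring|lia].
Qed.

Lemma hiB j r : (j < m)%N -> stopB j - hi new (n1 + m - j) r =
  if (j == 0)%N then (if b then t / 2 + r else 0) else lo c j (h - r).
Proof.
move=> jm; rewrite /hi [plen new _]/= by_kindB// /startB.
have [->|j0] := eqVneq j 0%N.
  have -> : ((n1 + m - 0).+1 = (n1 + m).+1)%N by lia.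
  by rewrite turnS; case: b; ring.
have -> : (n1 + m - j).+1 = (n1 + m - j.-1)%N by lia.
by rewrite turnB; [rewrite prednK ?lt0n// /lo; ring|lia].
Qed.

Lemma loS r : b -> lo new (n1 + m).+1 r = r.
Proof. by move=> bT; rewrite /lo turnS bT mul1r. Qed.

Lemma hiS r : b -> hi new (n1 + m).+1 r = w + t - r.
Proof. by move=> bT; rewrite /hi turnG0// [plen new _]/= by_kindS mul1r. Qed.

Lemma loG j r : b -> (j <= i)%N -> startG j + lo new ((n1 + m).+2 + j) r =
  if (j == 0)%N then t / 2 + r else lo c j (r - h).
Proof.
move=> bT ji; rewrite /startG /lo; have [->|j0] := eqVneq j 0%N.
  by rewrite addn0 turnG0//; ring.
by rewrite turnG//; [ring|lia].
Qed.

Lemma hiG j r : b -> (j <= i)%N -> startG j + hi new ((n1 + m).+2 + j) r =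
  if (j == i)%N then xl else hi c j (r - h).
Proof.
move=> bT ji; rewrite /hi [plen new _]/= by_kindG /stopG -addnS.
have [->|j0] := eqVneq j i; first by rewrite turnGend//; ring.
by rewrite turnG//; [rewrite /hi; ring|lia].
Qed.

Lemma cptF k y r : (k < n1)%N ->
  cpt new k y r = cpt c (i + k) (startF (i + k) + y) (r - h).
Proof. by move=> kn; rewrite {1}/cpt /= !by_kindF// /cpt /pt /=; congr pair; ring. Qed.

Lemma cptE y r : cpt new n1 y r = cpt c m.-1 (plen c m.-1 - t / 2 - r) (y - h).
Proof. by rewrite {1}/cpt /= !by_kindE /cpt /pt /perp /=; congr pair; ring. Qed.

Lemma cptB j y r : (j < m)%N ->
  cpt new (n1 + m - j) y r = cpt c j (stopB j - y) (h - r).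
Proof. by move=> jm; rewrite {1}/cpt /= !by_kindB// /cpt /pt /=; congr pair; ring. Qed.

Lemma cptS y r : b -> cpt new (n1 + m).+1 y r = cpt c 0 (t / 2 + r) (h - y).
Proof. by move=> bT; rewrite {1}/cpt /= !by_kindS bT /cpt /pt /perp /=; congr pair; ring. Qed.

Lemma cptG j y r : (j <= i)%N ->
  cpt new ((n1 + m).+2 + j) y r = cpt c j (startG j + y) (r - h).
Proof.
move=> ji; rewrite {1}/cpt /= !by_kindG ifF; last lia.
by rewrite /cpt /pt /=; congr pair; ring.
Qed.

(* A point of the new strip, in the coordinates of the old one. *)
Variant view k y r j x u : Prop :=
| ViewF of (k < n1)%N & j = (i + k)%N & u = r - h & x = startF j + y &
    (if (k == 0)%N then xr else lo c j u) <= x <=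
    (if (j.+1 == m)%N then plen c j - t / 2 - r else hi c j u)
| ViewE of k = n1 & j.+1 = m & u = y - h & x = plen c j - t / 2 - r &
    r <= y <= w + t - r
| ViewB of k = (n1 + m - j)%N & (j < m)%N & u = h - r & x = stopB j - y &
    (if (j == 0)%N then (if b then t / 2 + r else 0) else lo c j u) <= x <=
    (if (j.+1 == m)%N then plen c j - t / 2 - r else hi c j u)
| ViewS of b & k = (n1 + m).+1 & j = 0%N & u = h - y & x = t / 2 + r &
    r <= y <= w + t - r
| ViewG of b & k = ((n1 + m).+2 + j)%N & (j <= i)%N & u = r - h &
    x = startG j + y &
    (if (j == 0)%N then t / 2 + r else lo c j u) <= x <=
    (if (j == i)%N then xl else hi c j u).

Lemma dom_view k y r : dom new t k y r ->
  exists j x u, view k y r j x u /\ cpt new k y r = cpt c j x u.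
Proof.
move=> [km rt]; case: (kindP km) => {km}
    [{}k kn||j jm|bT|j bT ji] /andP[y1 y2].
- exists (i + k)%N, (startF (i + k) + y), (r - h); split; last exact: cptF.
  by apply: ViewF => //; rewrite -loF// -hiF// !lerD2l y1.
- exists m.-1, (plen c m.-1 - t / 2 - r), (y - h); split; last exact: cptE.
  by apply: ViewE; rewrite ?prednK ?psize_gt0//; rewrite loE in y1; rewrite hiE in y2; apply/andP.
- exists j, (stopB j - y), (h - r); split; last exact: cptB.
  by apply: ViewB => //; rewrite -loB// -hiB// !lerD2l !lerN2 y1 y2.
- exists 0%N, (t / 2 + r), (h - y); split; last exact: cptS.
  by apply: ViewS => //; rewrite loS// in y1; rewrite hiS// in y2; rewrite y1.
- exists j, (startG j + y), (r - h); split; last exact: cptG.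
  by apply: ViewG => //; rewrite -loG// -hiG// !lerD2l y1.
Qed.

Lemma view_dom k y r j x u : - (t / 2) <= r <= t / 2 -> view k y r j x u ->
  dom new t k y r /\ cpt new k y r = cpt c j x u.
Proof.
move=> rt; case.
- move=> kn jE uE xE B; subst j u x; split; last exact: cptF.
  split=> //; first by have := psize_next; lia.
  by move: B; rewrite -loF// -hiF// !lerD2l.
- move=> kn jE uE xE B; have {}jE : j = m.-1 by lia.
  subst j k u x; split; last exact: cptE.
  by split=> //; [have := psize_next; lia|rewrite loE hiE].
- move=> kE jm uE xE B; subst k u x; split; last exact: cptB.
  split=> //; first by have := psize_next; lia.
  by move: B; rewrite -loB// -hiB// !lerD2l !lerN2 andbC.
- move=> bT kE jE uE xE B; subst k j u x; split; last exact: cptS.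
  by split=> //; [rewrite /= bT; lia|rewrite loS// hiS].
- move=> bT kE ji uE xE B; subst k u x; split; last exact: cptG.
  split=> //; first exact: segmentG.
  by move: B; rewrite -loG// -hiG// !lerD2l.
Qed.

Lemma plen0_gt : (1 < m)%N -> w / 2 + t < plen c 0.
Proof. by move=> m1; have [] := mid_short gc w0 t0 m1. Qed.

Lemma inner_turn j : (0 < j < m)%N -> turn c j = 1 \/ turn c j = -1.
Proof. by case: j => // j; case: chain_polyline => _ _ _ _ /(_ j). Qed.

Lemma lo_lt_hi j u : (j < m)%N -> - (w / 2 + t) <= u <= w / 2 + t ->
  lo c j u < hi c j u.
Proof.
move=> jm uw; case: gc => _ /(_ j u jm) + _; apply.
by case/andP: uw => *; lra.
Qed.

Lemma hi_last j u : j.+1 = m -> hi c j u = plen c j.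
Proof. by move=> jm; rewrite /hi jm turnm mul0r subr0. Qed.

Lemma lo_first u : lo c 0 u = 0. Proof. by rewrite /lo turn0 mul0r. Qed.

Lemma lo_lt_far j u r : - (t / 2) <= r <= t / 2 -> j.+1 = m ->
  - (h - r) <= u <= h - r -> lo c j u < plen c j - t / 2 - r.
Proof.
have w_gt0 := w0; have t_gt0 := t0.
move=> /andP[r1 r2] jm /andP[u1 u2]; case: j jm => [|j] jm.
  by rewrite lo_first; have := room (esym jm); lra.
have m1 : (1 < m)%N by rewrite -jm.
have [_] := mid_short gc w0 t0 m1; rewrite -jm /= => L.
by rewrite /lo; have [|E|E] := @inner_turn j.+1; rewrite ?E -?jm//=; lra.
Qed.

Lemma near_lt_hi u r : - (t / 2) <= r <= t / 2 -> (1 < m)%N ->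
  - (h - r) <= u <= h - r -> t / 2 + r < hi c 0 u.
Proof.
have w_gt0 := w0; have t_gt0 := t0.
move=> /andP[r1 r2] m1 /andP[u1 u2]; have L := plen0_gt m1.
by rewrite /hi; have [|->|->] := @inner_turn 1; rewrite ?m1//; lra.
Qed.

Lemma bar_lo u : b -> - (w / 2 + t) <= u <= - (w / 2) ->
  [/\ lo c i u < xl, xl < xr & xr < hi c i u].
Proof.
have w_gt0 := w0; have t_gt0 := t0.
move=> /bar_fits[_ _ [t1 t2] [x1 x2 x3]] /andP[u1 u2].
by rewrite /lo /hi t1 t2; split; lra.
Qed.

Lemma view_dom_old k y r j x u : - (t / 2) <= r <= t / 2 ->
  view k y r j x u -> dom c (w + 2 * t) j x u.
Proof.
have w_gt0 := w0; have t_gt0 := t0.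
move=> rt; have /andP[r1 r2] := rt; case.
- move=> kn jE uE xE /andP[x1 x2].
  have jm : (j < m)%N by nlia.
  split=> //; first by lra.
  apply/andP; split.
    move: x1; case: eqP => // k0; apply: le_trans.
    have -> : j = i by nlia.
    case bT: b; first by have [|] := @bar_lo u bT; [apply/andP; split|]; lra.
    have [|i0 ->] := side_fits; first by rewrite bT.
    by rewrite i0 lo_first.
  by move: x2; case: eqP => // jE' xl'; rewrite hi_last//; lra.
- move=> kE jm uE xE /andP[y1 y2]; split; first by nlia.
    by lra.
  rewrite hi_last// xE; apply/andP; split; last by lra.
  by apply/ltW/lo_lt_far => //; lra.
- move=> kE jm uE xE /andP[x1 x2].
  split=> //; first by lra.
  apply/andP; split.
    move: x1; case: eqP => // ->; rewrite lo_first; case: b => //.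
    by move=> ?; lra.
  by move: x2; case: eqP => // jE' xl'; rewrite hi_last//; lra.
- move=> bT kE jE uE xE /andP[y1 y2].
  have [i0 i1 _ _] := bar_fits bT; subst j; split; [exact: psize_gt0|by lra|].
  rewrite lo_first xE; apply/andP; split; first by lra.
  by apply/ltW/near_lt_hi => //; [nlia|lra].
- move=> bT kE ji uE xE /andP[x1 x2].
  have uw : - (w / 2 + t) <= u <= - (w / 2) by lra.
  have [b1 b2 b3] := bar_lo bT uw.
  split; first by nlia.
    by lra.
  apply/andP; split.
    by move: x1; case: eqP => // -> ?; rewrite lo_first; lra.
  by move: x2; case: eqP => // -> ?; lra.
Qed.

Lemma thick_next : thick new t.
Proof.
have w_gt0 := w0; have t_gt0 := t0.
move=> k r km rt; have /andP[r1 r2] := rt.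
case: (kindP km) => {km} [{}k kn||j jm|bT|j bT ji].
- rewrite -(ltrD2l (startF (i + k))) loF// hiF//.
  have uw : - (w / 2 + t) <= r - h <= - (w / 2) by lra.
  have uw' : - (w / 2 + t) <= r - h <= w / 2 + t by lra.
  have uw2 : - (h - r) <= r - h <= h - r by lra.
  case: eqP => [k0|k0]; last first.
    by case: eqP => E; [apply: lo_lt_far|apply: lo_lt_hi => //; nlia].
  subst k; rewrite addn0; case bT: b.
    have [b1 b2 b3] := bar_lo bT uw; rewrite ifF//.
    by have [_ i1 _ _] := bar_fits bT; rewrite ltn_eqF.
  have [|i0 ->] := side_fits; first by rewrite bT.
  rewrite i0; case: eqP => E; first by rewrite -(lo_first (r - h)); exact: lo_lt_far.
  by rewrite -(lo_first (r - h)); apply: lo_lt_hi => //; exact: psize_gt0.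
- by rewrite loE hiE; lra.
- rewrite -ltrN2 -(ltrD2l (stopB j)) loB// hiB//.
  have uw' : - (w / 2 + t) <= h - r <= w / 2 + t by lra.
  have uw2 : - (h - r) <= h - r <= h - r by lra.
  have ow := lo_lt_hi jm uw'.
  case: eqP => [E|E]; last first.
    by case: eqP => E'; [apply: lo_lt_far|].
  subst j; rewrite lo_first in ow; case: eqP => E.
    have := room (esym E); case bT: b; last by lra.
    by have [_ i1 _ _] := bar_fits bT; move: i1; rewrite -E ltnS ltn0.
  case bT: b; last by [].
  apply: near_lt_hi => //; have [_ i1 _ _] := bar_fits bT.
  by rewrite (leq_trans _ i1).
- by rewrite loS// hiS//; lra.
- rewrite -(ltrD2l (startG j)) loG// hiG//.
  have uw : - (w / 2 + t) <= r - h <= - (w / 2) by lra.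
  have uw' : - (w / 2 + t) <= r - h <= w / 2 + t by lra.
  have uw2 : - (h - r) <= r - h <= h - r by lra.
  have [b1 b2 b3] := bar_lo bT uw; have [i0 i1 _ _] := bar_fits bT.
  case: eqP => [j0|j0]; last first.
    by case: eqP => [->//|E]; apply: lo_lt_hi => //; nlia.
  subst j; rewrite ifF; last by nlia.
  by apply: near_lt_hi => //; nlia.
Qed.

Lemma polyline_next : polyline new.
Proof.
have w_gt0 := w0; have t_gt0 := t0.
have sz' := psize_next; split.
- by nlia.
- move=> k km; case: (kindP km) => {km} [{}k kn||j jm|bT|j bT ji] /=.
  + by rewrite by_kindF//; apply: chain_axis; nlia.
  + by rewrite by_kindE; apply: axis_perp; apply: chain_axis; nlia.
  + by rewrite by_kindB//; apply: axisN; apply: chain_axis.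
  + by rewrite by_kindS; apply: (@axisN R (perp _)); apply: axis_perp; apply: chain_axis; exact: psize_gt0.
  + by rewrite by_kindG; apply: chain_axis; nlia.
- move=> k km; have := @thick_next k 0 km; rewrite /lo /hi !mulr0 subr0; apply.
  by lra.
- move=> k km; case: (kindP km) => {km} [{}k kn||j jm|bT|j bT ji].
  + rewrite cptF// [plen new _]/= by_kindF// [vert _ _]/= sub0r.
    rewrite [startF _ + _]addrC subrK /stopF.
    have [k1|k1] := ltnP k.+1 n1.
      rewrite by_kindF// ifF; last nlia.
      rewrite addnS (cpt_joint _ chain_polyline); last nlia.
      by rewrite /startF ifF//; nlia.
    have -> : k.+1 = n1 by nlia.
    rewrite by_kindE ifT; last nlia.
    by have -> : (m.-1 = i + k)%N by nlia.
  + rewrite cptE [plen new _]/= by_kindE [vert _ _]/=.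
    have -> : n1.+1 = (n1 + m - m.-1)%N by nlia.
    rewrite by_kindB; last nlia.
    rewrite /stopB ifT; last nlia.
    by congr cpt; lra.
  + rewrite cptB// [plen new _]/= by_kindB// [vert _ _]/= subr0 subKr.
    have [j0|j0] := posnP j.
      have -> : (n1 + m - j).+1 = (n1 + m).+1 by nlia.
      by rewrite by_kindS /startB j0.
    have -> : (n1 + m - j).+1 = (n1 + m - j.-1)%N by nlia.
    rewrite by_kindB; last nlia.
    rewrite /stopB /startB ifF; last nlia.
    rewrite ifF; last nlia.
    by rewrite (cpt_joint _ chain_polyline) ?prednK//; nlia.
  + rewrite cptS// [plen new _]/= by_kindS [vert _ _]/=.
    have -> : (n1 + m).+2 = ((n1 + m).+2 + 0)%N by nlia.
    rewrite by_kindG /= /startG /=.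
    by congr cpt; lra.
  + rewrite cptG// [plen new _]/= by_kindG [vert _ _]/= sub0r.
    rewrite [startG _ + _]addrC subrK /stopG -addnS by_kindG.
    case: eqP => [ji'|ji']; first by rewrite ifT; [congr cpt; nlia|nlia].
    rewrite ifF; last nlia.
    by rewrite (cpt_joint _ chain_polyline); [rewrite /startG|nlia].
- move=> k; move E: k.+1 => k1 km; case: (kindP km) E => {km}
    [{}k1 kn||j jm|bT|j bT ji] E.
  + by rewrite turnF; [apply: inner_turn; nlia|nlia].
  + by rewrite turnE; left.
  + have [jm1|jm1] := eqVneq j.+1 m.
      have -> : (n1 + m - j = n1.+1)%N by nlia.
      by rewrite turnB1; left.
    rewrite turnB; last nlia.
    by have [|->|->] := @inner_turn j.+1; [nlia|right|left; rewrite opprK].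
  + by rewrite turnS bT; left.
  + have [->|j0] := posnP j; first by rewrite addn0 turnG0//; left.
    by rewrite turnG; [apply: inner_turn; nlia| |nlia].
Qed.

(** Both points are read in the old strip, where [embedded] identifies their coordinates. The walls
    and the two end pieces meet there only along mitres, and these are the joints of the new
    chain. *)
Lemma embedded_next_le k y r l y' r' : (k <= l)%N ->
  dom new t k y r -> dom new t l y' r' -> cpt new k y r = cpt new l y' r' ->
  r = r' /\ ((k = l /\ y = y') \/
             [/\ l = k.+1, y = hi new k r & y' = lo new l r]).
Proof.
have w_gt0 := w0; have t_gt0 := t0.
move=> kl D D'; have [_ rt _] := D; have [_ rt' _] := D'.
have [j [x [u [V ->]]]] := dom_view D; have [j' [x' [u' [V' ->]]]] := dom_view D'.
have [_ _ em] := gc.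
move=> /(em _ _ _ _ _ _ (view_dom_old rt V) (view_dom_old rt' V')) [uu old].
subst u'.
(* Of the 25 pairs of kinds, those against the order k <= l and those on opposite walls (u of
   opposite signs) are discarded at once; 13 remain. *)
case: V => [kn jE uE xE B|kE jm uE xE B|kE jm uE xE B|bT kE jE uE xE B|
    bT kE ji uE xE B];
case: V' => [kn' jE' uE' xE' B'|kE' jm' uE' xE' B'|kE' jm' uE' xE' B'|
    bT' kE' jE' uE' xE' B'|bT' kE' ji' uE' xE' B'];
  try (exfalso; clear -kl kE kE' jm; lia);
  try (exfalso; clear -kl kE kn' im; nlia);
  try (exfalso; clear -kl kE kn' jm; nlia);
  try (exfalso; clear -kl kE kE' im; nlia);
  try (exfalso; move: uE uE' rt rt' w_gt0; clear => ? ? /andP[? ?] /andP[? ?] ?; lra).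
- have rr : r = r' by lra.
  subst r'; split=> //; case: old => [[jj xx]|[jj xx xx']|[jj xx xx']].
  + left; split; first by nlia.
    have E : startF j = startF j' by rewrite jj.
    lra.
  + right; have lk : l = k.+1 by nlia.
    split=> //.
      have := hiF r kn; rewrite ifF; last by nlia.
      by rewrite -jE -uE; lra.
    have := loF r kn'; rewrite ifF; last by nlia.
    by rewrite -jE' -uE; lra.
  + by exfalso; nlia.
- case: old => [[jj xx]|[jj xx xx']|[jj xx xx']]; last by exfalso; nlia.
    move: B; rewrite jj jm' eqxx => /andP[_ B]; move/andP: B' => [b1 b2].
    rewrite jj in xE xx; have rr : r = r' by lra.
    subst r'; split=> //; right; have lk : l = k.+1 by nlia.
    split=> //; last by rewrite kE' loE; lra.
    by have := hiF r kn; rewrite -jE jj jm' eqxx; lra.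
  have := @lo_lt_far _ u _ rt' jm'; rewrite -xE' xx' ltxx => F.
  by exfalso; have : false by apply: F; lra.
- have [i0 i1 _ _] := bar_fits bT'; case: old => [[jj xx]|[jj xx xx']|[jj xx xx']]; try by exfalso; nlia.
  have E0 : t / 2 + r' = hi c 0 u by rewrite -xE' xx jE'.
  have := @near_lt_hi u _ rt' (leq_ltn_trans i0 (ltnW i1)); rewrite E0 ltxx => F.
  by exfalso; have : false by apply: F; lra.
(* Kinds F and G share the right wall but are separated by the bar: F starts at [xr] and G stops at
   [xl]. *)
- have [i0 i1 _ _] := bar_fits bT'; have rr : r = r' by lra.
  have uw : - (w / 2 + t) <= u <= - (w / 2) by lra.
  have [c1 c2 c3] := bar_lo bT' uw.
  exfalso; case: old => [[jj xx]|[jj xx xx']|[jj xx xx']]; last 2 first.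
  + by nlia.
  + have [k0|k0] := posnP k.
      by move: B; rewrite k0 /= => /andP[B _]; rewrite xx' jE k0 addn0 in B; lra.
    have E : j' = i by nlia.
    by move: B'; rewrite E eqxx => /andP[_ B']; rewrite xx E in B'; lra.
  have k0 : k = 0%N by nlia.
  have E : j' = i by nlia.
  move: B B'; rewrite k0 E !eqxx /= => /andP[B _] /andP[_ B'].
  lra.
- move/andP: B => [b1 b2]; move/andP: B' => [b1' b2'].
  case: old => [[jj xx]|[jj xx xx']|[jj xx xx']]; try by exfalso; nlia.
  subst j'; have rr : r = r' by lra.
  by subst r'; split=> //; left; split; [nlia|lra].
- case: old => [[jj xx]|[jj xx xx']|[jj xx xx']]; first last.
  + have := @lo_lt_far _ u _ rt jm; rewrite -xE xx' ltxx => F.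
    by exfalso; have : false by apply: F; lra.
  + by exfalso; nlia.
  subst j'; move: B'; rewrite jm eqxx => /andP[_ B']; move/andP: B => [b1 b2].
  have rr : r = r' by lra.
  subst r'; split=> //; right; have lk : l = k.+1 by nlia.
  split=> //; first by rewrite kE hiE; lra.
  by have := loB r jm'; rewrite -kE' jm eqxx; lra.
- have [i0 i1 _ _] := bar_fits bT'; exfalso; case: old => [[jj xx]|[jj xx xx']|[jj xx xx']]; nlia.
- have [i0 i1 _ _] := bar_fits bT'; exfalso; case: old => [[jj xx]|[jj xx xx']|[jj xx xx']]; try nlia.
  have := @lo_lt_far _ u _ rt jm; rewrite -xE xx' ltxx => F.
  by have : false by apply: F; lra.
- have rr : r = r' by lra.
  subst r'; split=> //; case: old => [[jj xx]|[jj xx xx']|[jj xx xx']].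
  + left; split; first by nlia.
    have E : stopB j = stopB j' by rewrite jj.
    lra.
  + by exfalso; nlia.
  + right; have lk : l = k.+1 by nlia.
    split=> //.
      have := hiB r jm; rewrite -kE ifF; last by nlia.
      by rewrite -uE; lra.
    have := loB r jm'; rewrite -kE' ifF; last by nlia.
    by rewrite -uE; lra.
- have [i0 i1 _ _] := bar_fits bT'; case: old => [[jj xx]|[jj xx xx']|[jj xx xx']]; last 2 first.
  + by exfalso; nlia.
  + have E0 : t / 2 + r' = hi c 0 u by rewrite -xE' xx jE'.
  have := @near_lt_hi u _ rt' (leq_ltn_trans i0 (ltnW i1)); rewrite E0 ltxx => F.
    by exfalso; have : false by apply: F; lra.
  subst j'; move/andP: B' => [b1' b2'].
  move: B; rewrite jj eqxx bT' => /andP[B _]; have rr : r = r' by lra.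
  subst r'; split=> //; right; have lk : l = k.+1 by nlia.
  split=> //; last by rewrite kE' loS//; lra.
  by have := hiB r jm; rewrite -kE jj eqxx bT'; rewrite jj in xE; lra.
- move/andP: B => [b1 b2]; move/andP: B' => [b1' b2'].
  case: old => [[jj xx]|[jj xx xx']|[jj xx xx']]; try by exfalso; nlia.
  have rr : r = r' by lra.
  by subst r'; split=> //; left; split; [nlia|lra].
- have [i0 i1 _ _] := bar_fits bT'; case: old => [[jj xx]|[jj xx xx']|[jj xx xx']]; last 2 first.
  + have E0 : t / 2 + r = hi c 0 u by rewrite -xE xx jE.
  have := @near_lt_hi u _ rt (leq_ltn_trans i0 (ltnW i1)); rewrite E0 ltxx => F.
    by exfalso; have : false by apply: F; lra.
  + by exfalso; nlia.
  rewrite jE in jj; subst j'; move/andP: B => [b1 b2].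
  move: B'; rewrite eqxx => /andP[B' _]; have rr : r = r' by lra.
  subst r'; split=> //; right; have lk : l = k.+1 by nlia.
  split=> //; first by rewrite kE hiS//; lra.
  by have := @loG 0 r bT' isT; rewrite -kE' eqxx; lra.
- have rr : r = r' by lra.
  subst r'; split=> //; case: old => [[jj xx]|[jj xx xx']|[jj xx xx']].
  + left; split; first by nlia.
    have E : startG j = startG j' by rewrite jj.
    lra.
  + right; have lk : l = k.+1 by nlia.
    split=> //.
      have := hiG r bT ji; rewrite -kE ifF; last by nlia.
      by rewrite -uE; lra.
    have := loG r bT ji'; rewrite -kE' ifF; last by nlia.
    by rewrite -uE; lra.
  + by exfalso; nlia.
Qed.

Lemma good_next : good new t.
Proof.
split; [exact: polyline_next|exact: thick_next|].
move=> k x u l y u' D D' E; have [kl|lk] := leqP k l.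
  have [-> H] := embedded_next_le kl D D' E; split=> //.
  by case: H; [constructor 1|constructor 2].
have [H1 H2] := embedded_next_le (ltnW lk) D' D (esym E).
split=> //; case: H2 => [[-> ->]|[]]; first by constructor 1.
by rewrite H1; constructor 3.
Qed.


End Step.

(** * Neighbourhoods and closures in terms of squares *)

Section Boxes.
Variable R : realType.
Implicit Types (z : R * R) (A : set (R * R)) (e x u : R).

Lemma nbhs_boxP z A : nbhs z A <-> exists2 e, 0 < e &
  forall z', `|z.1 - z'.1| < e -> `|z.2 - z'.2| < e -> A z'.
Proof.
split=> [/nbhs_ballP[e /= e0 H]|[e e0 H]]; [|apply/nbhs_ballP]; exists e => //.
  by move=> z' h1 h2; apply: H; split; rewrite -ball_normE.
by move=> z' []; rewrite -!ball_normE; exact: H.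
Qed.

Lemma closure_boxP z A : closure A z <-> forall e, 0 < e ->
  exists z', [/\ A z', `|z.1 - z'.1| < e & `|z.2 - z'.2| < e].
Proof.
split=> [cl e e0|H B].
  have [|z' [Az [h1 h2]]] :=
      cl [set z' | `|z.1 - z'.1| < e /\ `|z.2 - z'.2| < e].
    by apply/nbhs_boxP; exists e.
  by exists z'.
move=> /nbhs_boxP[e e0 HB]; have [z' [Az h1 h2]] := H e e0.
by exists z'; split=> //; exact: HB.
Qed.

Lemma pick_inside (a b x D eta : R) : a < b -> a - D <= x <= b + D -> 0 <= D ->
  0 < eta -> exists y, [/\ a < y, y < b & `|x - y| <= D + eta].
Proof.
move=> ab /andP[x1 x2] D0 e0; pose d := Num.min (eta / 2) ((b - a) / 2).
have d0 : 0 < d by rewrite lt_min; lra.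
have d1 : d <= eta / 2 by rewrite ge_min lexx.
have d2 : d <= (b - a) / 2 by rewrite ge_min lexx orbT.
have [ax|ax] := leP x a.
  by exists (a + d); split; [lra|lra|rewrite ler_norml; lra].
have [bx|bx] := ltP x b.
  by exists x; split=> //; rewrite subrr normr0; lra.
by exists (b - d); split; [lra|lra|rewrite ler_norml; lra].
Qed.

Lemma pt_close (p d : R * R) x u x' u' : axis d ->
  `|(pt p d x u).1 - (pt p d x' u').1| <= `|x - x'| + `|u - u'| /\
  `|(pt p d x u).2 - (pt p d x' u').2| <= `|x - x'| + `|u - u'|.
Proof.
have H (e f : R) : `|e| <= `|e| + `|f| /\ `|f| <= `|e| + `|f|.
  by rewrite lerDl lerDr !normr_ge0.
move=> ax; rewrite /pt /=.
have -> : p.1 + x * d.1 - u * d.2 - (p.1 + x' * d.1 - u' * d.2) =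
  (x - x') * d.1 - (u - u') * d.2 by ring.
have -> : p.2 + x * d.2 + u * d.1 - (p.2 + x' * d.2 + u' * d.1) =
  (x - x') * d.2 + (u - u') * d.1 by ring.
have [h1 h2] := H (x - x') (u - u').
by case: ax => -> /=; rewrite ?(mulr0, mulr1, mulrN1, mulrN, subr0, sub0r, add0r,
  addr0, opprK, normrN, oppr0).
Qed.

End Boxes.

(** * The new strip is the closure of the old one minus the canal *)

Section StepSets.
Variable R : realType.
Variables (c : chain R) (b : bool) (i : nat) (xl xr w t : R).
Implicit Types (x y u r : R) (j k : nat).

Local Notation m := (psize c).
Local Notation n1 := (psize c - i)%N.
Local Notation h := ((w + t) / 2).
Local Notation new := (next_chain c b i xl xr w t).

Hypotheses (gc : good c (w + 2 * t)) (w0 : 0 < w) (t0 : 0 < t).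
Hypothesis room : roomy c t.
Hypothesis im : (i < m)%N.
Hypothesis Hcut : cut_fits c b i xl xr w t.

Definition barset : set (R * R) := [set z | exists x u,
  [/\ xl <= x <= xr, - (w / 2 + t) <= u <= 0 & z = cpt c i x u]].

Definition dug : set (R * R) :=
  (if b then barset else set0) `|` middle c b w t.

Lemma ribbon_dug z : ribbon c (w + 2 * t) z -> ~ dug z -> ribbon new t z.
Proof.
have w_gt0 := w0; have t_gt0 := t0; have pcc := chain_polyline gc.
move=> [j [x [u [[jm /andP[u1 u2] /andP[x1 x2]] ->]]]] nd.
have tw2 : - (t / 2) <= 0 :> R by lra.
suff [k [y [r [rt V]]]] : exists k y r, - (t / 2) <= r <= t / 2 /\
    view c b i xl xr w t k y r j x u.
  have [D E] := view_dom gc w0 t0 im rt V.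
  by exists k, y, r.
(* The end piece E is bounded by the two diagonals issuing from the far corners of the old strip;
   the next case treats the near end in the same way. *)
have [/andP[/eqP jE E1]|nE] := boolP ((j.+1 == m) && [&& plen c j - t <= x,
    - (x - (plen c j - (w / 2 + t))) <= u & u <= x - (plen c j - (w / 2 + t))]).
  move/and3P: E1 => [e1 e2 e3]; rewrite (hi_last _ jE) in x2.
  exists n1, (u + h), (plen c j - t / 2 - x); split; first by lra.
  by apply: ViewE => //; [lra|lra|lra].
have [/and5P[bT /eqP jE s1 s2 s3]|nS] := boolP [&& b, (j == 0)%N, x <= t,
    - (w / 2 + t - x) <= u & u <= w / 2 + t - x].
  subst j; rewrite lo_first in x1.
  exists (n1 + m).+1, (h - u), (x - t / 2); split; first by lra.
  by apply: ViewS => //; [lra|lra|lra].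
have upper s : s = u \/ s = - u -> w / 2 <= s ->
    x <= if (j.+1 == m)%N then plen c j - (w / 2 + t) + s else hi c j u.
  move=> su ws; case: ifP => // jE; rewrite jE /= in nE.
  rewrite leNgt; apply: contra nE => lx.
  by case: su => su; rewrite su in lx ws *; apply/and3P; split; lra.
have lower s : b -> s = u \/ s = - u -> w / 2 <= s ->
    (if (j == 0)%N then w / 2 + t - s else lo c j u) <= x.
  move=> bT su ws; case: ifP => // jE; rewrite bT jE /= in nS.
  rewrite leNgt; apply: contra nS => lx.
  by case: su => su; rewrite su in lx ws *; apply/and3P; split; lra.
have [uw|uw] := leP (w / 2) u.
  have up := upper u (or_introl erefl) uw.
  have low bT := lower u bT (or_introl erefl) uw.
  clear nE nS upper lower; exists (n1 + m - j)%N, (stopB c w t j - x), (h - u).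
  split; first by lra.
  apply: ViewB => //; try lra.
  apply/andP; split.
    case bT: b; last first.
      case: eqP => // j0; move: x1; rewrite j0 lo_first; lra.
    move: (low bT); case: ifP => // _; lra.
  by move: up; case: ifP => // _; lra.
have [uw'|uw'] := leP u (- (w / 2)).
  clear nE nS; have wu : w / 2 <= - u by lra.
  have up := upper (- u) (or_intror erefl) wu.
  have low bT := lower (- u) bT (or_intror erefl) wu; clear upper lower.
  (* On the right wall: behind the bar the point is of kind F; otherwise it is before the bar and of
     kind G, or else in the bar. *)
  have [[ij xr']|nF] : ((i <= j)%N /\ (j = i -> xr <= x)) \/ ~ ((i <= j)%N /\ (j = i -> xr <= x)).
  - exact: EM.
  - exists (j - i)%N, (x - startF c i xr w t j), (u + h).
    split; first by lra.
    apply: ViewF => //; [clear -ij jm; lia|clear -ij; lia|lra|lra|].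
    apply/andP; split; last by move: up; case: ifP => // _; lra.
    by case: eqP => // ji; apply: xr'; clear -ij ji; lia.
  have ji : (j <= i)%N.
    rewrite leqNgt; apply/negP => ij; apply: nF; split; first exact: ltnW.
    by move=> ji; rewrite ji ltnn in ij.
  have bT : b.
    case: (boolP b) => // nb; exfalso; apply: nF.
    have [|i0 xr0] := side_fits Hcut; first by apply/negP.
    rewrite i0 in ji *; split=> // j0; move: x1; rewrite j0 lo_first; lra.
  have xl' : j = i -> x <= xl.
    move=> jE; rewrite leNgt; apply/negP => xx.
    apply: nd; left; rewrite bT; exists x, u; split; last by rewrite jE.
      apply/andP; split; first exact: ltW.
      by rewrite leNgt; apply/negP => xx'; apply: nF; split; [rewrite jE|move=> _; exact: ltW].
    by lra.
  exists ((n1 + m).+2 + j)%N, (x - startG c w t j), (u + h).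
  split; first by lra.
  apply: ViewG => //; try lra.
  apply/andP; split.
    by move: (low bT); case: ifP => // _; lra.
  by case: eqP => // /xl'.
exfalso; apply: nd; right; exists j, x, u; split=> //.
  by lra.
rewrite /clo /chi; apply/andP; split.
  case: ifP => [/andP[bT j0]|//]; rewrite leNgt; apply: contra nS => xt.
  by rewrite bT j0 /=; apply/and3P; split; lra.
case: ifP => [jE|//]; rewrite leNgt; apply: contra nE => xt.
by rewrite jE /=; apply/and3P; split; lra.
Qed.

Lemma bar_dom x u : b -> xl <= x <= xr -> - (w / 2 + t) <= u <= 0 ->
  [/\ dom c (w + 2 * t) i x u, lo c i u < x & x < hi c i u].
Proof.
have w_gt0 := w0; have t_gt0 := t0.
move=> bT /andP[x1 x2] /andP[u1 u2].
have [_ _ [t1 t2] [h1 h2 h3]] := bar_fits Hcut bT.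
rewrite /dom /lo /hi t1 t2; split; [|lra|lra].
by split=> //; lra.
Qed.

Lemma middle_dom k x u : (k < m)%N -> - (w / 2) <= u <= w / 2 ->
  clo c b t k u <= x <= chi c t k u -> dom c (w + 2 * t) k x u.
Proof.
have w_gt0 := w0; have t_gt0 := t0.
move=> km /andP[u1 u2] /andP[x1 x2]; split=> //; first by lra.
apply/andP; split.
  by move: x1; rewrite /clo; case: ifP => // /andP[_ /eqP ->]; rewrite lo_first; lra.
by move: x2; rewrite /chi; case: eqP => // E; rewrite hi_last//; lra.
Qed.

(** Strict inequalities in the new coordinates put the old ones strictly outside the ranges of the
    bar and of the middle, and a second description of the same point is excluded by [embedded]. *)
Lemma inner_not_dug k y r : (k < psize new)%N -> - (t / 2) < r < t / 2 ->
  lo new k r < y < hi new k r -> ~ dug (cpt new k y r).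
Proof.
have w_gt0 := w0; have t_gt0 := t0; have pcc := chain_polyline gc.
move=> km /andP[r1 r2] /andP[y1 y2].
have rt : - (t / 2) <= r <= t / 2 by rewrite !ltW.
have D : dom new t k y r by split; rewrite ?ltW.
have [j [x [u [V ->]]]] := dom_view gc w0 t0 im D.
have D' := view_dom_old gc w0 t0 room im Hcut rt V.
have [_ _ em] := gc.
case=> [|[k0 [x0 [u0 [km0 uw0 cc E]]]]].
  case bT: b => // -[x0 [u0 [xx0 uu0 E]]].
  have [D0 l0 h0] := bar_dom bT xx0 uu0.
  have [uu old] := em _ _ _ _ _ _ D' D0 E; subst u0.
  have [ji xx] : j = i /\ x = x0.
    by case: old => // -[ji H1 H2]; exfalso; lra.
  have [i0 i1 _ _] := bar_fits Hcut bT; case/andP: xx0 => x01 x02; case/andP: uu0 => u01 u02.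
  case: V => [kn jE uE xE B|kE jm uE xE B|kE jm uE xE B|_ kE jE uE xE B|
    _ kE ji' uE xE B].
  - have k0 : k = 0%N by clear -jE ji; lia.
    have := @loF _ c b i xl xr w t w0 t0 im k r kn; rewrite k0 eqxx => lE.
    by rewrite k0 in y1; rewrite jE k0 in xE; lra.
  - by clear -jm ji i1; lia.
  - by lra.
  - by clear -jE ji i0; lia.
  - have := @hiG _ c b i xl xr w t w0 t0 im j r bT ji'; rewrite ji eqxx => hE.
    by rewrite kE ji in y2; rewrite ji in xE; lra.
have D0 := middle_dom km0 uw0 cc.
have [uu old] := em _ _ _ _ _ _ D' D0 E; subst u0.
case/andP: uw0 => u01 u02; case/andP: cc.
case: V => [kn jE uE xE B|kE jm uE xE B|kE jm uE xE B|bT kE jE uE xE B|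
    bT kE ji' uE xE B]; try by lra.
- case/andP: B => B1 B2; rewrite /chi => _ c2; case: old => [[jj xx]|[jj xx xx']|[jj xx xx']].
  + by move: c2; rewrite -jj jm eqxx; lra.
  + by move: km0; rewrite jj jm ltnn.
  + by have := @lo_lt_far _ _ _ _ gc w0 t0 room _ u _ rt jm; rewrite -xE xx' ltxx => F; have : false by apply: F; lra.
- case/andP: B => B1 B2; rewrite /clo => c1 _; case: old => [[jj xx]|[jj xx xx']|[jj xx xx']].
  + by move: c1; rewrite -jj jE bT /=; lra.
  + have E0 : t / 2 + r = hi c 0 u by rewrite -xE xx jE.
    have [i0 i1 _ _] := bar_fits Hcut bT.
    have := @near_lt_hi _ _ _ _ gc w0 t0 u _ rt (leq_ltn_trans i0 (ltnW i1)).
    by rewrite E0 ltxx => F; have : false by apply: F; lra.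
  + by move: jj; rewrite jE.
Qed.

Lemma lo_close (c' : chain R) v k u u' : polyline c' -> good c' v -> (k < psize c')%N ->
  `|lo c' k u - lo c' k u'| <= `|u - u'| /\ `|hi c' k u - hi c' k u'| <= `|u - u'|.
Proof.
move=> pc' _ km; have T j : `|turn c' j| <= 1.
  rewrite /turn; case: j => [|j] /=; first by rewrite normr0 ler01.
  case: ifP => [jm|_]; last by rewrite normr0 ler01.
  rewrite -(cross_turn pc' jm).
  by case: pc' => _ _ _ _ /(_ _ jm)[]->; rewrite ?normrN normr1.
rewrite /lo /hi.
have -> : plen c' k - turn c' k.+1 * u - (plen c' k - turn c' k.+1 * u') =
  turn c' k.+1 * (u' - u) by ring.
have -> : turn c' k * u - turn c' k * u' = turn c' k * (u - u') by ring.
by split; rewrite normrM ?[`|u' - u|]distrC; apply: ler_piMl.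
Qed.

Lemma closure_dug : closure (ribbon c (w + 2 * t) `\` dug) = ribbon new t.
Proof.
have w_gt0 := w0; have t_gt0 := t0.
have gn := good_next gc w0 t0 room im Hcut; have [pn thn _] := gn.
rewrite eqEsubset; split.
  rewrite [X in _ `<=` X](closure_id _).1; last exact: closed_ribbon.
  by apply: closureS => z [rz nd]; exact: ribbon_dug.
move=> z [k [y [r [D ->]]]]; apply/closure_boxP => e e0.
have [km rt /andP[y1 y2]] := D.
(* Moving r by e / 5 moves the bounds for y by at most e / 5, so y moves by at most 2 e / 5; the
   total of 3 e / 5 is below e. *)
have [||||r' [r1 r2 rr]] := @pick_inside R (- (t / 2)) (t / 2) r 0 (e / 5).
- by lra.
- by rewrite subr0 addr0.
- by [].
- by lra.
rewrite add0r in rr.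
have rt' : - (t / 2) <= r' <= t / 2 by rewrite !ltW.
have [l1 h1] := lo_close r r' pn gn km.
have [||||y' [y1' y2' yy]] := @pick_inside R (lo new k r') (hi new k r') y (e / 5) (e / 5).
- exact: thn.
- move: l1 h1; rewrite !ler_norml => /andP[l1 l2] /andP[h1 h2].
  by lra.
- by lra.
- by lra.
exists (cpt new k y' r'); split; last 2 first.
- have [ax' _] : axis (pdir new k) /\ True by split=> //; case: pn => _ /(_ k km).
  have [H1 _] := pt_close (vert new k) y r y' r' ax'.
  by apply: le_lt_trans H1 _; lra.
- have [ax' _] : axis (pdir new k) /\ True by split=> //; case: pn => _ /(_ k km).
  have [_ H1] := pt_close (vert new k) y r y' r' ax'.
  by apply: le_lt_trans H1 _; lra.
split; last by apply: inner_not_dug => //; apply/andP.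
have D1 : dom new t k y' r' by split=> //; rewrite !ltW.
have [j [x [u [V ->]]]] := dom_view gc w0 t0 im D1.
have D2 := view_dom_old gc w0 t0 room im Hcut rt' V.
by exists j, x, u.
Qed.

Lemma roomy_next s : roomy new s.
Proof.
move=> E; exfalso; have := @psize_next _ c b i xl xr w t w0 t0 im; rewrite E.
by have := im; clear -R; lia.
Qed.

End StepSets.

(** * Survival of the peak points *)

Section Peaks.
Variable R : realType.
Implicit Types (c : chain R) (p : R * R) (w t s l x y u r : R) (k : nat).

(* With s = 1 (resp. -1), p is the midpoint of an edge of length l of the     *)
(* left (resp. right) side of the strip c of width w, where the strip makes   *)
(* two left (resp. right) turns in a row.                                     *)
Definition peak c w s p l : Prop := exists k, [/\ (k < psize c)%N,
  turn c k = s, turn c k.+1 = s, plen c k = w + l &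
  p = cpt c k (plen c k / 2) (s * (w / 2))].

Lemma peak_inner c w s p l : polyline c -> s = 1 \/ s = -1 ->
  peak c w s p l -> exists k, [/\ (0 < k < (psize c).-1)%N,
  turn c k = s, turn c k.+1 = s, plen c k = w + l &
  p = cpt c k (plen c k / 2) (s * (w / 2))].
Proof.
move=> pcc s1 [k [km t1 t2 L pE]]; exists k; split=> //; apply/andP; split.
  by move: t1; rewrite /turn; case: k {km t2 L pE} => //=; case: s1 => ->; lra.
rewrite ltn_predRL ltn_neqAle km andbT; apply/eqP => E; move: t2; rewrite E turnm.
by case: s1 => ->; lra.
Qed.

Lemma peak_neq c w p q l l' : good c w -> 0 < w -> 0 <= l -> 0 <= l' ->
  peak c w 1 p l -> peak c w (-1) q l' -> p <> q.
Proof.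
move=> [pcc th em] w0 l0 l0' [k [km t1 t2 L ->]] [k' [km' t1' t2' L' ->]] E.
have [||+ _] := em _ _ _ _ _ _ _ _ E; last by lra.
  by split=> //; first (by lra);
    rewrite /lo /hi t1 t2 L; lra.
by split=> //; first (by lra);
  rewrite /lo /hi t1' t2' L'; lra.
Qed.

Variables (c : chain R) (b : bool) (i : nat) (xl xr w t : R).
Local Notation m := (psize c).
Local Notation n1 := (psize c - i)%N.
Local Notation h := ((w + t) / 2).
Local Notation new := (next_chain c b i xl xr w t).
Hypotheses (gc : good c (w + 2 * t)) (w0 : 0 < w) (t0 : 0 < t).
Hypothesis im : (i < m)%N.
Hypothesis Hcut : cut_fits c b i xl xr w t.

(** The new strip goes around the far end of the canal by two left turns, having the canal on its
    left. *)
Lemma peak_new : peak new t 1 (cpt c m.-1 (plen c m.-1 - t) 0) w.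
Proof.
exists n1; split.
- by have := @psize_next _ c b i xl xr w t w0 t0 im; have := psize_gt0 gc; clear -R; lia.
- exact: turnE gc w0 t0 im.
- exact: turnB1 gc w0 t0 im.
- by rewrite [plen new _]/= by_kindE; ring.
- by rewrite cptE [plen new _]/= by_kindE; congr cpt; field.
Qed.

(** The left wall is followed backwards, which turns two left turns into two right turns and puts
    the old shore on the right. The edge itself is unchanged, hence the same l. *)
Lemma peak_left p l : peak c (w + 2 * t) 1 p l -> peak new t (-1) p l.
Proof.
move=> /(peak_inner (chain_polyline gc) (or_introl erefl))[k [/andP[k0]]].
rewrite ltn_predRL => km t1 t2 L ->; have km' := ltnW km.
have startBE : startB c b w t k = h by rewrite /startB gtn_eqF// /lo t1; ring.
have stopBE : stopB c w t k = plen c k - h.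
  by rewrite /stopB ltn_eqF// /hi t2; ring.
have LE : plen new (n1 + m - k) = t + l.
  rewrite [plen new _]/= (by_kindB w0 t0 im)// startBE stopBE L.
  by field.
exists (n1 + m - k)%N; split=> //.
- by have := @psize_next _ c b i xl xr w t w0 t0 im; clear -k0 km; lia.
- by rewrite (turnB _ _ _ w0 t0 im)// t2.
- have -> : (n1 + m - k).+1 = (n1 + m - k.-1)%N by clear -k0 km; lia.
  rewrite (turnB _ _ _ w0 t0 im) ?prednK ?t1//.
- by rewrite cptB// stopBE LE L; congr cpt; field.
Qed.

(** The right wall is followed in the old direction, so its peaks stay on the right; only the one at
    which the bar starts is lost. *)
Lemma peak_right p l :
  (b -> p <> cpt c i (plen c i / 2) (- (w / 2 + t))) ->
  peak c (w + 2 * t) (-1) p l -> peak new t (-1) p l.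
Proof.
move=> np /(peak_inner (chain_polyline gc) (or_intror erefl))[k [/andP[k0]]].
rewrite ltn_predRL => km t1 t2 L pE; have km' := ltnW km.
have loE : lo c k (- h) = h by rewrite /lo t1; ring.
have hiE : hi c k (- h) = plen c k - h by rewrite /hi t2; ring.
have ki : k <> i.
  move=> ki; case bT: b.
    by apply: np => //; rewrite pE ki; congr cpt; field.
  have [|i0 _] := side_fits Hcut; first by rewrite bT.
  by move: k0; rewrite ki i0.
have [ik|ki'] := ltnP i k.
  have kE : k = (i + (k - i))%N by clear -ik; lia.
  have kn : (k - i < n1)%N by clear -ik km'; lia.
  have startE : startF c i xr w t k = h by rewrite /startF gtn_eqF.
  have stopE : stopF c w t k = plen c k - h by rewrite /stopF ltn_eqF.
  have LE : plen new (k - i) = t + l.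
    by rewrite [plen new _]/= by_kindF// -kE startE stopE L; field.
  exists (k - i)%N; split=> //.
  - by have := @psize_next _ c b i xl xr w t w0 t0 im; clear -kn; lia.
  - by rewrite (turnF _ _ _ w0 t0 im) -?kE//; clear -ik kn; lia.
  - rewrite (turnF _ _ _ w0 t0 im); first by rewrite addnS -kE.
    by clear -ik km; lia.
  - by rewrite cptF// -kE startE LE pE L; congr cpt; field.
have {ki'} ki' : (k < i)%N by rewrite ltn_neqAle ki'; apply/andP; split=> //; apply/eqP.
have bT : b.
  case: (boolP b) => // /negP nb; have [i0 _] := side_fits Hcut nb.
  by move: ki'; rewrite i0.
have startE : startG c w t k = h by rewrite /startG gtn_eqF.
have stopE : stopG c i xl w t k = plen c k - h by rewrite /stopG ltn_eqF.
have LE : plen new ((n1 + m).+2 + k) = t + l.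
  by rewrite [plen new _]/= (by_kindG w0 t0 im) startE stopE L; field.
exists ((n1 + m).+2 + k)%N; split=> //.
- exact: segmentG bT (ltnW ki').
- by rewrite (turnG _ _ w0 t0 im bT)//; rewrite k0 ltnW.
- by rewrite -addnS (turnG _ _ w0 t0 im bT).
- by rewrite cptG ?(ltnW ki')// startE LE pE L; congr cpt; field.
Qed.

End Peaks.

(** * Existence of the canals *)

Section Islands.
Variable R : realType.
Implicit Types (a : nat -> R) (C : nat -> set (R * R)) (n k : nat).

Lemma land_width0 a : land_width a 0 = 1.
Proof. by rewrite /land_width big_geq. Qed.

Lemma land_widthS a n : land_width a n.+1 = land_width a n * (a n.+1)^-1.
Proof. by rewrite /land_width big_nat_recr. Qed.

Lemma canal_widthS a n : canal_width a n.+1 =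
  land_width a n - 2 * land_width a n.+1.
Proof. by rewrite /canal_width land_widthS /=; ring. Qed.

Lemma land_width_gt0 a n : (forall k, (1 <= k)%N -> 2 < a k) ->
  0 < land_width a n.
Proof.
move=> a2; rewrite /land_width big_seq; apply: prodr_gt0 => k.
by rewrite mem_index_iota invr_gt0 => /andP[k1 _]; have := a2 k k1; lra.
Qed.

Lemma land_width_half a n : (forall k, (1 <= k)%N -> 2 < a k) ->
  2 * land_width a n.+1 < land_width a n.
Proof.
move=> a2; have t0 := land_width_gt0 n a2; have := a2 n.+1 isT.
rewrite land_widthS mulrCA => a2'; rewrite gtr_pMr// ltr_pdivrMr; lra.
Qed.

Lemma canal_width_gt0 a n : (forall k, (1 <= k)%N -> 2 < a k) ->
  0 < canal_width a n.+1.
Proof. by move=> a2; rewrite canal_widthS; have := land_width_half n a2; lra. Qed.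

Lemma closed_unit_square : closed (@unit_square R).
Proof.
have -> : @unit_square R = trap (0, 0) (1, 0) 0 1 0 0 1 0.
  rewrite trapE; last by constructor 1.
  rewrite eqEsubset /coordx /coordu /unit_square; split=> -[x y] /=.
    by move=> [/andP[? ?] /andP[? ?]]; split; lra.
  by move=> [/andP[? ?] /andP[? ?]]; split; lra.
by apply: closed_trap; constructor 1.
Qed.

Lemma island0 C : island C 0 = (@unit_square R).
Proof.
rewrite /island (_ : \bigcup_(_ in _) _ = set0) ?setD0.
  by rewrite -(closure_id _).1//; exact: closed_unit_square.
by rewrite -subset0 => z [k /= /andP[k1 k0]]; move: k1; rewrite lt0n -leqn0 k0.
Qed.

(** A point off the closed canal has a neighbourhood free of it, so land approximating the point
    before the dig still does so afterwards. *)
Lemma islandS C n : closed (C n.+1) ->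
  island C n.+1 = closure (island C n `\` C n.+1).
Proof.
move=> cC; rewrite /island; set A := (@unit_square R) `\` _; set B := (@unit_square R) `\` _.
have AE : A = B `\` C n.+1.
  rewrite /A /B eqEsubset; split=> z.
    move=> [sz nA]; split; last by move=> Cz; apply: nA; exists n.+1 => //=; rewrite ltnSn.
    by split=> // -[k /= /andP[k1 kn] Ckz]; apply: nA; exists k => //=; rewrite k1 leqW.
  move=> [[sz nB] nC]; split=> // -[k /= /andP[k1]].
  rewrite leq_eqVlt => /orP[/eqP -> //|kn] Ckz.
  by apply: nB; exists k => //=; rewrite k1.
rewrite AE eqEsubset; split.
  by apply: closureS => z [Bz nC]; split=> //; exact: subset_closure.
rewrite [X in _ `<=` X](closure_id _).1; last exact: closed_closure.
apply: closureS => z [clB nC]; apply/closure_boxP => e e0.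
have /nbhs_boxP[d d0 Hd] : nbhs z (~` C n.+1).
  by apply: open_nbhs_nbhs; split=> //; exact: closed_openC.
have m0 : 0 < Num.min e d by rewrite lt_min e0 d0.
have [z' [Bz' h1 h2]] := (closure_boxP z B).1 clB _ m0.
exists z'; split; [split=> //; apply: Hd| |].
- by apply: lt_le_trans h1 _; rewrite ge_min lexx orbT.
- by apply: lt_le_trans h2 _; rewrite ge_min lexx orbT.
- by apply: lt_le_trans h1 _; rewrite ge_min lexx.
- by apply: lt_le_trans h2 _; rewrite ge_min lexx.
Qed.

Lemma islandS_sub C n : island C n.+1 `<=` island C n.
Proof.
apply: closureS => z [sz nA]; split=> // -[k /= /andP[k1 kn] Cz].
by apply: nA; exists k => //=; rewrite k1 leqW.
Qed.

(** The square itself is a strip of width 1 with one segment; thus Day 1 is an instance of the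
    general step. *)
Definition square_chain : chain R :=
  Chain 1 (fun i => if (i == 0)%N then (0, 1 / 2) else (1, 1 / 2))
    (fun=> (1, 0)) (fun=> 1).

Lemma good_square_chain : good square_chain 1.
Proof.
have tn k : turn square_chain k = 0.
  by rewrite /turn /=; case: k => [|k] //=; rewrite ltnS.
split.
- split=> //; first by move=> k _; constructor 1.
  by case=> // _; rewrite /cpt /pt /=; congr pair; ring.
- by move=> k u _ _; rewrite /lo /hi !tn /= !mul0r subr0.
- move=> [|k] x u [|l] y u' [//= _ _ _] [//= _ _ _].
  move=> /(pt_inj (Or41 _ _ _ erefl)) [-> ->]; split=> //; first by constructor 1.
Qed.

Lemma ribbon_square_chain : ribbon square_chain 1 = (@unit_square R).
Proof.
have tn k : turn square_chain k = 0.
  by rewrite /turn /=; case: k => [|k] //=; rewrite ltnS.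
rewrite eqEsubset; split=> z.
  move=> [[|k] [x [u [[//= _ /andP[u1 u2]]]]]].
  rewrite /lo /hi !tn /= !mul0r subr0 => /andP[x1 x2] ->.
  by split=> /=; lra.
case: z => z1 z2 [/= /andP[h1 h2] /andP[h3 h4]].
exists 0%N, z1, (z2 - 1 / 2); split.
  split=> //; first by lra.
  by rewrite /lo /hi !tn /= !mul0r subr0; apply/andP.
by rewrite /cpt /pt /=; congr pair; ring.
Qed.

End Islands.

Section DependentChoice.

Lemma dependent_choice_inv (T : Type) (I : nat -> T -> Prop)
    (r : nat -> T -> T -> Prop) (x0 : T) : I 0%N x0 ->
  (forall n x, I n x -> exists y, I n.+1 y /\ r n x y) ->
  exists f : nat -> T, [/\ f 0%N = x0, forall n, I n (f n) &
    forall n, r n (f n) (f n.+1)].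
Proof.
move=> I0 step.
have [g gP] : exists g : nat -> T -> T, forall n x, I n x ->
    I n.+1 (g n x) /\ r n x (g n x).
  exists (fun n x => if pselect (I n x) is left Ix
    then projT1 (cid (step n x Ix)) else x) => n x Ix.
  by case: pselect => // Ix'; exact: (projT2 (cid (step n x Ix'))).
pose f := fix f n := if n is k.+1 then g k (f k) else x0.
have If n : I n (f n) by elim: n => //= n /gP[].
by exists f; split=> // n; exact: (gP _ _ (If n)).2.
Qed.

End DependentChoice.

Section Existence.
Variables (R : realType) (a : nat -> R).
Hypothesis a2 : forall k, (1 <= k)%N -> 2 < a k.
(** The bar of canal n must fit into the edge in which canal n - 3 terminates. *)
Hypothesis narrowing : forall n, (4 <= n)%N ->
  canal_width a n < canal_width a (n - 3).

Local Notation t := (land_width a).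
Local Notation w := (canal_width a).

(* Here st_peak1, st_peak2, st_peak3 are peak points of the last canal, of the *)
(* one before it, and of the one before that; after n days the next canal     *)
(* (n >= 3) starts at st_peak3.                                               *)
Record state := State {
  st_chain : chain R;
  st_island : set (R * R);
  st_canal : set (R * R);
  st_peaks : set (R * R);
  st_peak1 : R * R;
  st_peak2 : R * R;
  st_peak3 : R * R }.

Implicit Types x y : state.

(** The condition for n <= 2 serves the canals entering from the left side of the square, and for n
    = 1 it selects the lower end. The newest peak is on the left, the older ones on the right, where
    a bar may be dug. Since [st_peak2] and [st_peak3] differ, the bar at the latter does not destroy
    the former. *)
Definition invariant n x : Prop := let c := st_chain x in
  [/\ good c (t n), st_island x = ribbon c (t n), roomy c (t n.+1),
    (n <= 2)%N -> [/\ (vert c 0).1 = 0, pdir c 0 = (1, 0) &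
      n = 1%N -> (vert c 0).2 < (vert c (psize c)).2] &
    [/\ (1 <= n)%N -> peak c (t n) 1 (st_peak1 x) (w n),
        (2 <= n)%N -> peak c (t n) (-1) (st_peak2 x) (w n.-1),
        (3 <= n)%N -> peak c (t n) (-1) (st_peak3 x) (w n.-2) &
        (3 <= n)%N -> st_peak2 x <> st_peak3 x]].

Definition dig n x y : Prop := let c := st_chain x in
  let m := psize c in let v := vert c in
  [/\ closed (st_canal y), st_island y = closure (st_island x `\` st_canal y),
    st_peak2 y = st_peak1 x /\ st_peak3 y = st_peak2 x,
    st_peaks y (st_peak1 y) &
    if (n < 3)%N then
      st_canal y = strip m (cut_end m v (t n.+1)) (w n.+1) /\
      st_peaks y = [set cut_end m v (t n.+1) m]
    else exists i s u,
    let mid := cut_start (cut_end m v (t n.+1)) (t n.+1) in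
    let p := parallel_pt m v i s u in
    let q := move p (- u) (normal (v i) (v i.+1)) in
    [/\ [/\ (i < m)%N, 0 <= s <= 1 & `|u| = t n / 2],
        st_peak3 x = p,
        st_canal y = bar p q (w n.+1) `|` strip m mid (w n.+1) &
        st_peaks y = [set mid 0%N; mid m]]].

Lemma dig_side n x : (n < 3)%N -> invariant n x ->
  exists y, invariant n.+1 y /\ dig n x y.
Proof.
move=> n3 [gc IE rm st [p1 p2 p3 p23]].
have t0 := land_width_gt0 n.+1 a2; have w0 := canal_width_gt0 n a2.
have tE : t n = w n.+1 + 2 * t n.+1 by rewrite canal_widthS; ring.
have {st} [v1 d0 v2] := st n3.
have gc' : good (st_chain x) (w n.+1 + 2 * t n.+1) by rewrite -tE.
pose c := st_chain x; have pcc : polyline c by case: gc.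
have m_gt0 : (0 < psize c)%N by case: pcc.
have fits : cut_fits c false 0 0 0 (w n.+1) (t n.+1) by [].
pose new := next_chain c false 0 0 0 (w n.+1) (t n.+1).
pose D := dug c false 0 0 0 (w n.+1) (t n.+1).
have DE : D = strip (psize c) (cut_end (psize c) (vert c) (t n.+1)) (w n.+1).
  by rewrite /D /dug set0U -(strip_mid false gc' w0 t0 rm).
pose p := cut_end (psize c) (vert c) (t n.+1) (psize c).
have pE : p = cpt c (psize c).-1 (plen c (psize c).-1 - t n.+1) 0.
  by rewrite /p -(mid_last false pcc t0).
have v0E : vert new 0 = cpt c 0 0 (- ((w n.+1 + t n.+1) / 2)).
  by rewrite [vert _ _]/= by_kindF ?subn0.
have d0E : pdir new 0 = pdir c 0 by rewrite [pdir _ _]/= by_kindF ?subn0.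
have vmE : vert new (psize new) = cpt c 0 0 ((w n.+1 + t n.+1) / 2).
  by rewrite [vert _ _]/= (by_kindS w0 t0 m_gt0).
exists (State new (ribbon new (t n.+1)) D [set p] p (st_peak1 x) (st_peak2 x)).
split; split; rewrite ?[st_chain _]/= ?[st_island _]/= ?[st_canal _]/=
  ?[st_peaks _]/= ?[st_peak1 _]/= ?[st_peak2 _]/= ?[st_peak3 _]/= //.
- exact: good_next.
- by apply: roomy_next.
- move=> n2; split.
  + by rewrite v0E /cpt /pt /= -/c v1 d0 /=; ring.
  + by rewrite d0E.
  + by move=> _; rewrite v0E vmE /cpt /pt /= -/c d0 /=; lra.
- split.
  + by move=> _; rewrite pE; exact: peak_new.
  + move=> n1; rewrite ltnS in n1; apply: peak_left => //.
    by rewrite -tE; exact: p1.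
  + move=> n2; rewrite ltnS in n2; apply: (peak_right gc' w0 t0 m_gt0 fits) => //.
    by rewrite -tE; exact: p2.
  (* The two peaks were on different sides of the old strip. *)
  + move=> n2; rewrite ltnS in n2; have n1 : (0 < n)%N by exact: leq_trans n2.
    apply: (peak_neq gc (land_width_gt0 n a2) _ _ (p1 n1) (p2 n2)).
    * have : 0 < w n.-1.+1 by exact: canal_width_gt0.
      by rewrite prednK//; exact: ltW.
    * have : 0 < w n.-2.+1 by exact: canal_width_gt0.
      case: (n) n2 => [|[|k]] // _ /= H; exact: ltW H.
- by rewrite /D /dug set0U; exact: closed_middle.
- by rewrite IE tE; rewrite closure_dug.
- by rewrite n3.
Qed.

Lemma dig_bar n x : (3 <= n)%N -> invariant n x ->
  exists y, invariant n.+1 y /\ dig n x y.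
Proof.
move=> n3 [gc IE rm _ [p1 p2 p3 p23]].
have t0 := land_width_gt0 n.+1 a2; have w0 := canal_width_gt0 n a2.
have tE : t n = w n.+1 + 2 * t n.+1 by rewrite canal_widthS; ring.
have gc' : good (st_chain x) (w n.+1 + 2 * t n.+1) by rewrite -tE.
pose c := st_chain x; have pcc : polyline c by case: gc.
have m_gt0 : (0 < psize c)%N by case: pcc.
have [i [/andP[i0]]] := peak_inner pcc (or_intror erefl) (p3 n3).
rewrite ltn_predRL => i1 t1 t2 L pE.
have im : (i < psize c)%N by exact: ltnW.
have nar : w n.+1 < w n.-2.
  by have := @narrowing n.+1 n3; rewrite (_ : n.+1 - 3 = n.-2)%N//; clear -n3; lia.
pose xl := plen c i / 2 - w n.+1 / 2; pose xr := plen c i / 2 + w n.+1 / 2.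
have fits : cut_fits c true i xl xr (w n.+1) (t n.+1).
  (* The segment has length t_n + w_(n-2) and the bar is centred on it, so clearing both mitres
     means exactly w_(n+1) < w_(n-2). *)
  by split=> //; rewrite /xl /xr -?tE -/c L; split; lra.
pose new := next_chain c true i xl xr (w n.+1) (t n.+1).
pose D := dug c true i xl xr (w n.+1) (t n.+1).
pose mid := cut_start (cut_end (psize c) (vert c) (t n.+1)) (t n.+1).
have midE : strip (psize c) mid (w n.+1) = middle c true (w n.+1) (t n.+1).
  by rewrite -(strip_mid true gc' w0 t0 rm).
have pmE : mid (psize c) = cpt c (psize c).-1 (plen c (psize c).-1 - t n.+1) 0.
  by rewrite -(mid_last true pcc t0).
have ppE : parallel_pt (psize c) (vert c) i (1 / 2) (- (t n / 2)) =
    cpt c i (plen c i / 2) (- (t n / 2)).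
  by rewrite parallel_ptE// /lo /hi t1 t2; congr cpt; field.
have qE : move (cpt c i (plen c i / 2) (- (t n / 2))) (- - (t n / 2))
   (normal (vert c i) (vert c i.+1)) = cpt c i (plen c i / 2) 0.
  by rewrite normal_vert// /move /cpt /pt /perp /=; congr pair; ring.
have tn0 := land_width_gt0 n a2.
have barE : bar (cpt c i (plen c i / 2) (- (t n / 2))) (cpt c i (plen c i / 2) 0)
    (w n.+1) = barset c i xl xr (w n.+1) (t n.+1).
  rewrite bar_rect//; last by rewrite lt_eqF//; lra.
  rewrite eqEsubset; split=> z.
    move=> [y [l [y1 /andP[l0 l1] ->]]]; exists y, (l * - (t n / 2)); split=> //.
    by apply/andP; split; [rewrite tE in tn0 *; nra|nra].
  move=> [y [u [y1 /andP[u0 u1] ->]]]; exists y, (u / - (t n / 2)); split=> //.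
    rewrite invrN mulrN -mulNr.
    by apply/andP; split; [apply: divr_ge0; lra|rewrite ler_pdivrMr; lra].
  by rewrite divfK// oppr_eq0 gt_eqF//; lra.
(* Of the two peak points the one at the far end is recorded for later use; [peak_new] applies to
   it. *)
exists (State new (ribbon new (t n.+1)) D [set mid 0%N; mid (psize c)]
  (mid (psize c)) (st_peak1 x) (st_peak2 x)).
split; split; rewrite ?[st_chain _]/= ?[st_island _]/= ?[st_canal _]/=
  ?[st_peaks _]/= ?[st_peak1 _]/= ?[st_peak2 _]/= ?[st_peak3 _]/= //.
- exact: good_next.
- by move=> n2; exfalso; clear -n2 n3; lia.
- have n1 : (0 < n)%N by exact: leq_trans n3.
  have n2 : (1 < n)%N by exact: leq_trans n3.
  split=> _.
  + by rewrite pmE; exact: peak_new.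
  + apply: peak_left => //.
    by rewrite -tE; exact: p1.
  + apply: (peak_right gc' w0 t0 im fits); last by rewrite -tE; exact: p2.
    move=> _ E; apply: (p23 n3); rewrite E pE /c tE; congr cpt; lra.
  + apply: (peak_neq gc tn0 _ _ (p1 n1) (p2 n2)).
    * have : 0 < w n.-1.+1 by exact: canal_width_gt0.
      by rewrite prednK//; exact: ltW.
    * have : 0 < w n.-2.+1 by exact: canal_width_gt0.
      case: (n) n2 => [|[|k]] // _ /= H; exact: ltW H.
- rewrite /D /dug -midE; apply: closedU; last by rewrite midE; exact: closed_middle.
  suff -> : barset c i xl xr (w n.+1) (t n.+1) = rect c i (- (w n.+1 / 2 + t n.+1)) 0 xl xr.
    by apply: closed_trap; case: pcc => _ ax _ _ _; exact: ax.
  rewrite eqEsubset; split=> z [y [u [h1 h2 h3]]]; exists y, u; split=> //.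
    by rewrite !mul0r !addr0.
  by rewrite !mul0r !addr0 in h2.
- by rewrite IE tE; rewrite closure_dug.
- by right.
- rewrite ifF; last by apply/negbTE; rewrite -leqNgt.
  exists i, (1 / 2), (- (t n / 2)); cbv zeta; rewrite -/c -/mid ppE qE barE midE.
  split=> //.
    split=> //; first by lra.
    by rewrite normrN ger0_norm//; lra.
  by rewrite pE; congr cpt; ring.
Qed.

Lemma wada_canals_exist : exists C P : nat -> set (R * R), wada_canals a C P.
Proof.
pose x0 := State (square_chain R) (@unit_square R) set0 set0 (0, 0) (0, 0) (0, 0).
have I0 : invariant 0 x0.
  have t1 := land_width_half 0 a2; rewrite land_width0 in t1.
  split=> //=; rewrite ?land_width0.
  - exact: good_square_chain.
  - by rewrite ribbon_square_chain.
have [|f [f0 If rf]] := dependent_choice_inv I0 (r := dig).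
  by move=> n x; case: (ltnP n 3) => n3; [exact: dig_side|exact: dig_bar].
pose C n := st_canal (f n); pose P n := st_peaks (f n).
have clC n : closed (C n.+1) by have [] := rf n.
have islE n : island C n = st_island (f n).
  elim: n => [|n IH]; first by rewrite island0 f0.
  by rewrite islandS// IH; have [_ -> _ _ _] := rf n.
have strE n : is_strip (psize (st_chain (f n))) (vert (st_chain (f n)))
    (t n) (island C n).
  rewrite islE; have [gc -> _ _ _] := If n; exact: good_is_strip.
exists C, P; split.
- have [_ _ _ _ /= [CE PE]] := rf 0%N; rewrite f0 /= in CE PE.
  have t0 := land_width_gt0 1 a2; have w0 := canal_width_gt0 0 a2.
  have t1 := land_width_half 0 a2; rewrite land_width0 in t1.
  have t1E : t 1 = (a 1%N)^-1 by rewrite land_widthS land_width0 mul1r.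
  have wE : 1 = w 1 + 2 * t 1 by rewrite canal_widthS land_width0; ring.
  have gs : good (square_chain R) (w 1 + 2 * t 1).
    by rewrite -wE; exact: good_square_chain.
  have rs : roomy (square_chain R) (t 1) by [].
  have ps : polyline (square_chain R) by case: gs.
  split.
    rewrite /C CE; have sE := strip_mid false gs w0 t0 rs.
    transitivity (middle (square_chain R) false (w 1) (t 1)); first exact: sE.
    rewrite -t1E eqEsubset; split=> -[z1 z2] /=.
      move=> [[|k] [x [u [//= _ /andP[u1 u2]]]]].
      rewrite /clo /chi /= /lo /turn /= mul0r => /andP[x1 x2] [-> ->].
      by split; lra.
    move=> [/andP[h1 h2] /andP[h3 h4]].
    exists 0%N, z1, (z2 - 1 / 2); rewrite /clo /chi /= /lo /turn /= mul0r; split=> //.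
    + by lra.
    + by lra.
    + by rewrite /cpt /pt /=; congr pair; ring.
  rewrite /P PE; have mE := mid_last false ps t0.
  transitivity [set cpt (square_chain R) 0 (1 - t 1) 0]; first by congr set1; exact: mE.
  by rewrite -t1E; congr set1; rewrite /cpt /pt /=; congr pair; ring.
- move=> n /andP[n2 n3]; case: n n2 n3 => [|n] // n2 n3.
  have [_ _ _ _] := rf n; rewrite n3 => -[CE PE].
  exists (psize (st_chain (f n))), (vert (st_chain (f n))); split=> //=.
  + by have [_ _ _ /(_ n3)[]] := If n.
  + by move=> [n1]; have [_ _ _ /(_ n3)[_ _ /(_ n1)]] := If n.
- move=> n n4; case: n n4 => [|n] // n4.
  have [_ _ _ _] := rf n; rewrite ifF; last by apply/negbTE; rewrite -leqNgt.
  move=> [i [s [u [h1 pE CE PE]]]].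
  exists (psize (st_chain (f n))), (vert (st_chain (f n))), i, s, u; split=> //=.
  rewrite -pE; case: n n4 {h1 pE CE PE} => [|[|[|n]]] // _.
  (* The peak recorded on Day n + 1 is [st_peak2] one day later and [st_peak3] two days later. *)
  rewrite (_ : n.+4 - 3 = n.+1)%N; last by rewrite -addn3 addnK.
  have [_ _ [_ ->] _ _] := rf n.+2; have [_ _ [-> _] _ _] := rf n.+1.
  by have [_ _ _ H _] := rf n.
Qed.

End Existence.

(** * Area of a strip *)

Section Area.
Variable R : realType.
Local Notation mu := (@lebesgue_measure R).
Local Notation plane := (measurableTypeR R * measurableTypeR R)%type.
Implicit Types (A : set plane) (p d : R * R) (a b e : R).

Definition area : set plane -> \bar R := (mu \x mu)%E.

HB.instance Definition _ := Measure.on area.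

Lemma area_swap A : measurable A -> area A = (mu \x^ mu)%E A.
Proof.
by move=> mA; apply: product_measure_unique => // X Y mX mY; exact: product_measure2E.
Qed.

Lemma integral_affine (a b e f : R) : a <= b ->
  (\int[mu]_(x in `[a, b]) (e + f * x)%:E)%E =
  ((b - a) * e + f * (b ^+ 2 - a ^+ 2) / 2)%:E.
Proof.
rewrite le_eqVlt => /orP[/eqP ->|ab].
  rewrite set_itv1 integral_set1 !subrr; congr (_%:E); ring.
pose F x := e * x + f / 2 * x ^+ 2 : R.
have dF x : is_derive x (1 : R) F (e + f * x).
  rewrite /F; apply: is_derive_eq.
  by rewrite /GRing.scale /=; field.
rewrite (@continuous_FTC2 _ _ F)//.
- by rewrite -EFinB /F; congr (_%:E); field.
- apply: continuous_subspaceT => x; apply: cvgD; first exact: cvg_cst.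
  by apply: cvgM; [exact: cvg_cst|exact: cvg_id].
- split.
  + by move=> x _; have [] := dF x.
  + by apply: cvg_at_right_filter; apply: differentiable_continuous;
      apply/derivable1_diffP; have [] := dF a.
  + by apply: cvg_at_left_filter; apply: differentiable_continuous;
      apply/derivable1_diffP; have [] := dF b.
- by move=> x _; rewrite derive1E; have [_ ->] := dF x.
Qed.

Lemma area_xslices A a b e f : measurable A -> a <= b ->
  (forall x, a <= x <= b -> mu (xsection A x) = (e + f * x)%:E) ->
  (forall x, ~~ (a <= x <= b) -> xsection A x = set0) ->
  area A = ((b - a) * e + f * (b ^+ 2 - a ^+ 2) / 2)%:E.
Proof.
move=> mA ab H0 H1; rewrite -integral_affine// /area /product_measure1.
rewrite [RHS]integral_mkcond; apply: eq_integral => x _ /=.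
rewrite patchE; case: ifPn => [/set_mem|/negP xn].
  by rewrite /= in_itv /=; exact: H0.
rewrite H1 ?measure0//; apply/negP => xab; apply: xn.
by apply/mem_set; rewrite /= in_itv.
Qed.

Lemma area_yslices A a b e f : measurable A -> a <= b ->
  (forall y, a <= y <= b -> mu (ysection A y) = (e + f * y)%:E) ->
  (forall y, ~~ (a <= y <= b) -> ysection A y = set0) ->
  area A = ((b - a) * e + f * (b ^+ 2 - a ^+ 2) / 2)%:E.
Proof.
move=> mA ab H0 H1; rewrite area_swap// -integral_affine// /product_measure2.
rewrite [RHS]integral_mkcond; apply: eq_integral => x _ /=.
rewrite patchE; case: ifPn => [/set_mem|/negP xn].
  by rewrite /= in_itv /=; exact: H0.
rewrite H1 ?measure0//; apply/negP => xab; apply: xn.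
by apply/mem_set; rewrite /= in_itv.
Qed.

(* A trapezoid without (s = true) or with (s = false) its upper end. *)
Definition gtrap (s : bool) p d (a b l0 l1 h0 h1 : R) : set plane :=
  [set z | exists x u, [/\ a <= u <= b,
    x \in Interval (BLeft (l0 + l1 * u)) (BSide s (h0 + h1 * u)) &
    z = pt p d x u]].

Lemma gtrapE s p d a b l0 l1 h0 h1 : axis d -> gtrap s p d a b l0 l1 h0 h1 =
  [set z | a <= coordu p d z <= b /\ coordx p d z \in
     Interval (BLeft (l0 + l1 * coordu p d z)) (BSide s (h0 + h1 * coordu p d z))].
Proof.
move=> ax; rewrite eqEsubset; split=> z /=.
  by move=> [x [u [? ? ->]]]; rewrite coordx_pt// coordu_pt.
by move=> [? ?]; exists (coordx p d z), (coordu p d z); rewrite pt_coord.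
Qed.

Lemma trap_gtrap p d a b l0 l1 h0 h1 :
  trap p d a b l0 l1 h0 h1 = gtrap false p d a b l0 l1 h0 h1.
Proof.
by rewrite eqEsubset; split=> z [x [u [? H ->]]]; exists x, u; split=> //;
  move: H; rewrite in_itv.
Qed.

Lemma measurable_plane_fun (a b e : R) :
  measurable_fun [set: plane] (fun z : plane => a * z.1 + b * z.2 + e).
Proof.
apply: measurable_funD; last exact: measurable_cst.
by apply: measurable_funD; apply: measurable_funM; (try exact: measurable_cst);
  [exact: measurable_fst|exact: measurable_snd].
Qed.

Lemma measurable_halfplane (s : bool) (a b e : R) :
  measurable ([set z | a * z.1 + b * z.2 + e \in Interval (BSide s 0) +oo%O] : set plane).
Proof.
have := measurable_plane_fun a b e measurableT
  (measurable_itv (Interval (BSide s 0) +oo%O)).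
by rewrite setTI.
Qed.

Lemma measurable_gtrap s p d a b l0 l1 h0 h1 : axis d ->
  measurable (gtrap s p d a b l0 l1 h0 h1).
Proof.
move=> ax; rewrite gtrapE//.
have -> : [set z | a <= coordu p d z <= b /\ coordx p d z \in
     Interval (BLeft (l0 + l1 * coordu p d z)) (BSide s (h0 + h1 * coordu p d z))]
  = [set z : plane | (- d.2) * z.1 + d.1 * z.2 + (p.1 * d.2 - p.2 * d.1 - a) \in Interval (BLeft 0) +oo%O] `&`
    [set z : plane | d.2 * z.1 + (- d.1) * z.2 + (b - (p.1 * d.2 - p.2 * d.1)) \in Interval (BLeft 0) +oo%O] `&`
    [set z : plane | (d.1 + l1 * d.2) * z.1 + (d.2 - l1 * d.1) * z.2 +
      (- (p.1 * d.1 + p.2 * d.2) - l0 - l1 * (p.1 * d.2 - p.2 * d.1)) \in Interval (BLeft 0) +oo%O] `&`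
    [set z : plane | (- d.1 - h1 * d.2) * z.1 + (- d.2 + h1 * d.1) * z.2 +
      (p.1 * d.1 + p.2 * d.2 + h0 + h1 * (p.1 * d.2 - p.2 * d.1)) \in Interval (BSide (~~ s) 0) +oo%O].
  rewrite eqEsubset /coordx /coordu; split=> z /=; case: s; rewrite !in_itv /= ?andbT.
  - by move=> [/andP[? ?] /andP[? ?]]; repeat split; lra.
  - by move=> [/andP[? ?] /andP[? ?]]; repeat split; lra.
  - by move=> [[[? ?] ?] ?]; split; lra.
  - by move=> [[[? ?] ?] ?]; split; lra.
by repeat apply: measurableI; exact: measurable_halfplane.
Qed.

Lemma mu_itv (s1 s2 : bool) (a b : R) : a <= b ->
  mu [set` Interval (BSide s1 a) (BSide s2 b)] = (b - a)%:E.
Proof.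
move=> ab; rewrite lebesgue_measure_itv /= lte_fin -EFinD; case: ifPn => //.
rewrite -leNgt => ba; congr (_%:E); lra.
Qed.

Lemma area_gtrap s p d a b l0 l1 h0 h1 : axis d -> a <= b ->
  (forall u, a <= u <= b -> l0 + l1 * u <= h0 + h1 * u) ->
  area (gtrap s p d a b l0 l1 h0 h1) =
  ((b - a) * (h0 - l0) + (h1 - l1) * (b ^+ 2 - a ^+ 2) / 2)%:E.
Proof.
move=> ax ab lh; have mA := measurable_gtrap s p a b l0 l1 h0 h1 ax.
case: ax mA => -> mA.
- rewrite (@area_yslices _ (p.2 + a) (p.2 + b) (h0 - l0 - (h1 - l1) * p.2) (h1 - l1))//.
  + by congr (_%:E); field.
  + by lra.
  + move=> y yab; rewrite (_ : ysection _ _ = [set` Interval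
      (BLeft (p.1 + (l0 + l1 * (y - p.2)))) (BSide s (p.1 + (h0 + h1 * (y - p.2))))]).
      by rewrite mu_itv; [congr (_%:E); ring|have := lh (y - p.2); lra].
    rewrite eqEsubset; split=> z; rewrite /ysection /= inE.
      move=> [x [u [ub]]]; rewrite /pt /= => xi [zE yE].
      have uE : u = y - p.2 by lra.
      by move: xi; rewrite uE !in_itv /=; case: s mA => mA /= /andP[? ?]; lra.
    move=> zi; exists (z - p.1), (y - p.2); split; first lra.
      by move: zi; rewrite !in_itv /=; case: s mA => mA /= /andP[? ?]; lra.
    by rewrite /pt /=; congr pair; ring.
  + move=> y nyab; rewrite -subset0 => z; rewrite /ysection /= inE.
    move=> [x [u [ub]]]; rewrite /pt /= => _ [_ yE].
    by move/negP: nyab; apply; lra.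
- rewrite (@area_yslices _ (p.2 - b) (p.2 - a) (h0 - l0 + (h1 - l1) * p.2) (- (h1 - l1)))//.
  + by congr (_%:E); field.
  + by lra.
  + move=> y yab; rewrite (_ : ysection _ _ = [set` Interval
      (BSide (~~ s) (p.1 - (h0 + h1 * (p.2 - y)))) (BRight (p.1 - (l0 + l1 * (p.2 - y))))]).
      by rewrite mu_itv; [congr (_%:E); ring|have := lh (p.2 - y); lra].
    rewrite eqEsubset; split=> z; rewrite /ysection /= inE.
      move=> [x [u [ub]]]; rewrite /pt /= => xi [zE yE].
      have uE : u = p.2 - y by lra.
      by move: xi; rewrite uE !in_itv /=; case: s mA => mA /= /andP[? ?]; lra.
    move=> zi; exists (p.1 - z), (p.2 - y); split; first lra.
      by move: zi; rewrite !in_itv /=; case: s mA => mA /= /andP[? ?]; lra.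
    by rewrite /pt /=; congr pair; ring.
  + move=> y nyab; rewrite -subset0 => z; rewrite /ysection /= inE.
    move=> [x [u [ub]]]; rewrite /pt /= => _ [_ yE].
    by move/negP: nyab; apply; lra.
- rewrite (@area_xslices _ (p.1 - b) (p.1 - a) (h0 - l0 + (h1 - l1) * p.1) (- (h1 - l1)))//.
  + by congr (_%:E); field.
  + by lra.
  + move=> y yab; rewrite (_ : xsection _ _ = [set` Interval
      (BLeft (p.2 + (l0 + l1 * (p.1 - y)))) (BSide s (p.2 + (h0 + h1 * (p.1 - y))))]).
      by rewrite mu_itv; [congr (_%:E); ring|have := lh (p.1 - y); lra].
    rewrite eqEsubset; split=> z; rewrite /xsection /= inE.
      move=> [x [u [ub]]]; rewrite /pt /= => xi [zE yE].
      have uE : u = p.1 - y by lra.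
      by move: xi; rewrite uE !in_itv /=; case: s mA => mA /= /andP[? ?]; lra.
    move=> zi; exists (z - p.2), (p.1 - y); split; first lra.
      by move: zi; rewrite !in_itv /=; case: s mA => mA /= /andP[? ?]; lra.
    by rewrite /pt /=; congr pair; ring.
  + move=> y nyab; rewrite -subset0 => z; rewrite /xsection /= inE.
    move=> [x [u [ub]]]; rewrite /pt /= => _ [yE _].
    by move/negP: nyab; apply; lra.
- rewrite (@area_xslices _ (p.1 + a) (p.1 + b) (h0 - l0 - (h1 - l1) * p.1) (h1 - l1))//.
  + by congr (_%:E); field.
  + by lra.
  + move=> y yab; rewrite (_ : xsection _ _ = [set` Interval
      (BSide (~~ s) (p.2 - (h0 + h1 * (y - p.1)))) (BRight (p.2 - (l0 + l1 * (y - p.1))))]).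
      by rewrite mu_itv; [congr (_%:E); ring|have := lh (y - p.1); lra].
    rewrite eqEsubset; split=> z; rewrite /xsection /= inE.
      move=> [x [u [ub]]]; rewrite /pt /= => xi [zE yE].
      have uE : u = y - p.1 by lra.
      by move: xi; rewrite uE !in_itv /=; case: s mA => mA /= /andP[? ?]; lra.
    move=> zi; exists (p.2 - z), (y - p.1); split; first lra.
      by move: zi; rewrite !in_itv /=; case: s mA => mA /= /andP[? ?]; lra.
    by rewrite /pt /=; congr pair; ring.
  + move=> y nyab; rewrite -subset0 => z; rewrite /xsection /= inE.
    move=> [x [u [ub]]]; rewrite /pt /= => _ [yE _].
    by move/negP: nyab; apply; lra.
Qed.

End Area.

Section StripArea.
Variable R : realType.
Local Notation plane := (measurableTypeR R * measurableTypeR R)%type.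
Implicit Types (A B : set plane) (c : chain R) (w t x u : R) (k n : nat).
Local Notation area := (@area R).

Lemma area_le A B : measurable A -> measurable B -> A `<=` B ->
  (area A <= area B)%E.
Proof. by move=> mA mB AB; apply: le_measure; rewrite ?inE. Qed.

Lemma areaU_le A B : measurable A -> measurable B ->
  (area (A `|` B) <= area A + area B)%E.
Proof. by move=> mA mB; exact: measureU2. Qed.

Lemma areaU A B : measurable A -> measurable B -> A `&` B = set0 ->
  area (A `|` B) = (area A + area B)%E.
Proof. by move=> mA mB AB; exact: measureU. Qed.

Lemma area_bigcup_le (F : nat -> set plane) (f : nat -> R) n :
  (forall k, (k < n)%N -> measurable (F k)) ->
  (forall k, (k < n)%N -> (area (F k) <= (f k)%:E)%E) ->
  measurable (\bigcup_(k in `I_n) F k) /\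
  (area (\bigcup_(k in `I_n) F k) <= (\sum_(k < n) f k)%:E)%E.
Proof.
rewrite bigcup_mkord; elim: n => [|n IH] mF aF.
  by rewrite !big_ord0 measure0; split.
have [|k kn|mU aU] := IH; rewrite ?big_ord_recr /=.
- by move=> k kn; apply: mF; exact: leqW.
- by apply: aF; exact: leqW.
split; first by apply: measurableU => //; exact: mF.
rewrite EFinD; apply: (le_trans (areaU_le mU (mF _ _))) => //.
by apply: leeD => //; exact: aF.
Qed.

Lemma area_bigcup_ge (F : nat -> set plane) (f : nat -> R) n :
  (forall k, (k < n)%N -> measurable (F k)) ->
  (forall k, (k < n)%N -> area (F k) = (f k)%:E) ->
  (forall k l, (k < l < n)%N -> F k `&` F l = set0) ->
  area (\bigcup_(k in `I_n) F k) = (\sum_(k < n) f k)%:E.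
Proof.
rewrite bigcup_mkord; elim: n => [|n IH] mF aF dF.
  by rewrite !big_ord0 measure0.
rewrite !big_ord_recr /= areaU; last 3 first.
- by apply: bigsetU_measurable => k _; apply: mF; exact: leqW.
- exact: mF.
- rewrite -bigcup_mkord -subset0 => z [[k /= kn Fk] Fn].
  by rewrite -[False]/(set0 z) -(dF k n) ?kn ?ltnSn.
rewrite aF// IH//; first by move=> k kn; apply: mF; exact: leqW.
  by move=> k kn; apply: aF; exact: leqW.
by move=> k l /andP[kl ln]; apply: dF; rewrite kl leqW.
Qed.

Definition tlen c : R := \sum_(k < psize c) plen c k.

Lemma quad_gtrap c k a b : quad c k a b =
  gtrap false (vert c k) (pdir c k) a b 0 (turn c k) (plen c k) (- turn c k.+1).
Proof. exact: trap_gtrap. Qed.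

Lemma area_quad (s : bool) c k w a b : polyline c -> thick c w -> (k < psize c)%N ->
  - (w / 2) <= a -> a <= b -> b <= w / 2 ->
  area (gtrap s (vert c k) (pdir c k) a b 0 (turn c k) (plen c k) (- turn c k.+1)) =
  ((b - a) * plen c k - (turn c k + turn c k.+1) * (b ^+ 2 - a ^+ 2) / 2)%:E.
Proof.
move=> pcc th km wa ab bw; rewrite area_gtrap//.
- by congr (_%:E); field.
- by case: pcc => _ ax _ _ _; exact: ax.
- move=> u /andP[u1 u2]; have := th k u km; rewrite /lo /hi.
  have uw : - (w / 2) <= u <= w / 2 by lra.
  by move=> /(_ uw); lra.
Qed.

Lemma measurable_quad c k a b : polyline c -> (k < psize c)%N ->
  measurable (quad c k a b : set plane).
Proof.
by move=> [_ ax _ _ _] km; rewrite quad_gtrap; apply: measurable_gtrap; exact: ax.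
Qed.

Lemma measurable_ribbon c w : polyline c -> measurable (ribbon c w : set plane).
Proof.
move=> pcc; rewrite ribbonE; apply: fin_bigcup_measurable => // k km.
exact: measurable_quad.
Qed.

(** The slanted ends cancel over a symmetric range of offsets, so each quadrilateral has area w
    times its length. Subadditivity gives one inequality; for the other, quadrilaterals without
    their upper ends are disjoint by [embedded]. *)
Lemma area_ribbon c w : good c w -> 0 <= w -> area (ribbon c w) = (w * tlen c)%:E.
Proof.
move=> [pcc th em] w0; have ww : - (w / 2) <= w / 2 by lra.
have wE k : (w / 2 - - (w / 2)) * plen c k - (turn c k + turn c k.+1) *
    ((w / 2) ^+ 2 - (- (w / 2)) ^+ 2) / 2 = w * plen c k by field.
apply/eqP; rewrite eq_le; apply/andP; split.
  rewrite ribbonE /tlen mulr_sumr.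
  apply: (area_bigcup_le (f := fun k => w * plen c k) _ _).2 => k km.
    exact: measurable_quad.
  by rewrite quad_gtrap (area_quad _ pcc th)// wE.
pose F k := gtrap true (vert c k) (pdir c k) (- (w / 2)) (w / 2) 0 (turn c k)
  (plen c k) (- turn c k.+1).
have mF k : (k < psize c)%N -> measurable (F k).
  by move=> km; apply: measurable_gtrap; case: pcc => _ ax _ _ _; exact: ax.
have <- : area (\bigcup_(k in `I_(psize c)) F k) = (w * tlen c)%:E.
  rewrite (@area_bigcup_ge F (fun k => w * plen c k)) ?mulr_sumr//.
    by move=> k km; rewrite (area_quad _ pcc th)// wE.
  move=> k l /andP[kl lm]; rewrite -subset0 => z.
  move=> [[x [u [uw xx zE]]] [y [v [vw yy]]]]; rewrite zE => E.
  move: xx yy; rewrite !in_itv /= !add0r !mulNr => /andP[x1 x2] /andP[y1 y2].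
  have [||_] := em _ _ _ _ _ _ _ _ E.
  - by split; [exact: ltn_trans lm|done|rewrite /lo /hi x1 ltW].
  - by split; [done|done|rewrite /lo /hi y1 ltW].
  case=> [[E1 _]|[_ E1 _]|[E1 _ _]]; first by rewrite E1 ltnn in kl.
    by rewrite /hi in E1; lra.
  by move: kl; rewrite E1 ltnNge leqnSn.
apply: area_le; [|exact: measurable_ribbon|].
  by apply: fin_bigcup_measurable => // k; exact: mF.
move=> z [k /= km [x [u [uw xx ->]]]]; exists k, x, u; split=> //; split=> //.
by move: xx; rewrite in_itv /= !add0r mulNr => /andP[x1 x2]; rewrite /lo /hi x1 ltW.
Qed.

(** The length is the area divided by the width, hence independent of the polyline chosen to
    describe an island. *)
Lemma tlen_uniq c c' w : good c w -> good c' w -> 0 < w ->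
  ribbon c w = ribbon c' w -> tlen c = tlen c'.
Proof.
move=> g g' w0 E; have := area_ribbon g (ltW w0); rewrite E area_ribbon ?(ltW w0)//.
by move=> /eqP; rewrite eqe => /eqP /(mulfI (lt0r_neq0 w0)).
Qed.

Lemma tlen_ge0 c : polyline c -> 0 <= tlen c.
Proof. by move=> [_ _ L0 _ _]; apply: sumr_ge0 => k _; apply: ltW; exact: L0. Qed.

Lemma middle_sub c b w t : polyline c -> 0 < t ->
  middle c b w t `<=` \bigcup_(k in `I_(psize c)) quad c k (- (w / 2)) (w / 2).
Proof.
move=> pcc t0 z [k [x [u [km uw /andP[x1 x2] ->]]]]; exists k => //.
apply/quadP; exists x, u; split=> //; apply/andP; split.
  move: x1; rewrite /clo; case: ifP => // /andP[_ /eqP ->].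
  by rewrite /lo turn0 mul0r; lra.
move: x2; rewrite /chi; case: eqP => // E.
by rewrite /hi E turnm mul0r; lra.
Qed.

Lemma measurable_middle c b w t : polyline c -> measurable (middle c b w t : set plane).
Proof.
move=> pcc; rewrite middleE; apply: fin_bigcup_measurable => // k km.
by rewrite trap_gtrap; apply: measurable_gtrap; case: pcc => _ ax _ _ _; exact: ax.
Qed.

Lemma area_middle_le c b w t : good c (w + 2 * t) -> 0 <= w -> 0 < t ->
  (area (middle c b w t) <= (w * tlen c)%:E)%E.
Proof.
move=> [pcc th _] w0 t0.
have th' : thick c w.
  move=> k u km /andP[u1 u2]; apply: th => //; lra.
have [||mU aU] := @area_bigcup_le (fun k => quad c k (- (w / 2)) (w / 2))
  (fun k => w * plen c k) (psize c) _ _.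
- by move=> *; exact: measurable_quad.
- move=> k km; rewrite quad_gtrap (area_quad _ pcc th')//; last by lra.
  by rewrite lee_fin; lra.
rewrite /tlen mulr_sumr; apply: le_trans aU; apply: area_le => //.
  exact: measurable_middle.
exact: middle_sub.
Qed.

(* What is left of the strip c of width w + 2 t when its middle is removed. *)
Definition land c (b : bool) w t : set (R * R) :=
  \bigcup_(k in `I_(psize c)) (quad c k (- (w / 2 + t)) (- (w / 2)) `|`
    quad c k (w / 2) (w / 2 + t)) `|`
  (rect c (psize c).-1 (- (w / 2)) (w / 2) (plen c (psize c).-1 - t)
     (plen c (psize c).-1) `|`
   (if b then rect c 0 (- (w / 2)) (w / 2) 0 t else set0)).

Lemma land_cover c b w t : polyline c -> 0 < t ->
  ribbon c (w + 2 * t) `\` middle c b w t `<=` land c b w t.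
Proof.
move=> pcc t0 z [[k [x [u [[km /andP[u1 u2] /andP[x1 x2]] ->]]]] nm].
have [uw|uw] := leP (w / 2) u.
  left; exists k => //; right; apply/quadP; exists x, u; split=> //.
    by lra.
  exact/andP.
have [uw'|uw'] := leP u (- (w / 2)).
  left; exists k => //; left; apply/quadP; exists x, u; split=> //.
    by lra.
  exact/andP.
right; have [xt|xt] := leP (clo c b t k u) x; last first.
  right; move: xt; rewrite /clo; case: ifP => [/andP[-> /eqP k0] xt|_]; last by lra.
  subst k; exists x, u; rewrite /lo turn0 mul0r in x1; split=> //.
    by lra.
  by rewrite !mul0r !addr0; lra.
have [xh|xh] := leP x (chi c t k u).
  by exfalso; apply: nm; exists k, x, u; split=> //; lra.
left; move: xh; rewrite /chi; case: eqP => [E xh|_]; last by lra.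
have kE : (psize c).-1 = k by rewrite -E.
rewrite kE; exists x, u; split=> //.
  by lra.
rewrite /hi E turnm in x2.
by rewrite !mul0r !addr0; lra.
Qed.

Lemma closed_land c b w t : polyline c -> closed (land c b w t).
Proof.
move=> [m0 ax _ _ _]; apply: closedU; last first.
  apply: closedU; first by apply: closed_trap; apply: ax => //; rewrite prednK.
  by case: b; [apply: closed_trap; exact: ax|exact: closed0].
by apply: closed_bigcup => // k km; apply: closedU; apply: closed_trap; exact: ax.
Qed.

Lemma area_rect c k a b l h : polyline c -> (k < psize c)%N -> a <= b -> l <= h ->
  measurable (rect c k a b l h : set plane) /\
  area (rect c k a b l h) = ((b - a) * (h - l))%:E.
Proof.
move=> [_ ax _ _ _] km ab lh; rewrite /rect trap_gtrap.
split; first by apply: measurable_gtrap; exact: ax.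
rewrite area_gtrap//; [|exact: ax|by move=> u _; lra].
by congr (_%:E); field.
Qed.

Lemma area_land_le c b w t : good c (w + 2 * t) -> 0 <= w -> 0 < t ->
  measurable (land c b w t : set plane) /\
  (area (land c b w t) <= (2 * t * tlen c + 2 * t * w)%:E)%E.
Proof.
move=> [pcc th _] w0 t0; have [m0 _ _ _ _] := pcc.
have m1 : ((psize c).-1 < psize c)%N by rewrite prednK.
have ww : - (w / 2) <= w / 2 by lra.
have [||mU aU] := @area_bigcup_le (fun k => quad c k (- (w / 2 + t)) (- (w / 2)) `|`
    quad c k (w / 2) (w / 2 + t)) (fun k => 2 * t * plen c k) (psize c) _ _.
- by move=> k km; apply: measurableU; exact: measurable_quad.
- move=> k km; apply: (le_trans (areaU_le _ _)); [exact: measurable_quad|exact: measurable_quad|].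
  rewrite !quad_gtrap.
  have -> := @area_quad false _ _ _ (- (w / 2 + t)) (- (w / 2)) pcc th km
    ltac:(lra) ltac:(lra) ltac:(lra).
  have -> := @area_quad false _ _ _ (w / 2) (w / 2 + t) pcc th km
    ltac:(lra) ltac:(lra) ltac:(lra).
  by rewrite -EFinD lee_fin; lra.
have [mL aL] := @area_rect c _ (- (w / 2)) (w / 2) (plen c (psize c).-1 - t)
   (plen c (psize c).-1) pcc m1 ww ltac:(lra).
have [mF aF] := @area_rect c _ (- (w / 2)) (w / 2) 0 t pcc m0 ww (ltW t0).
set F := if b then rect c 0 (- (w / 2)) (w / 2) 0 t else set0.
have {mF aF}[mF aF] : measurable (F : set plane) /\ (area F <= (w * t)%:E)%E.
  rewrite /F; case: (b); split=> //; first by rewrite aF lee_fin; lra.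
  by rewrite measure0 lee_fin mulr_ge0 // ltW.
split; first by apply: measurableU => //; exact: measurableU.
rewrite EFinD; apply: (le_trans (areaU_le mU _)); first exact: measurableU.
apply: leeD; first by rewrite /tlen mulr_sumr.
apply: (le_trans (areaU_le mL mF)).
apply: (@le_trans _ _ ((w / 2 - - (w / 2)) *
  (plen c (psize c).-1 - (plen c (psize c).-1 - t)) + w * t)%:E).
  by rewrite EFinD; apply: leeD => //; rewrite aL.
by rewrite lee_fin; lra.
Qed.

End StripArea.

(** * Lengths of the islands, for arbitrary canals *)

Section Days.
Variables (R : realType) (a : nat -> R) (C P : nat -> set (R * R)).
Hypothesis a2 : forall k, (1 <= k)%N -> 2 < a k.
(** Equivalently t_n^2 <= t_(n+1), which makes the area of a bar at most t_(n+1) / 2. *)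
Hypothesis a_slow : forall n, (3 <= n)%N -> a n.+1 * land_width a n <= 1.
Hypothesis wada : wada_canals a C P.

Local Notation t := (land_width a).
Local Notation w := (canal_width a).
Local Notation I := (island C).

(** Only the two side lengths of the bar and one of its points in the island matter from here on:
    the former for areas and edges, the latter for [canal_near_island]. *)
Definition bar_spec n (c : chain R) (B : set (R * R)) : Prop :=
  B = set0 \/ (3 <= n)%N /\ exists i r y, [/\ (i < psize c)%N,
    B = rect c i r (r + t n / 2) y (y + w n.+1) &
    exists2 p, B p & I n p].

Lemma strip_of_day n : exists c, [/\ good c (t n), I n = ribbon c (t n) &
  exists b B, [/\ bar_spec n c B, C n.+1 = B `|` strip (psize c) (midline c b (t n.+1)) (w n.+1) &
    n = 0%N -> c = square_chain R /\ b = false]].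
Proof.
have [[C1 _] sc bc] := wada.
have [->|n0] := posnP n.
  have t1 := land_width_half 0 a2; rewrite land_width0 in t1.
  have t0 := land_width_gt0 1 a2; have w0 := canal_width_gt0 0 a2.
  exists (square_chain R); rewrite land_width0; split.
  - exact: good_square_chain.
  - by rewrite island0 ribbon_square_chain.
  - exists false, set0; split=> //; first by left.
    have wE : 1 = w 1 + 2 * t 1 by rewrite canal_widthS land_width0; ring.
    have gs : good (square_chain R) (w 1 + 2 * t 1).
      by rewrite -wE; exact: good_square_chain.
    have rs : roomy (square_chain R) (t 1) by [].
    have t1E : t 1 = (a 1%N)^-1 by rewrite land_widthS land_width0 mul1r.
    rewrite set0U (strip_mid false gs w0 t0 rs) C1 -t1E.
    rewrite eqEsubset; split=> -[z1 z2] /=.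
      move=> [/andP[h1 h2] /andP[h3 h4]].
      exists 0%N, z1, (z2 - 1 / 2); rewrite /clo /chi /= /lo /turn /= mul0r; split=> //.
      + by lra.
      + by lra.
      + by rewrite /cpt /pt /=; congr pair; ring.
    move=> [[|k] [x [u [//= _ /andP[u1 u2]]]]].
    rewrite /clo /chi /= /lo /turn /= mul0r => /andP[x1 x2] [-> ->].
    by split; lra.
have [n3|n3] := ltnP n 3.
  have [|m [v [st _ _ CE _]]] := sc n.+1; first by rewrite !ltnS n0.
  have [gc IE] := is_strip_good st; exists (path_of m v); split=> //.
  exists false, set0; split; [by left|by rewrite set0U CE|].
  by move=> nE; rewrite nE in n0.
have [|m [v [i [s [u [st [im s01 uE] _ CE _]]]]]] := bc n.+1; first by [].
have [gc IE] := is_strip_good st; have [pcc th _] := gc.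
have tn0 := land_width_gt0 n a2; have w0 := canal_width_gt0 n a2.
rewrite /= in uE.
pose c := path_of m v; exists c; split=> //.
have pE := parallel_ptE s u pcc im.
set x := (1 - s) * lo c i u + s * hi c i u in pE.
have qE : move (cpt c i x u) (- u) (normal (v i) (v i.+1)) = cpt c i x 0.
  by rewrite -[v]/(vert c) normal_vert// /move /cpt /pt /perp /=; congr pair; ring.
have u0 : u != 0 by rewrite -normr_gt0 uE; lra.
have uw : - (t n / 2) <= u <= t n / 2 by rewrite -ler_norml uE.
have us : u = t n / 2 \/ u = - (t n / 2).
  by move: uE; case: (ger0P u) => _ <-; [left|right; rewrite opprK].
exists true, (bar (cpt c i x u) (cpt c i x 0) (w n.+1)); split.
- right; split=> //; exists i, (if 0 < u then 0 else - (t n / 2)), (x - w n.+1 / 2).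
  split=> //.
    rewrite bar_rect// eqEsubset; split=> z.
      move=> [y [l [/andP[y1 y2] /andP[l0 l1] ->]]]; exists y, (l * u); split=> //.
        by case: us => ->; case: ltP => ?; apply/andP; split; nra.
      by rewrite !mul0r !addr0; lra.
    move=> [y [r [r01]]]; rewrite !mul0r !addr0 => /andP[y1 y2] ->.
    exists y, (r / u); split; first by lra.
      move: r01; case: us => ->; case: ltP => ? /andP[r0 r1]; try lra.
        by apply/andP; split; [apply: divr_ge0; lra|rewrite ler_pdivrMr; lra].
      rewrite invrN mulrN -mulNr.
      by apply/andP; split; [apply: divr_ge0; lra|rewrite ler_pdivrMr; lra].
    by rewrite divfK.
  exists (cpt c i x u).
    rewrite bar_rect//; exists x, 1; rewrite mul1r.
    by split=> //; lra.
  rewrite IE; exists i, x, u; split=> //; split=> //.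
  have := th i u im uw; rewrite /x; move: (lo _ _ _) (hi _ _ _) => l h lh.
  by case/andP: s01 => *; apply/andP; split; nra.
- by rewrite CE -pE -qE -pE.
- by move=> nE; rewrite nE in n0.
Qed.

Lemma land_width_le1 n : t n <= 1.
Proof.
elim: n => [|n IH]; first by rewrite land_width0.
by have := land_width_half n a2; have := land_width_gt0 n.+1 a2; lra.
Qed.

Lemma canal_width_le n : w n.+1 <= t n.
Proof. by rewrite canal_widthS; have := land_width_gt0 n.+1 a2; lra. Qed.

Lemma canal_widthE n : t n = w n.+1 + 2 * t n.+1.
Proof. by rewrite canal_widthS; ring. Qed.

Lemma barP n c B : polyline c -> bar_spec n c B ->
  [/\ closed B, measurable (B : set (measurableTypeR R * measurableTypeR R)) &
      (area B <= (t n.+1 / 2)%:E)%E].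
Proof.
move=> pcc; have tn0 := land_width_gt0 n a2; have t0 := land_width_gt0 n.+1 a2.
have w0 := canal_width_gt0 n a2; have wt := canal_width_le n.
move=> [->|[n3 [i [r [y [im -> _]]]]]].
  by split; [exact: closed0|exact: measurable0|rewrite measure0 lee_fin; lra].
have [||mB aB] := @area_rect R c i r (r + t n / 2) y (y + w n.+1) pcc im; [lra|lra|].
split=> //; first by apply: closed_trap; case: pcc => _ ax _ _ _; exact: ax.
rewrite aB lee_fin; have := a_slow n3.
have a0 := a2 (isT : (1 <= n.+1)%N).
have tE : t n = a n.+1 * t n.+1.
  by rewrite land_widthS mulrCA divff ?mulr1// gt_eqF//; lra.
have H : t n * t n = (a n.+1 * t n) * t n.+1 by rewrite {2}tE; ring.
move=> H1; have : t n * t n <= t n.+1 by rewrite H; apply: ler_piMl => //; lra.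
have : w n.+1 * t n <= t n * t n by apply: ler_wpM2r => //; lra.
lra.
Qed.

(** A single segment would have length [tlen c], at least 1, whereas 2 t_(n+1) < t_n <= 1. *)
Lemma roomy_tlen n c : 2 ^+ n / 2 + 1 / 2 <= tlen c -> polyline c ->
  (n = 0%N -> c = square_chain R) -> roomy c (t n.+1).
Proof.
move=> L pcc sq E; have := land_width_half n a2; have := land_width_le1 n.
have [n0|n0] := posnP n; first by rewrite (sq n0) n0 land_width0 /=.
have : plen c 0 = tlen c by rewrite /tlen E big_ord1.
have : 1 <= 2 ^+ n :> R by apply: exprn_ege1; lra.
lra.
Qed.

(** For consecutive lengths T and T', areas give 2 T - 1/2 <= T' <= 2 T + 2. The new island lies in
    [land], which yields the upper estimate. The old island is covered by the new one, the middle
    and the bar, which yields the lower one. The additive constants 1/2 and - 2 in the statement are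
    those preserved by this recursion. *)
Lemma tlen_bounds n c : good c (t n) -> I n = ribbon c (t n) ->
  2 ^+ n / 2 + 1 / 2 <= tlen c <= 3 * 2 ^+ n - 2.
Proof.
have tp k := land_width_gt0 k a2.
elim: n c => [|n IH] c gc IE.
  have -> : tlen c = 1.
    rewrite (@tlen_uniq _ c (square_chain R) 1)//.
    - by rewrite /tlen big_ord1.
    - by rewrite land_width0 in gc.
    - exact: good_square_chain.
    - by rewrite ribbon_square_chain -(island0 C) IE land_width0.
  by rewrite expr0; lra.
have [c0 [g0 I0 [b [B [bs CE sq]]]]] := strip_of_day n.
have /andP[l1 l2] := IH c0 g0 I0.
have [pc0 _ _] := g0; have w0 := canal_width_gt0 n a2; have t0 := tp n.+1.
have rm : roomy c0 (t n.+1) by apply: roomy_tlen => // /sq[].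
have g0' : good c0 (w n.+1 + 2 * t n.+1) by rewrite -canal_widthE.
rewrite strip_mid// in CE; have [cB mB aB] := barP pc0 bs.
have cC : closed (C n.+1) by rewrite CE; apply: closedU => //; exact: closed_middle.
have mM := measurable_middle b (w n.+1) (t n.+1) pc0.
have aM := area_middle_le b g0' (ltW w0) t0.
have [mL aL] := area_land_le b g0' (ltW w0) t0.
have [pcc _ _] := gc.
have aI := area_ribbon gc (ltW t0).
have aI0 := area_ribbon g0 (ltW (tp n)).
have mI : measurable (I n.+1 : set (measurableTypeR R * measurableTypeR R)).
  by rewrite IE; exact: measurable_ribbon.
have s1 : I n.+1 `<=` land c0 b (w n.+1) (t n.+1).
  have s0 : I n `\` C n.+1 `<=` land c0 b (w n.+1) (t n.+1).
    move=> z [zI nC]; apply: (@land_cover _ c0 b _ _ pc0 t0); split.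
      by rewrite -canal_widthE -I0.
    by move=> zM; apply: nC; rewrite CE; right.
  have /closure_id -> := @closed_land _ c0 b (w n.+1) (t n.+1) pc0.
  by rewrite islandS//; exact: closureS.
have s2 : I n `<=` I n.+1 `|` (B `|` middle c0 b (w n.+1) (t n.+1)).
  move=> z zI; have [zC|nC] := EM (C n.+1 z); first by right; rewrite -CE.
  by left; rewrite islandS//; exact: subset_closure.
have := le_trans (area_le mI mL s1) aL; rewrite IE aI lee_fin => up.
have : (area (I n) <= (t n.+1 * tlen c + (t n.+1 / 2 + w n.+1 * tlen c0))%:E)%E.
  apply: (le_trans (area_le _ _ s2)).
  - by rewrite I0; exact: measurable_ribbon.
  - by apply: measurableU => //; exact: measurableU.
  apply: (le_trans (areaU_le mI _)); first exact: measurableU.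
  rewrite EFinD; apply: leeD; first by rewrite IE aI.
  apply: (le_trans (areaU_le mB mM)).
  by rewrite EFinD; apply: leeD.
rewrite I0 aI0 lee_fin {1}canal_widthE => dn.
rewrite exprS; have w1 := canal_width_le n; have t1 := land_width_le1 n.
have {}up : tlen c <= 2 * tlen c0 + 2 * w n.+1.
  by rewrite -(ler_pM2l t0); apply: le_trans up _; lra.
have {}dn : 2 * tlen c0 - 1 / 2 <= tlen c.
  by rewrite -(ler_pM2l t0); lra.
by lra.
Qed.

Lemma island_strip n : exists c b B, [/\ good c (t n), I n = ribbon c (t n),
  bar_spec n c B /\ closed B, C n.+1 = B `|` middle c b (w n.+1) (t n.+1) &
  roomy c (t n.+1) /\ 2 ^+ n / 2 + 1 / 2 <= tlen c <= 3 * 2 ^+ n - 2].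
Proof.
have [c [gc IE [b [B [bs CE sq]]]]] := strip_of_day n.
have tb := tlen_bounds gc IE; have /andP[l1 _] := tb.
have [pcc _ _] := gc.
have rm : roomy c (t n.+1) by apply: roomy_tlen => // /sq[].
have [cB _ _] := barP pcc bs.
exists c, b, B; split=> //; rewrite CE strip_mid//.
- by rewrite -canal_widthE.
- exact: canal_width_gt0.
- exact: land_width_gt0.
Qed.

Lemma closed_canal n : closed (C n.+1).
Proof.
have [c [b [B [[pcc _ _] _ [_ cB] -> _]]]] := island_strip n.
by apply: closedU => //; exact: closed_middle.
Qed.

End Days.

(** * Covers *)

Section Covers.
Variable R : realType.
Implicit Types (S : set (R * R)) (e X r l : R) (c : chain R) (k n : nat).

(** The bound X is real, so that counts can be added and estimated without rounding. *)
Definition covers S e X : Prop :=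
  exists k : nat, k%:R <= X /\ covered_by_squares S e k.

Lemma covers_sub S S' e X : S `<=` S' -> covers S' e X -> covers S e X.
Proof.
move=> SS [k [kX [f Hf]]]; exists k; split=> //; exists f.
exact: subset_trans SS Hf.
Qed.

Lemma covers_le S e e' X X' : e <= e' -> X <= X' -> covers S e X -> covers S e' X'.
Proof.
move=> ee XX [k [kX [f Hf]]]; exists k; split; first exact: le_trans XX.
exists f => z /Hf[i _ [/andP[? ?] /andP[? ?]]]; exists i => //.
by split; lra.
Qed.

Lemma covers_setU S S' e X X' : covers S e X -> covers S' e X' ->
  covers (S `|` S') e (X + X').
Proof.
move=> [k [kX [f Hf]]] [k' [kX' [f' Hf']]]; exists (k + k')%N; split.
  by rewrite natrD; exact: lerD.
exists (fun i => match fintype.split i with inl j => f j | inr j => f' j end).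
move=> z [/Hf[i _ zi]|/Hf'[i _ zi]].
  exists (lshift k' i) => //; case: fintype.splitP => j; rewrite /= => E.
    by rewrite (_ : j = i)//; exact: val_inj.
  by have := ltn_ord i; rewrite E ltnNge leq_addr.
exists (rshift k i) => //; case: fintype.splitP => j; rewrite /= => E.
  by have := ltn_ord j; rewrite -E ltnNge leq_addr.
by rewrite (_ : j = i)//; apply: val_inj; exact/esym/(addnI E).
Qed.

Lemma covers_set0 e : covers set0 e 0.
Proof. by exists 0%N; split=> //; exists (fun=> (0, 0)). Qed.

Lemma covers_bigcup (F : nat -> set (R * R)) (f : nat -> R) e n :
  (forall k, (k < n)%N -> covers (F k) e (f k)) ->
  covers (\bigcup_(k in `I_n) F k) e (\sum_(k < n) f k).
Proof.
rewrite bigcup_mkord; elim: n => [|n IH] H.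
  by rewrite !big_ord0; exact: covers_set0.
rewrite !big_ord_recr /=; apply: covers_setU; last exact: H.
by apply: IH => k kn; apply: H; exact: leqW.
Qed.

Definition near_set r S : set (R * R) :=
  [set z | exists2 z', S z' & `|z.1 - z'.1| <= r /\ `|z.2 - z'.2| <= r].

Lemma covers_near S e X r : 0 <= r -> covers S e X -> covers (near_set r S) (e + 2 * r) X.
Proof.
move=> r0 [k [kX [f Hf]]]; exists k; split=> //.
exists (fun i => ((f i).1 - r, (f i).2 - r)) => z [z' /Hf[i _ [h1 h2]]].
rewrite !ler_norml => -[h3 h4]; exists i => //; split=> /=.
  by move: h1 h3 => /andP[? ?] /andP[? ?]; lra.
by move: h2 h4 => /andP[? ?] /andP[? ?]; lra.
Qed.

(* s z is the arc length at z on a curve of length l. *)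
Definition curve S l : Prop := exists s : R * R -> R, forall z, S z ->
  0 <= s z <= l /\ forall z', S z' ->
    `|z.1 - z'.1| <= `|s z - s z'| /\ `|z.2 - z'.2| <= `|s z - s z'|.

(** Cut the curve into arcs of length e; an arc lies in the square of side 2 e centred at any of its
    points. Empty arcs get the default point of [xget], which does no harm. *)
Lemma covers_curve S l e : 0 < e -> 0 <= l -> curve S l ->
  covers S (2 * e) (l / e + 1).
Proof.
move=> e0 l0 [s Hs]; pose n := (Num.truncn (l / e)).+1.
have le0 : 0 <= l / e by apply: divr_ge0 => //; exact: ltW.
pose good_ (i : 'I_n) z := S z /\ i%:R * e <= s z <= (i%:R + 1) * e.
pose pick_ i := xget (0, 0) (good_ i).
exists n; split.
  by rewrite /n -natr1 lerD2r truncn_le.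
exists (fun i => ((pick_ i).1 - e, (pick_ i).2 - e)) => z Sz.
have [/andP[s0 sl] H] := Hs z Sz.
have se0 : 0 <= s z / e by apply: divr_ge0 => //; exact: ltW.
have /andP[t1 t2] := truncn_itv se0.
have tn : (Num.truncn (s z / e) < n)%N.
  by rewrite /n ltnS; apply: le_truncn; rewrite ler_pM2r// invr_gt0.
pose i := Ordinal tn; exists i => //.
have gz : good_ i z.
  split=> //=; apply/andP; split; first by rewrite -ler_pdivlMr.
  by rewrite -ler_pdivrMr// natr1 ltW.
have [Sp /andP[p1 p2]] : good_ i (pick_ i) by apply: (@xgetPex _ (0, 0) (good_ i)); exists z.
have [h1 h2] := H _ Sp; have [_ /andP[g1 g2]] := gz.
have D : `|s z - s (pick_ i)| <= e by rewrite ler_norml; lra.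
have := le_trans h1 D; have := le_trans h2 D.
rewrite !ler_norml => /andP[? ?] /andP[? ?].
by split=> /=; lra.
Qed.

Lemma curve_sub S S' l l' : S' `<=` S -> l <= l' -> curve S l -> curve S' l'.
Proof.
move=> SS ll [s H]; exists s => z /SS /H[/andP[? ?] K]; split.
  by lra.
by move=> z' /SS; exact: K.
Qed.

Lemma pt_distx (p d : R * R) x x' u : axis d ->
  `|(pt p d x u).1 - (pt p d x' u).1| <= `|x - x'| /\
  `|(pt p d x u).2 - (pt p d x' u).2| <= `|x - x'|.
Proof.
by move=> ax; have := pt_close p x u x' u ax; rewrite subrr normr0 addr0.
Qed.

Lemma pt_distu (p d : R * R) x u u' : axis d ->
  `|(pt p d x u).1 - (pt p d x u').1| <= `|u - u'| /\
  `|(pt p d x u).2 - (pt p d x u').2| <= `|u - u'|.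
Proof.
by move=> ax; have := pt_close p x u x u' ax; rewrite subrr normr0 add0r.
Qed.

Lemma curve_x (p d : R * R) u (a b : R) : axis d -> a <= b ->
  curve [set z | exists2 x, a <= x <= b & z = pt p d x u] (b - a).
Proof.
move=> ax ab; exists (fun z => coordx p d z - a) => z [x /andP[x1 x2] ->].
split; first by rewrite coordx_pt//; lra.
move=> z' [x' _ ->]; rewrite !coordx_pt//.
have -> : x - a - (x' - a) = x - x' by ring.
exact: pt_distx.
Qed.

Lemma curve_u (p d : R * R) x (a b : R) : axis d -> a <= b ->
  curve [set z | exists2 u, a <= u <= b & z = pt p d x u] (b - a).
Proof.
move=> ax ab; exists (fun z => coordu p d z - a) => z [u /andP[u1 u2] ->].
split; first by rewrite coordu_pt//; lra.
move=> z' [u' _ ->]; rewrite !coordu_pt//.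
have -> : u - a - (u' - a) = u - u' by ring.
exact: pt_distu.
Qed.

Definition sideline c u : set (R * R) :=
  [set z | exists k x, [/\ (k < psize c)%N, lo c k u <= x <= hi c k u & z = cpt c k x u]].

(** On each segment the lines at offsets u and - u have lengths with sum 2 * plen, and both are
    positive; hence the factor 2. The parameter is the sum of the lengths passed so far. *)
Lemma curve_sideline c w u : good c w -> - (w / 2) <= u <= w / 2 ->
  curve (sideline c u) (2 * tlen c).
Proof.
move=> [pcc th _] uw; have [m0 ax L0 nx tn] := pcc.
pose len k := hi c k u - lo c k u.
have len0 k : (k < psize c)%N -> 0 < len k by move=> km; rewrite subr_gt0; exact: th.
have len2 k : (k < psize c)%N -> len k <= 2 * plen c k.
  move=> km; have := th k (- u) km.
  have -> : - (w / 2) <= - u <= w / 2 by move: uw => /andP[? ?]; lra.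
  by move=> /(_ isT); rewrite /len /lo /hi; lra.
pose tot k := \sum_(j < k) len j.
have totS k : tot k.+1 = tot k + len k by rewrite /tot big_ord_recr.
have tot_mono (k l : nat) : (k <= l)%N -> (l <= psize c)%N -> tot k <= tot l.
  elim: l => [|l IH]; first by rewrite leqn0 => /eqP ->.
  rewrite leq_eqVlt => /orP[/eqP -> //|kl lm].
  by rewrite totS; have := IH kl (ltnW lm); have := len0 l lm; lra.
have tot0 k : (k <= psize c)%N -> 0 <= tot k.
  by move=> km; have := tot_mono 0%N k isT km; rewrite {1}/tot big_ord0.
have totm : tot (psize c) <= 2 * tlen c.
  by rewrite /tlen mulr_sumr; apply: ler_sum => j _; exact: len2.
pose param z s := exists k x, [/\ (k < psize c)%N, lo c k u <= x <= hi c k u,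
  z = cpt c k x u & s = tot k + (x - lo c k u)].
pose V k := cpt c k (lo c k u) u.
have dV (k l : nat) : (k <= l)%N -> (l < psize c)%N ->
    `|(V k).1 - (V l).1| <= tot l - tot k /\ `|(V k).2 - (V l).2| <= tot l - tot k.
  elim: l => [|l IH].
    by rewrite leqn0 => /eqP -> _; rewrite !subrr normr0.
  rewrite leq_eqVlt => /orP[/eqP ->|kl lm]; first by rewrite !subrr normr0.
  have [h1 h2] := IH kl (ltnW lm).
  have [] := @pt_distx (vert c l) (pdir c l) (lo c l u) (hi c l u) u (ax _ (ltnW lm)).
  rewrite -/(cpt c l _ _) -/(cpt c l _ _) -/(V l) cpt_joint// -/(V l.+1).
  rewrite [`|lo c l u - _|]distrC (ger0_norm (ltW (len0 l (ltnW lm)))) totS.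
  move: h1 h2; rewrite /len !ler_norml => /andP[? ?] /andP[? ?] /andP[? ?] /andP[? ?].
  by split; lra.
have close z s z' s' : param z s -> param z' s' -> s <= s' ->
    `|z.1 - z'.1| <= `|s - s'| /\ `|z.2 - z'.2| <= `|s - s'|.
  move=> [k [x [km /andP[x1 x2] -> ->]]] [l [y [lm /andP[y1 y2] -> ->]]] ss'.
  have [kl|kl|E] := ltngtP k l; last 1 first.
  - move: ss'; rewrite E !lerD2l => xy.
    have -> : tot l + (x - lo c l u) - (tot l + (y - lo c l u)) = x - y by ring.
    by apply: pt_distx; exact: ax.
  - have [] := @pt_distx (vert c k) (pdir c k) x (hi c k u) u (ax _ km).
    have [] := @pt_distx (vert c l) (pdir c l) (lo c l u) y u (ax _ lm).
    rewrite -!/(cpt _ _ _ _) (cpt_joint _ pcc (leq_ltn_trans kl lm)) -/(V l) -/(V k.+1).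
    have [] := dV k.+1 l kl lm; rewrite totS /len.
    have -> : `|tot k + (x - lo c k u) - (tot l + (y - lo c l u))| =
      tot l + (y - lo c l u) - (tot k + (x - lo c k u)).
      by rewrite distrC ger0_norm// subr_ge0.
    have -> : `|x - hi c k u| = hi c k u - x by rewrite distrC ger0_norm// subr_ge0.
    have -> : `|lo c l u - y| = y - lo c l u by rewrite distrC ger0_norm// subr_ge0.
    move: {ss'}(cpt c k x u) (cpt c l y u) (V k.+1) (V l) => A B V1 V2.
    rewrite !ler_norml => /andP[? ?] /andP[? ?] /andP[? ?] /andP[? ?] /andP[? ?] /andP[? ?].
    by split; lra.
  (* The parameter cannot be smaller on a later segment, so both points lie at the joints and
     coincide. *)
  - have := tot_mono l.+1 k kl (ltnW km); rewrite totS /len => H.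
    have E1 : x = lo c k u by lra.
    have E2 : y = hi c l u by lra.
    have [] := dV l.+1 k kl km; rewrite totS /len /V -(cpt_joint u pcc (leq_ltn_trans kl km)).
    rewrite -E2 -E1; move: (cpt c k x u) (cpt c l y u) => A B.
    rewrite !ler_norml => /andP[? ?] /andP[? ?].
    have -> : tot k + (x - x) - (tot l + (y - lo c l u)) = 0 by lra.
    by rewrite normr0; split; lra.
exists (fun z => xget 0 (param z)) => z Hz.
have par z0 : sideline c u z0 -> param z0 (xget 0 (param z0)).
  move=> [k [x [km xx E]]]; apply: (@xgetPex _ 0 (param z0)).
  by exists (tot k + (x - lo c k u)), k, x.
split.
  have [k [x [km /andP[x1 x2] _ ->]]] := par z Hz.
  have := tot_mono k.+1 _ km (leqnn _); rewrite totS /len => H1.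
  by have := tot0 k (ltnW km); move=> ?; lra.
move=> z' Hz'; have [h|h] := leP (xget 0 (param z)) (xget 0 (param z')).
  exact: close (par _ Hz) (par _ Hz') h.
rewrite distrC [`|z.2 - _|]distrC [`|xget _ _ - _|]distrC.
exact: close (par _ Hz') (par _ Hz) (ltW h).
Qed.

Lemma interior_frame (p d : R * R) x u (A : set (R * R)) : axis d ->
  (exists2 e, 0 < e & forall x' u', `|x - x'| < e -> `|u - u'| < e -> A (pt p d x' u')) ->
  A° (pt p d x u).
Proof.
move=> ax [e e0 H]; apply/nbhs_boxP; exists e => // z h1 h2.
rewrite -(pt_coord p z ax); apply: H.
  rewrite -{1}(coordx_pt p x u ax) /coordx; move: h1 h2.
  by case: ax => -> /=; rewrite !ltr_norml => /andP[? ?] /andP[? ?]; lra.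
rewrite -{1}(coordu_pt p x u ax) /coordu; move: h1 h2.
by case: ax => -> /=; rewrite !ltr_norml => /andP[? ?] /andP[? ?]; lra.
Qed.

Lemma rect_interior (p d : R * R) (a b l h x u : R) : axis d ->
  a < u < b -> l < x < h -> (trap p d a b l 0 h 0)° (pt p d x u).
Proof.
move=> ax /andP[u1 u2] /andP[x1 x2]; apply: interior_frame => //.
exists (Num.min (Num.min (u - a) (b - u)) (Num.min (x - l) (h - x))).
  by rewrite !lt_min !subr_gt0 u1 u2 x1 x2.
move=> x' u'; rewrite !lt_min !ltr_norml.
move=> /andP[/andP[/andP[? ?] /andP[? ?]] /andP[/andP[? ?] /andP[? ?]]].
move=> /andP[/andP[/andP[? ?] /andP[? ?]] /andP[/andP[? ?] /andP[? ?]]].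
exists x', u'; split=> //; first by lra.
by rewrite !mul0r !addr0; lra.
Qed.

End Covers.

(** * Upper bound for the covering number *)

Section UpperBound.
Variables (R : realType) (a : nat -> R) (C P : nat -> set (R * R)).
Hypothesis a2 : forall k, (1 <= k)%N -> 2 < a k.
Hypothesis a_slow : forall n, (3 <= n)%N -> a n.+1 * land_width a n <= 1.
Hypothesis wada : wada_canals a C P.

Local Notation t := (land_width a).
Local Notation w := (canal_width a).
Local Notation I := (island C).

Lemma island_sub n k : (n <= k)%N -> I k `<=` I n.
Proof.
elim: k => [|k IH]; first by rewrite leqn0 => /eqP ->.
rewrite leq_eqVlt => /orP[/eqP -> //|nk]; apply: subset_trans (IH nk).
exact: islandS_sub.
Qed.

Lemma island_not_canal n k z : (1 <= k <= n)%N -> I n z -> ~ (C k)° z.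
Proof.
move=> kn Inz Ckz; have [z' [[_ nC] Cz']] := Inz _ Ckz.
by apply: nC; exists k.
Qed.

Lemma not_island n z : @unit_square R z -> ~ I n z ->
  exists2 k, (1 <= k <= n)%N & C k z.
Proof.
move=> sz nI; apply: contrapT => H; apply: nI; apply: subset_closure.
by split=> // -[k /= kn Cz]; apply: H; exists k.
Qed.

Lemma closed_canals n : closed (\bigcup_(k in [set k | (1 <= k <= n)%N]) C k).
Proof.
apply: closed_bigcup; first by apply: (@sub_finite_set _ _ `I_n.+1) => // k /= /andP[].
by move=> [//|k] _; exact: (closed_canal a2 a_slow wada).
Qed.

Definition bar_edges (p d : R * R) (r r' y y' : R) : set (R * R) :=
  ([set z | exists2 x, y <= x <= y' & z = pt p d x r] `|`
   [set z | exists2 x, y <= x <= y' & z = pt p d x r']) `|`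
  ([set z | exists2 u, r <= u <= r' & z = pt p d y u] `|`
   [set z | exists2 u, r <= u <= r' & z = pt p d y' u]).

Lemma covers_edges p d (r r' y y' e : R) : axis d -> r <= r' <= r + 1 ->
  y <= y' <= y + 1 -> 0 < e <= 1 -> covers (bar_edges p d r r' y y') (2 * e) (8 / e).
Proof.
move=> ax /andP[r0 r1] /andP[y0 y1] /andP[e0 e1].
have H S l : 0 <= l <= 1 -> curve S l -> covers S (2 * e) (2 / e).
  move=> /andP[l0 l1] cS; apply: covers_le (covers_curve e0 l0 cS) => //.
  have : 1 <= e^-1 by rewrite invf_ge1.
  have : l / e <= 1 / e by rewrite ler_pM2r// invr_gt0.
  by rewrite mul1r; lra.
have -> : 8 / e = (2 / e + 2 / e) + (2 / e + 2 / e) by field; lra.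
by repeat apply: covers_setU; (apply: H; last by [exact: curve_x|exact: curve_u]);
  lra.
Qed.

Lemma trap_edges p d (r r' y y' : R) z : axis d -> trap p d r r' y 0 y' 0 z ->
  ~ (trap p d r r' y 0 y' 0)° z -> bar_edges p d r r' y y' z.
Proof.
move=> ax [x [u [uu]]]; rewrite !mul0r !addr0 => xx -> H.
move: (uu) (xx); rewrite !le_eqVlt => /andP[/orP[/eqP <-|u1] u2].
  by move=> _; left; left; exists x.
case/orP: u2 => [/eqP ->|u2]; first by move=> _; left; right; exists x.
move=> /andP[/orP[/eqP <-|x1]]; first by move=> _; right; left; exists u.
case/orP=> [/eqP ->|x2]; first by right; right; exists u.
by case: H; apply: rect_interior => //; apply/andP.
Qed.

(* The shores of the canal dug in the strip c, without its mouths. *)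
Definition shore (c : chain R) b (v s : R) : set (R * R) :=
  (sideline c (v / 2) `|` sideline c (- (v / 2))) `|`
  ([set z | exists2 u, - (v / 2) <= u <= v / 2 &
      z = cpt c (psize c).-1 (plen c (psize c).-1 - s) u] `|`
   (if b then [set z | exists2 u, - (v / 2) <= u <= v / 2 & z = cpt c 0 s u] else set0)).

Lemma covers_shore c b v s e : good c (v + 2 * s) -> 0 < v <= 1 -> 0 < s -> 0 < e <= 1 ->
  covers (shore c b v s) (2 * e) ((4 * tlen c + 6) / e).
Proof.
move=> gc /andP[v0 v1] s0 /andP[e0 e1]; have [pcc _ _] := gc.
have [m0 ax _ _ _] := pcc.
have T0 := tlen_ge0 pcc.
have E1 : 1 <= e^-1 by rewrite invf_ge1.
have H S l : 0 <= l -> curve S l -> covers S (2 * e) ((l + 1) / e).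
  move=> l0 cS; apply: covers_le (covers_curve e0 l0 cS) => //.
  by rewrite mulrDl; lra.
have -> : (4 * tlen c + 6) / e = ((2 * tlen c + 1) / e + (2 * tlen c + 1) / e) +
  ((1 + 1) / e + (1 + 1) / e) by field; lra.
apply: covers_setU; first apply: covers_setU.
- by apply: H; [lra|apply: (curve_sideline gc); lra].
- by apply: H; [lra|apply: (curve_sideline gc); lra].
have vv : - (v / 2) <= v / 2 by lra.
have V1 : v / 2 - - (v / 2) <= 1 by lra.
apply: covers_setU.
  apply: H; first by lra.
  have m1 : ((psize c).-1 < psize c)%N by rewrite ltn_predL.
  exact: (curve_sub (@subset_refl _ _) V1 (curve_u (vert c (psize c).-1) _ (ax _ m1) vv)).
apply: H; first by lra.
case: b.
  exact: (curve_sub (@subset_refl _ _) V1 (curve_u (vert c 0) _ (ax _ m0) vv)).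
by exists (fun=> 0).
Qed.

(** By [embedded] a common point has an offset in both ranges, namely v / 2 or - (v / 2), or else an
    abscissa in both, at a cut end. *)
Lemma middle_land (c : chain R) b v s z : good c (v + 2 * s) -> 0 < v -> 0 < s -> roomy c s ->
  middle c b v s z -> land c b v s z -> shore c b v s z.
Proof.
move=> gc v0 s0 ro [k [x [u [km uv xx zE]]]].
have [pcc th em] := gc; have [m0 ax L0 _ tn] := pcc.
have dz := middle_dom v0 s0 km uv xx.
have [_ _ lhz] := dz.
have tur j (r : R) : `|turn c j * r| <= `|r|.
  rewrite normrM ler_piMl// /turn; case: j => [|j] /=; first by rewrite normr0 ler01.
  case: ltnP => jm; last by rewrite normr0 ler01.
  have := tn _ jm; rewrite cross_turn//.
  by case=> ->; rewrite ?normrN normr1.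
have /andP[uv1 uv2] := uv; have /andP[xx1 xx2] := xx.
move=> [[j /= jm [/quadP[y [r [rr yy E]]]|/quadP[y [r [rr yy E]]]]]|[[y [r [rr yy E]]]|]].
- have dj : dom c (v + 2 * s) j y r.
    by split=> //; move: rr => /andP[? ?]; lra.
  have [ur _] := em _ _ _ _ _ _ dz dj (etrans (esym zE) E).
  have uE : u = - (v / 2) by move: rr => /andP[? ?]; lra.
  by left; right; exists k, x; rewrite -uE.
- have dj : dom c (v + 2 * s) j y r.
    by split=> //; move: rr => /andP[? ?]; lra.
  have [ur _] := em _ _ _ _ _ _ dz dj (etrans (esym zE) E).
  have uE : u = v / 2 by move: rr => /andP[? ?]; lra.
  by left; left; exists k, x; rewrite -uE.
- right; left; move: yy; rewrite !mul0r !addr0 => /andP[y1 y2].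
  set j := (psize c).-1 in E y1 y2 *.
  have jm : (j < psize c)%N by rewrite prednK.
  have jE : j.+1 = psize c by rewrite prednK.
  have {}tur := tur j r.
  have rv : `|r| <= v / 2 by rewrite ler_norml.
  have Lj : (0 < j)%N -> (v + 2 * s) / 2 < plen c j.
    move=> j0; rewrite -(prednK j0); apply: (plen_last gc); first lra.
    by rewrite prednK// -jE.
  have lo_lt : lo c j r < plen c j - s.
    rewrite /lo; have [j0|j0] := posnP j; last first.
      by have := Lj j0; move: tur; rewrite ler_norml => /andP[_]; lra.
    by rewrite j0 turn0 mul0r; have := ro; rewrite /roomy -jE j0 => /(_ erefl); lra.
  have hiE : hi c j r = plen c j by rewrite /hi jE turnm mul0r subr0.
  have dj : dom c (v + 2 * s) j y r.
    split=> //; first by move: rr => /andP[? ?]; lra.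
    by rewrite hiE; lra.
  have [ur] := em _ _ _ _ _ _ dz dj (etrans (esym zE) E).
  case=> [[kj xy]|[_ _ yl]|[kj]].
  + have xL : x = plen c j - s.
      move: xx2; rewrite /chi kj jE eqxx; lra.
    by exists u => //; rewrite zE kj xL.
  + by move: y1 lo_lt; rewrite yl ur; lra.
  + by move: km; rewrite kj jE ltnn.
- case: b xx xx1 dz lhz => //= xx xx1 dz lhz [y [r [rr]]].
  rewrite !mul0r !addr0 => /andP[y1 y2] E.
  right; right => /=.
  have {}tur := tur 1%N r.
  have rv : `|r| <= v / 2 by rewrite ler_norml.
  have hi_gt : s < hi c 0 r.
    rewrite /hi; have [m1|m1] := leqP (psize c) 1; last first.
      by have := plen_first gc ltac:(lra) m1; move: tur; rewrite ler_norml => /andP[_]; lra.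
    have m1' : psize c = 1%N by apply/eqP; rewrite eqn_leq m1.
    by rewrite -m1' turnm mul0r; have := ro m1'; lra.
  have dj : dom c (v + 2 * s) 0 y r.
    split=> //; first by move: rr => /andP[? ?]; lra.
    by rewrite /lo turn0 mul0r; lra.
  have [ur] := em _ _ _ _ _ _ dz dj (etrans (esym zE) E).
  case=> [[kj xy]|[//]|[kj yh _]].
  + have xs : x = s by move: xx1; rewrite /clo kj /=; lra.
    by exists u => //; rewrite zE kj xs.
  + by move: y2 hi_gt; rewrite yh ur; lra.
Qed.

(** A boundary point of a canal either is approached by the land that remains, and then lies on its
    shore or on an edge of its bar, or it is approached only by earlier canals, as in a mouth, and
    then it is on the boundary of one of these. *)
Lemma canal_frontier n : exists E : set (R * R),
  (forall e, 0 < e <= 1 -> covers E (2 * e) (26 * 2 ^+ n / e)) /\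
  forall z, @open_unit_square R z -> C n.+1 z -> ~ (C n.+1)° z ->
    E z \/ exists2 k, (1 <= k <= n)%N & C k z /\ ~ (C k)° z.
Proof.
have [c [b [B [gc IE [bs cB] CE [ro /andP[_ T]]]]]] := island_strip a2 a_slow wada n.
have t0 := land_width_gt0 n.+1 a2; have w0 := canal_width_gt0 n a2.
have w1 := canal_width_le a2 n; have t1 := land_width_le1 a2 n.
have tn0 := land_width_gt0 n a2.
have gc' : good c (w n.+1 + 2 * t n.+1) by rewrite -canal_widthE.
have [pcc _ _] := gc; have [_ ax _ _ _] := pcc.
have p1 : 1 <= 2 ^+ n :> R by apply: exprn_ege1; lra.
have [EB [cEB HB]] : exists EB : set (R * R),
    (forall e, 0 < e <= 1 -> covers EB (2 * e) (8 / e)) /\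
    forall z, B z -> ~ B° z -> EB z.
  case: bs => [->|[_ [i [r [y [im -> _]]]]]].
    exists set0; split=> // e /andP[e0 _].
    by apply: (covers_le (lexx _) _ (covers_set0 (2 * e))); apply: divr_ge0; lra.
  exists (bar_edges (vert c i) (pdir c i) r (r + t n / 2) y (y + w n.+1)); split.
    by move=> e ee; apply: covers_edges => //; [exact: ax|lra|lra].
  by move=> z Bz nB; apply: trap_edges => //; exact: ax.
exists (shore c b (w n.+1) (t n.+1) `|` EB); split.
  move=> e ee; have /andP[e0 _] := ee.
  have := covers_setU (covers_shore b gc' _ t0 ee) (cEB e ee).
  have -> : 0 < w n.+1 <= 1 by lra.
  move=> /(_ isT); apply: covers_le => //.
  by rewrite -mulrDl ler_pM2r ?invr_gt0//; lra.
move=> z oz Cz nC; have [Bz|nB] := EM (B z).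
  left; right; apply: HB => // Bi; apply: nC; move: Bi; apply: interiorS.
  by rewrite CE => y; left.
have mz : middle c b (w n.+1) (t n.+1) z by move: Cz; rewrite CE => -[].
have Iz : I n z.
  rewrite IE canal_widthE; have [k [x [u [km uu xx ->]]]] := mz.
  by exists k, x, u; split=> //; exact: (middle_dom w0 t0 km uu xx).
have [cl|ncl] := EM (closure (I n `\` C n.+1) z).
  left; left; apply: (middle_land gc') => //.
  have /closure_id -> := @closed_land _ c b (w n.+1) (t n.+1) pcc.
  move: cl; apply: closureS => y [Iy nCy]; apply: (@land_cover _ c b _ _ pcc t0); split.
    by rewrite -canal_widthE -IE.
  by move=> my; apply: nCy; rewrite CE; right.
(* Near z all of I_n belongs to the new canal, while points outside this canal accumulate at z. They
   lie outside I_n, hence in the first n canals, whose union is closed; and z, being in I_n, is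
   interior to none of them. *)
right.
have /closure_id clE := @closed_canals n.
have : closure (\bigcup_(k in [set k | (1 <= k <= n)%N]) C k) z.
  apply/closure_boxP => e e0.
  have [e1 e10 He1] : exists2 e1, 0 < e1 & forall z', `|z.1 - z'.1| < e1 ->
      `|z.2 - z'.2| < e1 -> @unit_square R z'.
    have [/andP[? ?] /andP[? ?]] := oz.
    exists (Num.min (Num.min z.1 (1 - z.1)) (Num.min z.2 (1 - z.2))).
      by rewrite !lt_min !subr_gt0; apply/andP; split; apply/andP; split.
    move=> z'; rewrite !lt_min !ltr_norml.
    move=> /andP[/andP[/andP[? ?] /andP[? ?]] /andP[/andP[? ?] /andP[? ?]]].
    move=> /andP[/andP[/andP[? ?] /andP[? ?]] /andP[/andP[? ?] /andP[? ?]]].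
    by split; lra.
  have [e2 e20 He2] : exists2 e2, 0 < e2 & forall z', `|z.1 - z'.1| < e2 ->
      `|z.2 - z'.2| < e2 -> ~ (I n `\` C n.+1) z'.
    apply: contrapT => H; apply: ncl; apply/closure_boxP => e' e'0.
    apply: contrapT => H'; apply: H; exists e' => // z' h1 h2 Iz'.
    by apply: H'; exists z'.
  pose e' := Num.min e (Num.min e1 e2).
  have e'0 : 0 < e' by rewrite !lt_min e0 e10 e20.
  have [z' [h1 h2 nz']] : exists z', [/\ `|z.1 - z'.1| < e', `|z.2 - z'.2| < e' & ~ C n.+1 z'].
    apply: contrapT => H; apply: nC; apply/nbhs_boxP; exists e' => // z' h1 h2.
    by apply: contrapT => H'; apply: H; exists z'.
  move: h1 h2; rewrite !lt_min => /andP[h1 /andP[h1' h1'']] /andP[h2 /andP[h2' h2'']].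
  exists z'; split=> //.
  have [|k kn Ck] := @not_island n z' (He1 _ h1' h2').
    by move=> Iz'; apply: (He2 z').
  by exists k.
rewrite -clE => -[k /= kn Ck]; exists k => //; split=> //.
exact: (island_not_canal kn Iz).
Qed.

Lemma canal_near_island n : C n.+1 `<=` near_set (t n) (I n).
Proof.
have [c [b [B [gc IE [bs cB] -> _]]]] := island_strip a2 a_slow wada n.
have t0 := land_width_gt0 n.+1 a2; have w0 := canal_width_gt0 n a2.
have w1 := canal_width_le a2 n; have tn0 := land_width_gt0 n a2.
have [[_ ax _ _ _] _ _] := gc.
move=> z [Bz|mz].
  case: bs => [B0|[_ [i [r [y [im BE [p Bp Ip]]]]]]]; first by move: Bz; rewrite B0.
  exists p => //; move: Bz Bp; rewrite BE => -[x [u [/andP[u1 u2] + ->]]] [x' [u' [/andP[? ?] + ->]]].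
  rewrite !mul0r !addr0 => /andP[? ?] /andP[? ?].
  by rewrite !ler_norml /pt; case: (ax _ im) => -> /=; split; lra.
exists z; last by rewrite !subrr normr0; split; exact: ltW.
rewrite IE canal_widthE; have [k [x [u [km uu xx ->]]]] := mz.
by exists k, x, u; split=> //; exact: (middle_dom w0 t0 km uu xx).
Qed.

(** The middle line [sideline c 0] is a curve, and every point of the strip is within t_n of it. *)
Lemma covers_island n e : 0 < e <= 1 ->
  covers (I n) (2 * e + 2 * (t n)) (7 * 2 ^+ n / e).
Proof.
move=> /andP[e0 e1].
have [c [b [B [gc IE _ _ [_ /andP[_ T]]]]]] := island_strip a2 a_slow wada n.
have tn0 := land_width_gt0 n a2; have [pcc th _] := gc.
have T0 := tlen_ge0 pcc; have [_ ax L0 _ _] := pcc.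
have p1 : 1 <= 2 ^+ n :> R by apply: exprn_ege1; lra.
have cS : covers (sideline c 0) (2 * e) (7 * 2 ^+ n / e).
  have z0 : - (t n / 2) <= 0 <= t n / 2 by lra.
  apply: covers_le (covers_curve e0 _ (curve_sideline gc z0)) => //; last by lra.
  have : 1 <= e^-1 by rewrite invf_ge1.
  have : 2 * tlen c / e <= (6 * 2 ^+ n - 1) / e by rewrite ler_pM2r ?invr_gt0//; lra.
  have : 2 ^+ n / e >= e^-1 by rewrite ler_peMl// invr_ge0 ltW.
  by rewrite mulrBl; lra.
apply: covers_sub (covers_near (ltW tn0) cS); rewrite IE.
move=> z [k [x [u [[km uu xx] ->]]]].
have [] := @lo_close _ c (t n) k u 0 pcc gc km.
rewrite /lo /hi !mulr0 !subr0 => l1 l2; rewrite /lo /hi in xx.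
have un : `|u| <= t n / 2 by rewrite ler_norml.
have Lk := L0 _ km.
(* Near a mitre the abscissa may leave the segment by up to t_n / 2 and has to be brought back. *)
pose x' := Num.max 0 (Num.min x (plen c k)).
exists (cpt c k x' 0).
  exists k, x'; split=> //; rewrite /lo /hi !mulr0 subr0 /x'.
  by rewrite le_max lexx /= ge_max (ltW Lk) ge_min lexx orbT.
have xd : `|x - x'| <= t n / 2.
  move: l1 l2 xx; rewrite !ler_norml => /andP[? ?] /andP[? ?] /andP[? ?].
  rewrite /x' /Num.max /Num.min.
  by case: (ltP x (plen c k)) => ?; case: (ltP 0 _) => ?; lra.
have [] := pt_close (vert c k) x u x' 0 (ax _ km); rewrite -!/(cpt _ _ _ _) subr0.
by move=> h1 h2; split; [apply: le_trans h1 _|apply: le_trans h2 _]; lra.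
Qed.

(** The count is 33 = 7 + 26: the points within 2 t_n of the island, and the shores of the first n
    canals, where the powers 2^k for k < n add up to at most 2^n. *)
Lemma covers_wada n e : 0 < e <= 1 ->
  covers (wada_set C) (2 * e + 6 * t n) (33 * 2 ^+ n / e).
Proof.
move=> ee; have /andP[e0 e1] := ee.
have tn0 := land_width_gt0 n a2.
have p1 : 1 <= 2 ^+ n :> R by apply: exprn_ege1; lra.
have /choice[E HE] := canal_frontier.
have cE : covers (\bigcup_(k in `I_n) E k) (2 * e) (26 * 2 ^+ n / e).
  apply: (covers_le _ _ (covers_bigcup (fun k _ => (HE k).1 e ee))) => //.
  rewrite -mulr_suml -mulr_sumr ler_pM2r ?invr_gt0// ler_pM2l//.
  elim: (n) => [|j IH]; first by rewrite big_ord0 expr0 ler01.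
  by rewrite big_ord_recr /= exprS; lra.
have := covers_setU (covers_near (ltW (mulr_gt0 (ltr0Sn _ 1) tn0)) (covers_island n ee))
  (covers_le _ (lexx _) cE).
have -> : 2 * e <= 2 * e + 2 * t n + 2 * (2 * t n) by lra.
move=> /(_ isT).
have -> : 2 * e + 2 * t n + 2 * (2 * t n) = 2 * e + 6 * t n by ring.
have -> : 7 * 2 ^+ n / e + 26 * 2 ^+ n / e = 33 * 2 ^+ n / e by field; lra.
apply: covers_sub => z [oz [clz niz]].
(* Descent: a boundary point of canal k lies on a shore or on the boundary of an earlier canal. *)
have shore_of : forall k, (k <= n)%N -> (1 <= k)%N -> C k z -> ~ (C k)° z ->
    (\bigcup_(k in `I_n) E k) z.
  move=> k; have [j jk] := ubnP k; elim: j k jk => // j IH [//|k] jk kn _ Cz nC.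
  have [Ek|[i /andP[i0 ik] [Ci nCi]]] := (HE k).2 z oz Cz nC; first by exists k.
  apply: IH Ci nCi => //; first exact: leq_ltn_trans ik jk.
  exact: leq_trans ik (ltnW kn).
have [nI|nI] := EM (near_set (2 * t n) (I n) z); first by left.
right.
have nU j : ~ (\bigcup_(j in [set i | (i <= j)%N]) C (3 * j + 1)%N)° z.
  move=> iz; apply: niz; apply: (@filterS _ (nbhs z) _ (lake C 1 j)).
    by move=> y ?; exists j.
  exact: nbhs_interior.
(* A canal dug after Day n stays within t_n of I_n, so it cannot come within t_n of a point farther
   than 2 t_n from I_n. *)
have [e' e'0 He'] : exists2 e', 0 < e' & forall z' k, `|z.1 - z'.1| < e' ->
    `|z.2 - z'.2| < e' -> C k z' -> (1 <= k)%N -> (k <= n)%N.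
  exists (t n) => // z' [//|k] h1 h2 Ck _; rewrite leqNgt; apply/negP => nk.
  apply: nI; have [p Ip [h3 h4]] := canal_near_island Ck.
  exists p; first exact: (@island_sub n k nk _ Ip).
  have tk : t k <= t n.
    have: (n <= k)%N by []. clear -a2.
    elim: k => [|k IH]; first by rewrite leqn0 => /eqP ->.
    rewrite leq_eqVlt => /orP[/eqP -> //|nk]; have := IH nk.
    by have := land_width_half k a2; have := land_width_gt0 k.+1 a2; lra.
  move: h1 h2 h3 h4; rewrite !ltr_norml !ler_norml.
  by move=> /andP[? ?] /andP[? ?] /andP[? ?] /andP[? ?]; split; lra.
have clU : closure (\bigcup_(k in [set k | (1 <= k <= n)%N /\ exists j, k = (3 * j + 1)%N]) C k) z.
  apply/closure_boxP => r r0.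
  have m0 : 0 < Num.min r e' by rewrite lt_min r0.
  have [z' [[j _ lz'] h1 h2]] := (closure_boxP _ _).1 clz _ m0.
  move: h1 h2; rewrite !lt_min => /andP[h1 h1'] /andP[h2 h2'].
  exists z'; split=> //; have [i /= ij Ci] := interior_subset lz'.
  have i1 : (1 <= 3 * i + 1)%N by rewrite addn1.
  exists (3 * i + 1)%N => //=; split; last by exists i.
  by rewrite i1 (He' _ _ h1' h2' Ci).
have /closure_id clE : closed (\bigcup_(k in [set k | (1 <= k <= n)%N /\ exists j, k = (3 * j + 1)%N]) C k).
  apply: closed_bigcup; first by apply: (@sub_finite_set _ _ `I_n.+1) => // k /= [/andP[]].
  by move=> [[]//|k] _; exact: (closed_canal a2 a_slow wada).
move: clU; rewrite -clE => -[k /= [/andP[k1 kn] [j kE]] Ck].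
apply: (shore_of k) => //; rewrite kE => iz; apply: (nU j).
by move: iz; apply: interiorS => y; exists j => /=.
Qed.

End UpperBound.

(** * Lower bound for the covering number *)

Section CoverArea.
Variable R : realType.
Local Notation plane := (measurableTypeR R * measurableTypeR R)%type.
Local Notation area := (@area R).

Lemma area_box (x x' y y' : R) : x <= x' -> y <= y' ->
  measurable ([set z | x <= z.1 <= x' /\ y <= z.2 <= y'] : set plane) /\
  area [set z | x <= z.1 <= x' /\ y <= z.2 <= y'] = ((x' - x) * (y' - y))%:E.
Proof.
move=> xx yy; have ax : axis (1, 0 : R) by constructor 1.
have -> : [set z : R * R | x <= z.1 <= x' /\ y <= z.2 <= y'] =
    trap (0, 0) (1, 0) y y' x 0 x' 0.
  rewrite trapE// eqEsubset /coordx /coordu; split=> -[z1 z2] /=.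
    by move=> [/andP[? ?] /andP[? ?]]; split; lra.
  by move=> [/andP[? ?] /andP[? ?]]; split; lra.
rewrite trap_gtrap; split; first exact: measurable_gtrap.
rewrite area_gtrap//; last by move=> u _; lra.
by congr (_%:E); field.
Qed.

Lemma covers_area (S : set plane) (e X : R) : 0 <= e -> covers S e X ->
  exists2 M : set plane, measurable M /\ (area M <= (e ^+ 2 * X)%:E)%E & S `<=` M.
Proof.
move=> e0 [k [kX [f Hf]]].
pose F j := if insub j is Some i then square (f i) e else set0.
have HF j : (j < k)%N -> measurable (F j : set plane) /\ (area (F j) <= (e ^+ 2)%:E)%E.
  move=> jk; rewrite /F insubT/=; move: (f _) => p.
  have [] := @area_box p.1 (p.1 + e) p.2 (p.2 + e); [lra|lra|].
  move=> mp ap; split=> //; rewrite ap lee_fin; lra.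
have [||mU aU] := @area_bigcup_le R F (fun=> e ^+ 2) k.
- by move=> j /HF[].
- by move=> j /HF[].
exists (\bigcup_(j in `I_k) F j).
  split=> //; apply: le_trans aU _; rewrite lee_fin sumr_const card_ord -mulr_natr.
  by rewrite ler_wpM2l// sqr_ge0.
move=> z /Hf[i _ zi]; exists i => /=; first exact: ltn_ord.
by rewrite /F; case: insubP => [j _ ij|]; [rewrite (_ : j = i)//; exact: val_inj|rewrite ltn_ord].
Qed.

End CoverArea.

Section LowerBound.
Variables (R : realType) (a : nat -> R) (C P : nat -> set (R * R)).
Hypothesis a2 : forall k, (1 <= k)%N -> 2 < a k.
Hypothesis a_slow : forall n, (3 <= n)%N -> a n.+1 * land_width a n <= 1.
Hypothesis wada : wada_canals a C P.

Local Notation t := (land_width a).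
Local Notation w := (canal_width a).
Local Notation I := (island C).

(* The two points of the walls opposite to z are t n apart, so the bar, which *)
(* is smaller than t n in both directions, contains at most one of them.     *)
Lemma next_island n z : I n z -> exists2 z', I n.+1 z' &
  `|z.1 - z'.1| <= 2 * t n /\ `|z.2 - z'.2| <= 2 * t n.
Proof.
have [c [b [B [gc IE [bs cB] CE [ro _]]]]] := island_strip a2 a_slow wada n.
have t0 := land_width_gt0 n.+1 a2; have w0 := canal_width_gt0 n a2.
have tE := canal_widthE a n; have tn0 := land_width_gt0 n a2.
have gc' : good c (w n.+1 + 2 * t n.+1) by rewrite -tE.
have [pcc th em] := gc; have [_ ax L0 _ _] := pcc.
rewrite IE => -[k [x [u [[km uu xx] ->]]]].
have next v : v = t n / 2 \/ v = - (t n / 2) -> exists y, [/\ dom c (t n) k y v,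
    `|(cpt c k x u).1 - (cpt c k y v).1| <= 2 * t n /\
    `|(cpt c k x u).2 - (cpt c k y v).2| <= 2 * t n &
    ~ middle c b (w n.+1) (t n.+1) (cpt c k y v)].
  move=> vE; have vv : - (t n / 2) <= v <= t n / 2.
    by case: vE => ->; lra.
  have lh := th _ _ km vv.
  have [l1 l2] := @lo_close _ c (t n) k u v pcc gc km.
  pose y := Num.max (lo c k v) (Num.min x (hi c k v)).
  have yy : lo c k v <= y <= hi c k v.
    by rewrite /y le_max lexx /= ge_max (ltW lh) ge_min lexx orbT.
  have uv : `|u - v| <= t n.
    by rewrite ler_norml; move: uu vv => /andP[? ?] /andP[? ?]; lra.
  have xy : `|x - y| <= t n.
    move: xx (le_trans l1 uv) (le_trans l2 uv) lh tn0.
    rewrite !ler_norml /y /Num.max /Num.min; clear.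
    move=> /andP[? ?] /andP[? ?] /andP[? ?] ? ?; case: (ltP x (hi c k v)) => ?.
      by case: (ltP (lo c k v) _) => ?; lra.
    by case: (ltP (lo c k v) _) => ?; lra.
  have dy : dom c (t n) k y v by [].
  exists y; split=> //.
    have [] := pt_close (vert c k) x u y v (ax _ km); rewrite -!/(cpt _ _ _ _).
    by move=> h1 h2; split; [apply: le_trans h1 _|apply: le_trans h2 _]; lra.
  move=> [j [x' [u' [jm uw xx' E]]]].
  have dj : dom c (t n) j x' u' by rewrite tE; exact: (middle_dom w0 t0 jm uw xx').
  have [vu _] := em _ _ _ _ _ _ dy dj E.
  clear CE IE E; by move: uw => /andP[? ?]; case: vE => vE; lra.
have [y1 [d1 z1 m1]] := next _ (or_introl erefl).
have [y2 [d2 z2 m2]] := next _ (or_intror erefl).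
have stay y v : dom c (t n) k y v -> ~ middle c b (w n.+1) (t n.+1) (cpt c k y v) ->
    ~ B (cpt c k y v) -> I n.+1 (cpt c k y v).
  move=> d m nB; rewrite islandS; last exact: (closed_canal a2 a_slow wada).
  apply: subset_closure; split; first by rewrite IE; exists k, y, v.
  by rewrite CE => -[].
have [B1|nB1] := EM (B (cpt c k y1 (t n / 2))); last first.
  by exists (cpt c k y1 (t n / 2)) => //; exact: stay.
have [B2|nB2] := EM (B (cpt c k y2 (- (t n / 2)))); last first.
  by exists (cpt c k y2 (- (t n / 2))) => //; exact: stay.
exfalso; case: bs => [B0|[_ [i [r [y [im BE _]]]]]]; first by rewrite B0 in B1.
move: B1 B2; rewrite BE => -[x3 [u3 [/andP[? ?] + E3]]] [x4 [u4 [/andP[? ?] + E4]]].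
rewrite !mul0r !addr0 => /andP[? ?] /andP[? ?].
have wt : w n.+1 < t n by clear CE IE BE E3 E4 z1 z2 uu xx; lra.
move: E3 E4; rewrite /cpt /pt; clear CE IE BE uu xx tE t0 w0 tn0 z1 z2 d1 d2 next stay.
by case: (ax _ im) => ->; case: (ax _ km) => -> /= [? ?] [? ?]; lra.
Qed.

Definition kernel : set (R * R) := [set z | forall n, I n z].

Lemma compact_unit_square : compact (@unit_square R).
Proof.
have -> : @unit_square R = `[0, 1]%classic `*` `[0, 1]%classic.
  by rewrite eqEsubset; split=> -[x y] [] /=; rewrite !in_itv.
by apply: compact_setX; exact: segment_compact.
Qed.

Lemma island_unit_square n : I n `<=` @unit_square R.
Proof. by rewrite -(island0 C); exact: (@island_sub _ C 0 n). Qed.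

(** Repeat [next_island]: the moves 2 t_k for k >= n add up to at most 4 t_n because the widths at
    least halve. A cluster point lies in every island, these being closed and decreasing. *)
Lemma near_kernel n : I n `<=` near_set (4 * t n) kernel.
Proof.
move=> z Iz.
have /choice[f Hf] : forall x : nat * (R * R), exists z', I x.1 x.2 -> I x.1.+1 z' /\
    (`|x.2.1 - z'.1| <= 2 * t x.1 /\ `|x.2.2 - z'.2| <= 2 * t x.1).
  move=> [k y] /=; have [Iy|nI] := EM (I k y); last by exists y.
  by have [z' ? ?] := next_island Iy; exists z'.
pose zs := fix zs j := if j is j'.+1 then f ((n + j')%N, zs j') else z.
(* The bound telescopes, since 2 t_k <= 4 t_k - 4 t_(k+1). *)
have Hzs j : I (n + j)%N (zs j) /\ (`|z.1 - (zs j).1| <= 4 * t n - 4 * t (n + j)%N /\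
    `|z.2 - (zs j).2| <= 4 * t n - 4 * t (n + j)%N).
  elim: j => [|j [Ij [h1 h2]]].
    by rewrite addn0 !subrr normr0; split.
  have [/= Ij' [h3 h4]] := Hf ((n + j)%N, zs j) Ij.
  rewrite addnS; split=> //; have := land_width_half (n + j) a2.
  move: h1 h2 h3 h4; rewrite /= !ler_norml.
  move=> /andP[? ?] /andP[? ?] /andP[? ?] /andP[? ?] ?.
  by split; lra.
have [|p [_ clp]] := @compact_unit_square (zs @ \oo) _.
  by exists 0%N => // j _; apply: island_unit_square (Hzs j).1.
have near_p N e : 0 < e -> exists2 j, (N <= j)%N &
    `|p.1 - (zs j).1| < e /\ `|p.2 - (zs j).2| < e.
  move=> e0.
  have [||y [[j Nj <-] [h1 h2]]] := clp [set zs j | j in [set j | (N <= j)%N]]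
    [set y | `|p.1 - y.1| < e /\ `|p.2 - y.2| < e].
  - by exists N => // j Nj; exists j.
  - by apply/nbhs_boxP; exists e.
  by exists j.
exists p.
  move=> m; have /closure_id -> : closed (I m) by exact: closed_closure.
  apply/closure_boxP => e e0; have [j mj [h1 h2]] := near_p m e e0.
  exists (zs j); split=> //; apply: (@island_sub _ C m (n + j)); last exact: (Hzs j).1.
  by rewrite (leq_trans mj)// leq_addl.
have close : forall e, 0 < e -> `|z.1 - p.1| <= 4 * t n + e /\ `|z.2 - p.2| <= 4 * t n + e.
  move=> e e0; have [j _ [h1 h2]] := near_p 0%N e e0.
  have [_ [h3 h4]] := Hzs j; have := land_width_gt0 (n + j) a2.
  move: h1 h2 h3 h4; rewrite !ltr_norml !ler_norml.
  move=> /andP[? ?] /andP[? ?] /andP[? ?] /andP[? ?] ?.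
  by split; lra.
by split; apply/ler_addgt0Pr => e /close[].
Qed.

Lemma near_middle n z e : 0 < e -> I n z ->
  exists z', [/\ (C n.+1)° z', `|z.1 - z'.1| <= 2 * t n + e & `|z.2 - z'.2| <= 2 * t n + e].
Proof.
move=> e0.
have [c [b [B [gc IE _ CE [ro _]]]]] := island_strip a2 a_slow wada n.
have t0 := land_width_gt0 n.+1 a2; have w0 := canal_width_gt0 n a2.
have tE := canal_widthE a n; have tn0 := land_width_gt0 n a2.
have th2 := land_width_half n a2.
have [pcc th em] := gc; have [_ ax L0 _ _] := pcc.
rewrite IE => -[k [x [u [[km uu xx] ->]]]].
(* At offset 0 the canal occupies the abscissas from l to h of segment k. *)
pose l := if b && (k == 0)%N then t n.+1 else 0.
pose h := if (k.+1 == psize c)%N then plen c k - t n.+1 else plen c k.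
have lh : l < h.
  have Lk := L0 _ km.
  rewrite /l /h; case: ifP => [/andP[_ /eqP k0]|_]; case: eqP => kE //.
  - by rewrite k0; move: kE; rewrite k0 => /esym/ro; lra.
  - have := @plen_first _ c (t n) gc tn0; rewrite k0; apply: contraPP => nlt H.
    suff : t n / 2 < plen c 0 by apply/negP; rewrite -leNgt; move/negP: nlt; rewrite -leNgt; lra.
    by apply: H; rewrite ltnNge; apply/negP; move: km kE; rewrite k0; case: (psize c) => [|[|]].
  - have [k0|k0] := posnP k.
      by move: kE; rewrite k0 => /esym/ro; lra.
    have := @plen_last _ c (t n) k.-1 gc tn0; rewrite prednK// -kE => /(_ erefl); lra.
have [l1 l2] := @lo_close _ c (t n) k u 0 pcc gc km.
have un : `|u| <= t n / 2 by rewrite ler_norml.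
rewrite subr0 in l1 l2.
have [y [ly yh xy]] : exists y, [/\ l < y, y < h & `|x - y| <= t n + e].
  apply: pick_inside => //; last exact: ltW.
  move: (le_trans l1 un) (le_trans l2 un) xx t0 th2.
  rewrite /lo /hi !mulr0 !subr0 /l /h !ler_norml; clear.
  move=> /andP[? ?] /andP[? ?] /andP[? ?] ? ?.
  by case: ifP => _; case: ifP => _; lra.
exists (cpt c k y 0); split.
- apply: interior_frame; first exact: ax.
  exists (Num.min (w n.+1) (Num.min (y - l) (h - y)) / 2).
    by rewrite divr_gt0// !lt_min w0 !subr_gt0 ly yh.
  have [e1 [e2 e3]] : Num.min (w n.+1) (Num.min (y - l) (h - y)) <= w n.+1 /\
    Num.min (w n.+1) (Num.min (y - l) (h - y)) <= y - l /\
    Num.min (w n.+1) (Num.min (y - l) (h - y)) <= h - y.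
    by rewrite !ge_min !lexx /= !orbT.
  move: (Num.min _ _) e1 e2 e3 => e' e1 e2 e3 y' v.
  rewrite sub0r normrN => hy hv.
  rewrite CE; right; exists k, y', v; split=> //.
    by rewrite -ler_norml; lra.
  have [l3 l4] := @lo_close _ c (t n) k v 0 pcc gc km; rewrite subr0 in l3 l4.
  move: hy (le_lt_trans l3 hv) (le_lt_trans l4 hv) e2 e3 ly yh.
  rewrite /lo /hi !mulr0 !subr0 !ltr_norml /clo /chi /lo /hi /l /h; clear.
  move=> /andP[? ?] /andP[? ?] /andP[? ?].
  by case: ifP => _; case: ifP => _ *; lra.
- have [h1 _] := pt_close (vert c k) x u y 0 (ax _ km); rewrite -!/(cpt _ _ _ _) subr0 in h1.
  by apply: le_trans h1 _; lra.
- have [_ h1] := pt_close (vert c k) x u y 0 (ax _ km); rewrite -!/(cpt _ _ _ _) subr0 in h1.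
  by apply: le_trans h1 _; lra.
Qed.

Lemma land_width_small e : 0 < e -> exists N, forall n, (N <= n)%N -> t n < e.
Proof.
move=> e0; have tp n : t n <= (1 / 2) ^+ n.
  elim: n => [|n IH]; first by rewrite land_width0 expr0.
  by rewrite exprS; have := land_width_half n a2; lra.
have := @cvg_expr R (1 / 2) ltac:(rewrite ger0_norm; lra).
move=> /cvgr0Pnorm_lt /(_ _ e0)[N _ HN]; exists N => n Nn.
apply: le_lt_trans (tp n) _; apply: le_lt_trans (ler_norm _) _; exact: HN.
Qed.

(** By [near_middle] the canals 3 N + 1 have interior points arbitrarily close to such a point. It
    is in no lake, since a lake is open and would have to meet dry land of the island of the same
    day. *)
Lemma kernel_wada : kernel `&` @open_unit_square R `<=` wada_set C.
Proof.
move=> z [Kz oz]; split=> //; split.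
  apply/closure_boxP => e e0.
  have [N HN] := @land_width_small (e / 3) ltac:(lra).
  have tN : t (3 * N)%N < e / 3 by apply: HN; rewrite leq_pmull.
  have [z' [Cz' h1 h2]] := @near_middle (3 * N)%N z (e / 3) ltac:(lra) (Kz _).
  exists z'; split; [|by apply: le_lt_trans h1 _; lra|by apply: le_lt_trans h2 _; lra].
  exists N => //; rewrite /lake; move: Cz'; apply: interiorS => y Cy.
  by exists N; rewrite /= ?addn1.
move=> /interior_subset[k _ lk].
have [z' [[_ nC] [j /= jk Cz']]] := Kz (3 * k + 1)%N _ lk.
by apply: nC; exists (3 * j + 1)%N => //=; rewrite addn1 /= addn1 ltnS leq_pmul2l.
Qed.

(** Squares of side t_n enlarged by 4 t_n on each side have area 81 t_n^2. Within 4 t_n of the sides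
    of the unit square the nearby common point of the islands need not be in the open square, so
    four border strips of total area 16 t_n are added. Dividing the area of I_n by t_n gives the
    estimate. *)
Lemma wada_covers_ge n X : covers (wada_set C) (t n) X ->
  2 ^+ n / 2 <= 16 + 81 * t n * X.
Proof.
move=> cX; have tn0 := land_width_gt0 n a2.
have [c [b [B [gc IE _ _ [_ /andP[T _]]]]]] := island_strip a2 a_slow wada n.
have [pcc _ _] := gc.
have c9 := covers_near (ltW (mulr_gt0 (ltr0Sn _ 3) tn0)) cX.
have [|M [mM aM] HM] := covers_area _ c9; first by lra.
have [|mF1 aF1] := @area_box R 0 (4 * t n) 0 1 _ ler01; first lra.
have [|mF2 aF2] := @area_box R (1 - 4 * t n) 1 0 1 _ ler01; first lra.
have [|mF3 aF3] := @area_box R 0 1 0 (4 * t n) ler01; first lra.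
have [|mF4 aF4] := @area_box R 0 1 (1 - 4 * t n) 1 ler01; first lra.
have s1 : I n `<=` M `|` (([set z | 0 <= z.1 <= 4 * t n /\ 0 <= z.2 <= 1] `|`
    [set z | 1 - 4 * t n <= z.1 <= 1 /\ 0 <= z.2 <= 1]) `|`
    ([set z | 0 <= z.1 <= 1 /\ 0 <= z.2 <= 4 * t n] `|`
    [set z | 0 <= z.1 <= 1 /\ 1 - 4 * t n <= z.2 <= 1])).
  move=> z Iz; have [/andP[x0 x1] /andP[y0 y1]] := island_unit_square Iz.
  have [h1|h1] := leP z.1 (4 * t n).
    by right; left; left; split; apply/andP; split.
  have [h2|h2] := leP (1 - 4 * t n) z.1.
    by right; left; right; split; apply/andP; split.
  have [h3|h3] := leP z.2 (4 * t n).
    by right; right; left; split; apply/andP; split.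
  have [h4|h4] := leP (1 - 4 * t n) z.2.
    by right; right; right; split; apply/andP; split.
  left; apply: HM; have [p Kp [d1 d2]] := near_kernel Iz.
  exists p => //; apply: kernel_wada; split=> //.
  move: d1 d2; rewrite !ler_norml => /andP[? ?] /andP[? ?].
  by split; lra.
have mI : measurable (I n : set (measurableTypeR R * measurableTypeR R)).
  by rewrite IE; exact: measurable_ribbon.
have mF : measurable ((([set z | 0 <= z.1 <= 4 * t n /\ 0 <= z.2 <= 1] `|`
    [set z | 1 - 4 * t n <= z.1 <= 1 /\ 0 <= z.2 <= 1]) `|`
    ([set z | 0 <= z.1 <= 1 /\ 0 <= z.2 <= 4 * t n] `|`
    [set z | 0 <= z.1 <= 1 /\ 1 - 4 * t n <= z.2 <= 1])) :
    set (measurableTypeR R * measurableTypeR R)).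
  by apply: measurableU; exact: measurableU.
have : (area (I n) <= ((t n + 2 * (4 * t n)) ^+ 2 * X +
    ((4 * t n + 4 * t n) + (4 * t n + 4 * t n)))%:E)%E.
  apply: (le_trans (area_le mI _ s1)); first exact: measurableU.
  apply: (le_trans (areaU_le mM mF)); rewrite EFinD; apply: leeD => //.
  apply: (le_trans (areaU_le _ _)); [exact: measurableU|exact: measurableU|].
  rewrite EFinD; apply: leeD.
    apply: (le_trans (areaU_le mF1 mF2)); rewrite EFinD; apply: leeD.
      by rewrite aF1 lee_fin; lra.
    by rewrite aF2 lee_fin; lra.
  apply: (le_trans (areaU_le mF3 mF4)); rewrite EFinD; apply: leeD.
    by rewrite aF3 lee_fin; lra.
  by rewrite aF4 lee_fin; lra.
rewrite IE (area_ribbon gc (ltW tn0)) lee_fin => H.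
have {}H : tlen c <= 16 + 81 * t n * X.
  by rewrite -(ler_pM2l tn0); lra.
lra.
Qed.

End LowerBound.

(** * The widths and the dimension *)

Section BoxDimension.
Variable R : realType.
Implicit Types (S : set (R * R)) (e d : R) (f : R -> R).

Lemma limf_esup_at_right f (x d : R) :
  (forall eta, 0 < eta -> \forall y \near x^'+, `|f y - d| <= eta) ->
  limf_esup (EFin \o f) x^'+ = d%:E.
Proof.
move=> H; apply/eqP; rewrite eq_le limf_esupE; apply/andP; split.
  apply/lee_addgt0Pr => eta eta0.
  apply: (@le_trans _ _ (ereal_sup ((EFin \o f) @` [set y | `|f y - d| <= eta]))).
    by apply: ereal_inf_lbound; exists [set y | `|f y - d| <= eta] => //; exact: H.
  apply: ge_ereal_sup => _ [y /= + <-]; rewrite ler_norml => /andP[? ?].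
  by rewrite -EFinD lee_fin; lra.
apply: le_ereal_inf_tmp => _ [V FV <-]; apply/lee_subgt0Pr => eta eta0.
have [y [Vy]] := filter_ex (filterI FV (H _ eta0)).
rewrite ler_norml => /andP[? ?].
apply: (@le_trans _ _ (f y)%:E); first by rewrite -EFinB lee_fin; lra.
by apply: ereal_sup_ubound; exists y.
Qed.

Lemma has_box_dim_near S d :
  (forall eta, 0 < eta -> exists2 e0, 0 < e0 & forall e, 0 < e < e0 ->
    `|ln (covering_number S e)%:R / ln (1 / e) - d| <= eta) ->
  has_box_dim S d.
Proof.
move=> H; have near_d eta : 0 < eta -> \forall e \near 0^'+,
    `|ln (covering_number S e)%:R / ln (1 / e) - d| <= eta.
  move=> /H[e0 e00 He0]; near=> e; apply: He0; apply/andP; split.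
    by near: e; exact: nbhs_right_gt.
  by near: e; exact: nbhs_right_lt.
split; first exact: (limf_esup_at_right near_d).
rewrite /lower_box_dim /limf_einf.
have -> : (\- box_ratio S)%E = EFin \o (fun e => - (ln (covering_number S e)%:R / ln (1 / e))).
  by apply/funext.
rewrite (@limf_esup_at_right _ _ (- d)) ?EFinN ?oppeK// => eta eta0.
near=> e; rewrite -opprD normrN; near: e; exact: near_d.
Unshelve. all: by end_near. Qed.

(** As soon as some cover exists, [xget] returns the minimum and not its default 0. *)
Lemma covering_numberP S e k : covered_by_squares S e k ->
  covered_by_squares S e (covering_number S e) /\ (covering_number S e <= k)%N.
Proof.
move=> Sk; have ex : exists n, `[< covered_by_squares S e n >] by exists k; apply/asboolP.
have [] : [set k | covered_by_squares S e k /\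
    forall j, covered_by_squares S e j -> (k <= j)%N] (covering_number S e).
  apply: (@xgetPex _ 0%N); exists (ex_minn ex); case: ex_minnP => n /asboolP Sn Hn.
  by split=> // j Sj; apply: Hn; apply/asboolP.
by move=> Sn /(_ k Sk).
Qed.

End BoxDimension.

(** * The choice of the widths *)

Section Widths.
Variables (R : realType) (d : R).
Hypothesis hd : 1 <= d <= 2.

Local Notation delta := (d - 1).
Local Notation L := (ln (2 : R)).

(** This grows like n / delta for delta > 0 and like n^2 for delta = 0. The factor n + 2 keeps the
    steps above 1 even for delta = 1, where the value is n + 1 - 1 / (n + 1). *)
Definition scale (n : nat) : R := n%:R * (n%:R + 2) / (n%:R * delta + 1).
Definition widths (n : nat) : R := expR ((scale n - scale n.-1) * L).

Local Notation t := (land_width widths).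

Let L0 : 0 < L.
Proof. by apply: ln_gt0; lra. Qed.

Let two : 2 = expR L.
Proof. by rewrite lnK// posrE; lra. Qed.

Lemma land_widthsE n : t n = expR (- (scale n * L)).
Proof.
elim: n => [|n IH]; first by rewrite land_width0 /scale !mul0r oppr0 expR0.
by rewrite land_widthS IH /widths -expRN -expRD /=; congr expR; ring.
Qed.

Let D0 (n : nat) : 1 <= n%:R * delta + 1.
Proof.
have d0 : 0 <= delta by move: hd => /andP[? ?]; lra.
by have := mulr_ge0 (ler0n R n) d0; lra.
Qed.

Lemma scale_step n : scale n.+1 - scale n =
  (n%:R * (n%:R + 1) * delta + 2 * n%:R + 3) / ((n%:R * delta + 1) * (n.+1%:R * delta + 1)).
Proof.
have := D0 n; have := D0 n.+1; rewrite /scale -natr1; move: (n%:R) => x ? ?.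
by field; lra.
Qed.

Lemma scale_step_gt1 n : 1 < scale n.+1 - scale n.
Proof.
rewrite scale_step; have := D0 n; have := D0 n.+1; rewrite -natr1.
have := ler0n R n; move: (n%:R) hd => x /andP[d1 d2] x0 h1 h2.
have P : 0 < (x * delta + 1) * ((x + 1) * delta + 1) by apply: mulr_gt0; lra.
rewrite ltr_pdivlMr// mul1r -subr_gt0.
have -> : x * (x + 1) * delta + 2 * x + 3 - (x * delta + 1) * ((x + 1) * delta + 1) =
  x * (x + 1) * (delta * (1 - delta)) + (2 * x + 1) * (1 - delta) + 1 by ring.
have q1 : 0 <= delta * (1 - delta) by apply: mulr_ge0; lra.
have q2 : 0 <= x * (x + 1) by apply: mulr_ge0; lra.
have q3 : 0 <= (2 * x + 1) * (1 - delta) by apply: mulr_ge0; lra.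
by have := mulr_ge0 q2 q1; lra.
Qed.

Lemma widths_gt2 n : (1 <= n)%N -> 2 < widths n.
Proof.
case: n => // n _; rewrite [X in X < _]two /widths ltr_expR /=.
by have := scale_step_gt1 n; have := L0; nra.
Qed.

Lemma widths_slow n : (3 <= n)%N -> widths n.+1 * t n <= 1.
Proof.
move=> n3; rewrite land_widthsE /widths -expRD /= -[X in _ <= X]expR0 ler_expR.
have n3' : 3 <= n%:R :> R by rewrite ler_nat.
suff : scale n.+1 <= 2 * scale n by have := L0; nra.
rewrite /scale mulrA ler_pdivrMr; last by have := D0 n.+1; lra.
rewrite mulrAC ler_pdivlMr; last by have := D0 n; lra.
have := D0 n; have := D0 n.+1; rewrite -natr1.
move: (n%:R) hd n3' => x /andP[d1 d2] x3 h1 h2.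
have q1 : (x + 1) * (x + 1 + 2) * (x * delta + 1) <= (x + 1) * (x + 1 + 2) * ((x + 1) * delta + 1).
  by apply: ler_wpM2l; [apply: mulr_ge0; lra|lra].
apply: le_trans q1 _; apply: ler_wpM2r; first by lra.
nra.
Qed.

(** Three days reduce the land width by a factor above 8. For delta <= 1/2 the steps of [scale] are
    at least 2, so the factor 1 - 2 / a_n of the earlier canal is at least 1/2. For delta > 1/2 the
    steps decrease, so this factor is no smaller for the earlier canal than for the later one. *)
Lemma canal_widths_decrease n : (4 <= n)%N ->
  canal_width widths n < canal_width widths (n - 3).
Proof.
move=> n4; have -> : n = (n - 4).+4 by rewrite -addn4 subnK.
move: (n - 4)%N => {n n4}k; have -> : (k.+4 - 3 = k.+1)%N by rewrite -[k.+4]/(3 + k.+1)%N addKn.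
rewrite /canal_width /=.
have tk := land_width_gt0 k widths_gt2.
have t8 : 8 * t k.+3 < t k.
  have := land_width_half k widths_gt2; have := land_width_half k.+1 widths_gt2.
  by have := land_width_half k.+2 widths_gt2; lra.
have t30 := land_width_gt0 k.+3 widths_gt2.
have inv n : (0 < n)%N -> 0 < (widths n)^-1 < 1 / 2.
  move=> n0; have := widths_gt2 n0 => a2; rewrite invr_gt0 mul1r.
  by apply/andP; split; [lra|rewrite ltf_pV2// posrE; lra].
have /andP[i1 i2] := inv k.+1 isT; have /andP[i3 i4] := inv k.+4 isT.
have [d1|d1] := leP delta (1 / 2).
  have : (widths k.+1)^-1 <= 1 / 4.
    have -> : 1 / 4 = (expR (2 * L))^-1 :> R.
      by rewrite (_ : 2 * L = L + L) ?expRD -?two; [field|ring].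
    rewrite lef_pV2 ?posrE ?expR_gt0// ler_expR ler_pM2r//= scale_step.
    have := D0 k; have := D0 k.+1; rewrite -natr1.
    have := ler0n R k; move: (k%:R) hd d1 => x /andP[d1' d2] d1 x0 h1 h2.
    have P : 0 < (x * delta + 1) * ((x + 1) * delta + 1) by apply: mulr_gt0; lra.
    rewrite ler_pdivlMr// -subr_ge0.
    have -> : x * (x + 1) * delta + 2 * x + 3 - 2 * ((x * delta + 1) * ((x + 1) * delta + 1)) =
      x * (x + 1) * (delta * (1 - 2 * delta)) + (2 * x + 1) * (1 - 2 * delta) by ring.
    apply: addr_ge0; apply: mulr_ge0; try apply: mulr_ge0; lra.
  by nra.
suff : (widths k.+1)^-1 <= (widths k.+4)^-1 by nra.
rewrite lef_pV2 ?posrE ?expR_gt0// ler_expR ler_pM2r//= !scale_step.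
have E (n : nat) : (n%:R * (n%:R + 1) * delta + 2 * n%:R + 3) /
    ((n%:R * delta + 1) * (n.+1%:R * delta + 1)) =
    1 / delta + (2 * delta - 1) / delta / ((n%:R * delta + 1) * (n.+1%:R * delta + 1)).
  have := D0 n; have := D0 n.+1; rewrite -natr1; move: (n%:R) => x h1 h2.
  by field; apply/and3P; split; lra.
rewrite !E lerD2l; apply: ler_wpM2l; first by apply: divr_ge0; lra.
have d0 : 0 <= delta by lra.
have k3 : k%:R <= k.+3%:R :> R by rewrite ler_nat -addn3 leq_addr.
have k4 : k.+1%:R <= k.+4%:R :> R by rewrite ler_nat -addn3 leq_addr.
have := D0 k; have := D0 k.+1; have := D0 k.+3; have := D0 k.+4 => h1 h2 h3 h4.
have m3 := ler_wpM2r d0 k3; have m4 := ler_wpM2r d0 k4.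
rewrite lef_pV2 ?posrE; [|by apply: mulr_gt0; lra|by apply: mulr_gt0; lra].
by apply: ler_pM; lra.
Qed.

(** Quantitative forms of S_(m+4) / S_m -> 1 and m / S_m -> delta, namely S_(m+4) <= S_m (1 + 12 /
    m) and |m - delta S_m| <= S_m / m; constants are absorbed by 1 <= S_m / m. In the last bound 34
    = 24 + 10, with 12 d <= 24 and 10 = 9 + 1; m >= 34 ensures d - 34 / m >= 0. *)
Lemma scale_bounds m : (34 <= m)%N ->
  [/\ 0 < scale m, scale m <= scale m.+1 <= scale (m + 4),
    m%:R + 10 + scale (m + 4) <= (d + 34 / m%:R) * scale m &
    (d - 34 / m%:R) * scale (m + 4) <= m%:R - 9 + scale m].
Proof.
move=> m34; have m0 : 34 <= m%:R :> R by rewrite ler_nat.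
have inc k : scale k <= scale k.+1 by have := scale_step_gt1 k; lra.
have inc4 : scale m.+1 <= scale (m + 4).
  by rewrite -addn1 !addnS addn0; apply: le_trans (inc _) _; apply: le_trans (inc _) _.
have := D0 m; have := D0 (m + 4)%N => D4 Dm.
have {}d1 : 0 <= delta <= 1 by move: hd => /andP[? ?]; lra.
have /andP[d0 d2] := d1.
have sm : m%:R <= scale m.
  rewrite /scale ler_pdivlMr; last lra.
  have : m%:R * delta <= m%:R * 1 by apply: ler_wpM2l => //; lra.
  by move=> ?; apply: ler_wpM2l; lra.
have s4 : scale (m + 4) <= scale m * (1 + 12 / m%:R).
  rewrite /scale natrD; have := D4; rewrite natrD => {}D4.
  move: (m%:R) Dm m0 D4 => x Dm m0 D4.
  have q : (x + 4) * (x + 4 + 2) <= x * (x + 2) * (1 + 12 / x).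
    have -> : x * (x + 2) * (1 + 12 / x) = (x + 2) * (x + 12) by field; lra.
    nra.
  rewrite ler_pdivrMr; last lra.
  have -> : x * (x + 2) / (x * delta + 1) * (1 + 12 / x) * ((x + 4) * delta + 1) =
    (x * (x + 2) * (1 + 12 / x)) * (((x + 4) * delta + 1) / (x * delta + 1)).
    by field; lra.
  apply: le_trans q _; rewrite ler_peMr//.
    have : 0 <= 12 / x by apply: divr_ge0; lra.
    by move=> ?; apply: mulr_ge0; [apply: mulr_ge0; lra|lra].
  rewrite ler_pdivlMr; lra.
have mS : delta * scale m - scale m / m%:R <= m%:R <= delta * scale m + scale m / m%:R.
  have sE : scale m = m%:R * ((m%:R + 2) / (m%:R * delta + 1)) by rewrite /scale mulrA.
  rewrite sE; move: (m%:R) Dm m0 => x Dm m0.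
  have -> : x * ((x + 2) / (x * delta + 1)) / x = (x + 2) / (x * delta + 1) by field; lra.
  have E : delta * (x * ((x + 2) / (x * delta + 1))) = x - (x * (1 - 2 * delta)) / (x * delta + 1).
    by field; lra.
  have q1 : x * (1 - 2 * delta) / (x * delta + 1) <= (x + 2) / (x * delta + 1).
    by rewrite ler_pM2r ?invr_gt0; [nra|lra].
  have q2 : - ((x + 2) / (x * delta + 1)) <= x * (1 - 2 * delta) / (x * delta + 1).
    by rewrite -mulNr ler_pM2r ?invr_gt0; [nra|lra].
  by rewrite E; lra.
have /andP[mS1 mS2] := mS.
have q0 : scale m / m%:R >= 1 by rewrite ler_pdivlMr; lra.
have qE : scale m * (12 / m%:R) = 12 * (scale m / m%:R) by ring.
split; first by lra.
- by rewrite inc.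
- have -> : (d + 34 / m%:R) * scale m = d * scale m + 34 * (scale m / m%:R) by ring.
  rewrite mulrDr mulr1 qE in s4; lra.
have d34 : 0 <= d - 34 / m%:R.
  have : 34 / m%:R <= 1 :> R by rewrite ler_pdivrMr; lra.
  lra.
apply: le_trans (ler_wpM2l d34 s4) _.
have -> : (d - 34 / m%:R) * (scale m * (1 + 12 / m%:R)) =
  d * scale m + (12 * d - 34) * (scale m / m%:R) - 408 * ((scale m / m%:R) / m%:R).
  by field; lra.
have q3 : 0 <= scale m / m%:R / m%:R by apply: divr_ge0; lra.
have : (12 * d - 34) * (scale m / m%:R) <= - 10 * (scale m / m%:R).
  by apply: ler_wpM2r; lra.
lra.
Qed.

Lemma wada_box_dim (C P : nat -> set (R * R)) :
  wada_canals widths C P -> has_box_dim (wada_set C) d.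
Proof.
move=> W; set S := wada_set C.
have a2 := widths_gt2; have slow := widths_slow.
have t0 n := land_width_gt0 n a2.
have pow2 (n : nat) : 2 ^+ n = expR (n%:R * L) by rewrite expRM_natl -two.
have up n : exists k, k%:R <= 33 * 2 ^+ n / t n /\ covered_by_squares S (8 * t n) k.
  have := covers_wada a2 slow W n (e := t n).
  rewrite t0 land_width_le1// => /(_ isT).
  by rewrite (_ : 2 * t n + 6 * t n = 8 * t n)//; ring.
have mono e e' k : e <= e' -> covered_by_squares S e k -> covered_by_squares S e' k.
  move=> ee [f Hf]; exists f => z /Hf[i _ [/andP[? ?] /andP[? ?]]]; exists i => //.
  by split; lra.
apply: has_box_dim_near => eta eta0.
(* From m >= M it will follow that the error 34 / m is at most [eta]. *)
pose M := maxn 34 (Num.truncn (34 / eta)).+1.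
exists (t M) => // e /andP[e0 eM].
have [N HN] := land_width_small a2 e0.
have ex : exists n, t n <= e by exists N; apply: ltW; exact: HN.
(* The day m is determined by t_(m+1) <= e < t_m. *)
have [[|m] tm min_m] := ex_minnP ex.
  by have := lt_le_trans eM (land_width_le1 a2 M); rewrite land_width0 in tm; lra.
have em : e < t m.
  by rewrite ltNge; apply/negP => /min_m; rewrite ltnn.
have Mm : (M <= m)%N.
  rewrite leqNgt; apply/negP => mM.
  have dec k : (m.+1 <= k)%N -> t k <= t m.+1.
    elim: k => // k IH; rewrite leq_eqVlt => /orP[/eqP <- //|/IH].
    by have := land_width_half k a2; have := t0 k.+1; lra.
  by have := dec M mM; lra.
have m34 : (34 <= m)%N by apply: leq_trans Mm; rewrite leq_maxl.
have [s0 /andP[s1 s2] b1 b2] := scale_bounds m34.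
have m_eta : 34 / m%:R <= eta.
  have : (Num.truncn (34 / eta)).+1%:R <= m%:R :> R.
    by rewrite ler_nat (leq_trans _ Mm)// leq_maxr.
  have := truncnS_gt (34 / eta) => h1 h2.
  have mp : 0 < m%:R :> R by rewrite ltr0n (leq_trans _ m34).
  rewrite ler_pdivrMr// mulrC -ler_pdivrMr//; apply: ltW; exact: lt_le_trans h1 h2.
(* Three more halvings after Day m + 1 absorb the factor 8 in the side of the squares. *)
have e8 : 8 * t (m + 4)%N <= e.
  rewrite -addn1 !addnS addn0 in tm *.
  have := land_width_half m.+1 a2; have := land_width_half m.+2 a2.
  by have := land_width_half m.+3 a2; lra.
have [k [kX kS]] := up (m + 4)%N.
have [SN Nk] := covering_numberP (mono _ _ _ e8 kS).
set n := covering_number S e in SN Nk *.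
(* Here 33 <= 2^6, and 6 + (m + 4) = m + 10. *)
have nX : n%:R <= expR ((m%:R + 10 + scale (m + 4)) * L).
  apply: (@le_trans _ _ k%:R); first by rewrite ler_nat.
  apply: le_trans kX _.
  apply: (@le_trans _ _ (2 ^+ 6 * 2 ^+ (m + 4) / t (m + 4)%N)).
    rewrite ler_pM2r ?invr_gt0// ler_pM2r; last by rewrite exprn_gt0.
    lra.
  rewrite land_widthsE -exprD pow2 -expRN -expRD ler_expR opprK -mulrDl.
  by rewrite !natrD ler_pM2r//; lra.
(* A cover by squares of side e < t_m is also one by squares of side t_m. For m >= 6 the term 16 is
   at most 2^m / 4, and 4 * 81 <= 2^9. *)
have nY : expR ((m%:R - 9 + scale m) * L) <= n%:R.
  have := wada_covers_ge a2 slow W (n := m) (X := n%:R).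
  have cm : covers S (t m) n%:R by exists n; split=> //; apply: mono (ltW em) SN.
  move=> /(_ cm) => H.
  have m6 : 2 ^+ 6 <= 2 ^+ m :> R.
    by rewrite ler_eXn2l ?(leq_trans _ m34)//; lra.
  have {}H : 2 ^+ m / 2 ^+ 9 / t m <= n%:R.
    rewrite ler_pdivrMr//.
    by have := ler0n R n => n0; have := mulr_ge0 n0 (ltW (t0 m)); lra.
  apply: le_trans H; rewrite land_widthsE !pow2 -!expRN -!expRD ler_expR opprK.
  by rewrite -mulNr -!mulrDl.
have n0 : 0 < n%:R :> R by apply: lt_le_trans nY; exact: expR_gt0.
have lnn : (m%:R - 9 + scale m) * L <= ln n%:R <= (m%:R + 10 + scale (m + 4)) * L.
  by apply/andP; split; rewrite -ler_expR lnK ?posrE.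
have lne : scale m * L <= ln (1 / e) <= scale (m + 4) * L.
  rewrite mul1r lnV ?posrE//; apply/andP; split.
    by rewrite lerNr -ler_expR lnK ?posrE// -land_widthsE; exact: ltW.
  rewrite lerNl -ler_expR lnK ?posrE//; apply: le_trans tm; rewrite land_widthsE ler_expR lerN2.
  by apply: ler_wpM2r => //; exact: ltW.
have /andP[l1 l2] := lnn; have /andP[l3 l4] := lne.
have l0 : 0 < ln (1 / e) by apply: lt_le_trans l3; exact: mulr_gt0.
have {}m0 : 0 <= 34 / m%:R :> R by apply: divr_ge0.
have d34 : 0 <= d - 34 / m%:R.
  have : 34 / m%:R <= 1 :> R.
    by rewrite ler_pdivrMr ?mul1r ?ler_nat// ltr0n (leq_trans _ m34).
  by move: hd => /andP[? _]; lra.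
apply: le_trans m_eta; rewrite ler_norml; apply/andP; split.
  rewrite lerBrDr addrC ler_pdivlMr//.
  apply: le_trans (ler_wpM2l d34 l4) _; rewrite mulrA.
  by apply: le_trans l1; apply: ler_wpM2r => //; exact: ltW.
rewrite lerBlDr addrC ler_pdivrMr//.
apply: le_trans l2 _; apply: (@le_trans _ _ ((d + 34 / m%:R) * (scale m * L))).
  by rewrite mulrA; apply: ler_wpM2r => //; exact: ltW.
by apply: ler_wpM2l => //; move: hd => /andP[? _]; lra.
Qed.

End Widths.

Theorem corollary1p5 (R : realType) (d : R) (hd : 1 <= d <= 2) :
  exists a : nat -> R,
    [/\ forall i : nat, (1 <= i)%N -> 2 < a i,
        exists C P : nat -> set (R * R), wada_canals a C P &
        forall C P : nat -> set (R * R),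
          wada_canals a C P -> has_box_dim (wada_set C) d].
Proof.
exists (widths d); split.
- exact: widths_gt2.
- apply: wada_canals_exist; [exact: widths_gt2|exact: canal_widths_decrease].
- by move=> C P; exact: wada_box_dim.
Qed.
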